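(* Let $p\in\mathbb{C}[z_1,z_2]$ be semi-stable of bidegree $(n,m)$. If $(w_1,w_2)\in\mathbb{D}\times\mathbb{D}^{-1}$ is a common zero of $p$ and $\tilde p$, then $(\bar w_1,1/\bar w_2)$ is a joint eigenvalue of $(T_1^*,T_2)$ and $(w_1,1/w_2)$ is a joint eigenvalue of $(T_1,T_2^* )$ (with $1/\infty=0$).
   Context: $\mathbb{D}$ is the open unit disk, $\mathbb{T}$ the unit circle, $\mathbb{D}^{-1}=\{z:|z|>1\}\cup\{\infty\}$; a zero $(a,\infty)$ of a polynomial $f$ of bidegree $(n,m)$ means $z_2^mf(a,1/z_2)$ vanishes at $z_2=0$. For $p$ of bidegree $(n,m)$, $\tilde p(z)=z_1^nz_2^m\overline{p(1/\bar z_1,1/\bar z_2)}$; $p$ is semi-stable if it has no zeros in $\mathbb{D}^2$ and $p,\tilde p$ have no common factor. Let $\sigma$ be normalized Lebesgue measure on $\mathbb{T}^2$; in the Hilbert space $L^2(\frac1{|p|^2}d\sigma)$ let $\mathcal{G}$ be the subspace of polynomials of bidegree at most $(n-1,m-1)$, $P$ the orthogonal projection onto $\mathcal{G}$, and $T_j:\mathcal{G}\to\mathcal{G}$, $T_jf=P(z_jf)$, with adjoints $T_j^*$ on $\mathcal{G}$. A joint eigenvalue of a pair $(A,B)$ of operators is $(\mu_1,\mu_2)$ such that some nonzero $f$ satisfies $Af=\mu_1f$, $Bf=\mu_2f$. *)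

(* Defs.v *)
From HB Require Import structures.
From mathcomp Require Import all_boot all_order all_algebra.
From mathcomp Require Import all_classical all_reals all_analysis.
From mathcomp.real_closed Require Import complex.

Set Implicit Arguments.
Unset Strict Implicit.
Unset Printing Implicit Defensive.

Import Order.TTheory GRing.Theory Num.Theory.
Local Open Scope classical_set_scope.
Local Open Scope ring_scope.

(* Bivariate polynomials in C[z1,z2] are represented as {poly {poly R[i]}}:
   the outer variable is z2, the inner one z1, so that the coefficient
   (p`_j)`_i is the coefficient of z1^i z2^j. *)

Definition eval2 (R : realType) (p : {poly {poly R[i]}}) (z1 z2 : R[i]) : R[i] :=
  (map_poly (fun q : {poly R[i]} => q.[z1]) p).[z2].

Definition has_bidegree (R : realType) (n m : nat) (p : {poly {poly R[i]}}) :=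
  [/\ size p = m.+1, (forall j, leq (size p`_j) n.+1) &
      exists j, size p`_j = n.+1].

(* p~(z) = z1^n z2^m conj(p(1/conj z1, 1/conj z2)), written on coefficients *)
Definition ptilde (R : realType) (n m : nat) (p : {poly {poly R[i]}})
  : {poly {poly R[i]}} :=
  \poly_(j < m.+1) \poly_(i < n.+1) conjc ((p`_(m - j))`_(n - i)).

Definition pdivides (R : realType) (q p : {poly {poly R[i]}}) :=
  exists r, p = q * r.

Definition nonconstant (R : realType) (q : {poly {poly R[i]}}) :=
  ~ exists c : R[i], q = (c%:P)%:P.

Definition semi_stable (R : realType) (n m : nat) (p : {poly {poly R[i]}}) :=
  [/\ has_bidegree n m p,
      (forall z1 z2 : R[i], `|z1| < 1 -> `|z2| < 1 -> eval2 p z1 z2 != 0) &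
      ~ exists q, [/\ nonconstant q, pdivides q p & pdivides q (ptilde n m p)]].

(* points of C ∪ {∞}: None stands for ∞ *)
Definition in_Dinv (R : realType) (w : option R[i]) :=
  if w is Some b then 1 < `|b| else true.

Definition inv_opt (R : realType) (w : option R[i]) : R[i] :=
  if w is Some b then b^-1 else 0.

(* (a, w) is a zero of f, f of bidegree (n, m); (a, ∞) is a zero iff
   z2^m f(a, 1/z2) vanishes at z2 = 0, i.e. the z2^m coefficient vanishes at a *)
Definition zero_at (R : realType) (m : nat) (f : {poly {poly R[i]}})
  (a : R[i]) (w : option R[i]) :=
  if w is Some b then eval2 f a b = 0 else (f`_m).[a] = 0.

Definition tor (R : realType) (t : R) : R[i] := Complex (cos t) (sin t).

Definition torus_dom (R : realType) : set (R * R) :=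
  `[0%R, 2 * pi]%classic `*` `[0%R, 2 * pi]%classic.

Definition leb2 (R : realType) :=
  ((@lebesgue_measure R) \x (@lebesgue_measure R))%E.

Definition sqnorm (R : realType) (z : R[i]) : R := complex.Re z ^+ 2 + complex.Im z ^+ 2.

Definition weight (R : realType) (p : {poly {poly R[i]}}) (t : R * R) : R :=
  (sqnorm (eval2 p (tor t.1) (tor t.2)))^-1.

(* the inner product of L^2(1/|p|^2 dσ), σ normalized Lebesgue measure on T^2 *)
Definition ip (R : realType) (p : {poly {poly R[i]}}) (F G : R[i] -> R[i] -> R[i])
  : R[i] :=
  let g t := F (tor t.1) (tor t.2) * conjc (G (tor t.1) (tor t.2))
             * Complex (weight p t) 0 in
  let c : R := (4 * pi ^+ 2)^-1 in
  Complex (c * Rintegral (@leb2 R) (@torus_dom R) (fun t => complex.Re (g t)))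
          (c * Rintegral (@leb2 R) (@torus_dom R) (fun t => complex.Im (g t))).

Definition inG (R : realType) (n m : nat) (p f : {poly {poly R[i]}}) :=
  [/\ (size f <= m)%N, (forall j, leq (size f`_j) n) &
      (\int[@leb2 R]_(t in @torus_dom R)
          (sqnorm (eval2 f (tor t.1) (tor t.2)) * weight p t)%:E < +oo)%E].

(* T f = g, where T f = P(mult * f), mult = z1 or z2 *)
Definition Trel (R : realType) (n m : nat) (p : {poly {poly R[i]}})
  (mult : R[i] -> R[i] -> R[i]) (f g : {poly {poly R[i]}}) :=
  inG n m p g /\
  forall h, inG n m p h ->
    ip p (fun z1 z2 => mult z1 z2 * eval2 f z1 z2 - eval2 g z1 z2) (eval2 h) = 0.

Definition T1rel (R : realType) (n m : nat) (p : {poly {poly R[i]}}) :=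
  Trel n m p (fun z1 _ => z1).
Definition T2rel (R : realType) (n m : nat) (p : {poly {poly R[i]}}) :=
  Trel n m p (fun _ z2 => z2).

Definition adjrel (R : realType) (n m : nat) (p : {poly {poly R[i]}})
  (A : {poly {poly R[i]}} -> {poly {poly R[i]}} -> Prop)
  (f g : {poly {poly R[i]}}) :=
  inG n m p g /\
  forall h k, inG n m p h -> A h k -> ip p (eval2 g) (eval2 h) = ip p (eval2 f) (eval2 k).

Definition joint_eig (R : realType) (n m : nat) (p : {poly {poly R[i]}})
  (A B : {poly {poly R[i]}} -> {poly {poly R[i]}} -> Prop) (mu1 mu2 : R[i]) :=
  exists f, [/\ inG n m p f, f != 0, A f ((mu1%:P)%:P * f) & B f ((mu2%:P)%:P * f)].

(* Main.v *)
Require Import Defs.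
From HB Require Import structures.
From mathcomp Require Import all_boot all_order all_algebra.
From mathcomp Require Import all_classical all_reals all_analysis.
From mathcomp.real_closed Require Import complex.
From mathcomp.real_closed Require polyrcf.
From mathcomp Require Import measurable_realfun zify ring lra.
Import Order.TTheory GRing.Theory Num.Theory.
Import numFieldNormedType.Exports.
Local Open Scope classical_set_scope.
Local Open Scope ring_scope.

Set Implicit Arguments.
Unset Strict Implicit.
Unset Printing Implicit Defensive.

(** With v = 1/w2, evaluation at the common zero is homogenised to
[ev h = \sum_j h_j(w1) v^(m-1-j)] on the polynomials h of z2-degree less than m
that belong to L^2(1/|p|^2). The z2-Bezoutian coefficients [L_j] of p and p~
satisfy [ev L_j = 0] and [<z1^n h, z1^k L_j> = h_(k,j)] (up to normalisation).
If r is orthogonal to G, removing from r its projection onto the [z1^k L_j],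
k < N, keeps [ev r] and creates a gap of length N in the z1-degrees; the limit
along an ultrafilter of what lies below the gap belongs to G and is orthogonal
to G, hence vanishes, so [ev r = 0]. Thus [ev] is represented by some f in G,
and [<z1 h, f> = w1 <h, f>]. The relation [<h, z2 f> = v <h, f>] holds first
for multiples of p(z1,0), which has no zero in the closed disc; hence the
bounded sequence [<z1^k h, (z2 - conj v) f>] satisfies a recurrence all of whose
characteristic roots have modulus > 1, and it is 0. The reflection of f gives
the second joint eigenvector. *)

(** The obstacle is that [p] may vanish on the torus: 1/|p|^2 may then fail to be integrable,
    polynomials may fall outside the space, and a coefficientwise limit is not known to be square
    integrable. The remedy is the z2-resultant [D] of [p] and [ptilde], the determinant of the
    coefficient matrix of the L_j. It is a nonzero polynomial in z1 because there is no common
    factor; zeros of [p] on the torus lie over zeros of [D], so all but countably many slices in z2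
    are harmless; and [D] times any polynomial lies in the space. For |D|^4 <= c put psi = 1 -
    |D|^4/c. The weight 1 - psi^K is divisible by |D|^4, so each side of an inner product can
    receive a factor that puts it in the space: weighted products of arbitrary polynomials become
    true ones, depend on finitely many coefficients, and survive the limit. Letting K grow shows
    first that the limit is square integrable, then that its norm is 0. Only polynomials occur:
    coefficients are bounded by the norm uniformly in the z1-degree, which takes the place of
    completeness. *)

(** * Real and imaginary parts, and the squared modulus *)

Section ComplexParts.
Variable R : realType.
Implicit Types x y : R[i].

Lemma ReD x y : complex.Re (x + y) = complex.Re x + complex.Re y.
Proof. by case: x; case: y. Qed.
Lemma ImD x y : complex.Im (x + y) = complex.Im x + complex.Im y.
Proof. by case: x; case: y. Qed.
Lemma ReN x : complex.Re (- x) = - complex.Re x.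
Proof. by case: x. Qed.
Lemma ImN x : complex.Im (- x) = - complex.Im x.
Proof. by case: x. Qed.
Lemma ReM x y :
  complex.Re (x * y) = complex.Re x * complex.Re y - complex.Im x * complex.Im y.
Proof. by case: x; case: y. Qed.
Lemma ImM x y :
  complex.Im (x * y) = complex.Re x * complex.Im y + complex.Im x * complex.Re y.
Proof. by case: x => a b; case: y. Qed.
Lemma ReJ x : complex.Re (conjc x) = complex.Re x.
Proof. by case: x. Qed.
Lemma ImJ x : complex.Im (conjc x) = - complex.Im x.
Proof. by case: x. Qed.
Lemma ReR (r : R) : complex.Re (r%:C)%C = r. Proof. by []. Qed.
Lemma ImR (r : R) : complex.Im (r%:C)%C = 0. Proof. by []. Qed.

Lemma conjcD x y : conjc (x + y) = conjc x + conjc y.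
Proof. exact: rmorphD. Qed.
Lemma conjcB x y : conjc (x - y) = conjc x - conjc y.
Proof. exact: rmorphB. Qed.
Lemma conjcM x y : conjc (x * y) = conjc x * conjc y.
Proof. exact: rmorphM. Qed.
Lemma conjcX x n : conjc (x ^+ n) = conjc x ^+ n.
Proof. exact: rmorphXn. Qed.
Lemma conjcV x : conjc x^-1 = (conjc x)^-1.
Proof. exact: fmorphV. Qed.
Lemma conjc_sum (I : Type) (s : seq I) (P : pred I) (F : I -> R[i]) :
  conjc (\sum_(i <- s | P i) F i) = \sum_(i <- s | P i) conjc (F i).
Proof. exact: rmorph_sum. Qed.

Lemma complex_ext x y :
  complex.Re x = complex.Re y -> complex.Im x = complex.Im y -> x = y.
Proof. by case: x => a b; case: y => c d /= -> ->. Qed.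

Lemma sqnorm_ge0 x : 0 <= sqnorm x.
Proof. by rewrite /sqnorm addr_ge0 ?sqr_ge0. Qed.
Lemma sqnormM x y : sqnorm (x * y) = sqnorm x * sqnorm y.
Proof. by rewrite /sqnorm ReM ImM; ring. Qed.
Lemma sqnormJ x : sqnorm (conjc x) = sqnorm x.
Proof. by rewrite /sqnorm ReJ ImJ sqrrN. Qed.
Lemma sqnormN x : sqnorm (- x) = sqnorm x.
Proof. by rewrite /sqnorm ReN ImN !sqrrN. Qed.
Lemma sqnorm0 : sqnorm (0 : R[i]) = 0.
Proof. by rewrite /sqnorm /= expr0n addr0. Qed.
Lemma sqnorm1 : sqnorm (1 : R[i]) = 1.
Proof. by rewrite /sqnorm /= expr0n expr1n addr0. Qed.
Lemma sqnorm_eq0 x : (sqnorm x == 0) = (x == 0).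
Proof.
rewrite /sqnorm paddr_eq0 ?sqr_ge0// !sqrf_eq0.
by case: x => a b; rewrite eq_complex.
Qed.
Lemma sqnormX x n : sqnorm (x ^+ n) = sqnorm x ^+ n.
Proof.
by elim: n => [|n IH]; rewrite ?expr0 ?sqnorm1// !exprS sqnormM IH.
Qed.
Lemma sqnormV x : sqnorm x^-1 = (sqnorm x)^-1.
Proof.
have [->|x0] := eqVneq x 0; first by rewrite invr0 sqnorm0 invr0.
have sx0 : sqnorm x != 0 by rewrite sqnorm_eq0.
by apply: (mulfI sx0); rewrite -sqnormM !divff// sqnorm1.
Qed.
Lemma mulJ_sqnorm x : x * conjc x = (sqnorm x)%:C%C.
Proof.
apply: complex_ext; rewrite ?ReM ?ImM ReJ ImJ ?ReR ?ImR /sqnorm; ring.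
Qed.
Lemma sqnormE x : `|x| ^+ 2 = ((sqnorm x)%:C)%C.
Proof. by rewrite sqr_normc mulJ_sqnorm. Qed.
Lemma invc_sqnorm x : x^-1 = conjc x * ((sqnorm x)^-1%:C)%C.
Proof.
have [->|x0] := eqVneq x 0; first by rewrite invr0 conjc0 mul0r.
have sx0 : sqnorm x != 0 by rewrite sqnorm_eq0.
apply: (mulfI x0); rewrite mulrA mulJ_sqnorm divff//.
by rewrite -rmorphM/= divff.
Qed.
Lemma sqnormD_le x y : sqnorm (x + y) <= 2 * (sqnorm x + sqnorm y).
Proof.
rewrite /sqnorm ReD ImD.
set a := complex.Re x; set b := complex.Re y.
set c := complex.Im x; set d := complex.Im y.
have h1 := sqr_ge0 (a - b); have h2 := sqr_ge0 (c - d).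
by nra.
Qed.
Lemma sqnorm_lt1 x : `|x| < 1 -> sqnorm x < 1.
Proof.
move=> x1; rewrite -ltcR -sqnormE.
by rewrite exprn_ilt1.
Qed.
Lemma sqnormRe x : complex.Re x ^+ 2 <= sqnorm x.
Proof. by rewrite /sqnorm lerDl sqr_ge0. Qed.
Lemma sqnormIm x : complex.Im x ^+ 2 <= sqnorm x.
Proof. by rewrite /sqnorm lerDr sqr_ge0. Qed.
Lemma normr_le1D (a : R) : `|a| <= 1 + a ^+ 2.
Proof.
rewrite ler_norml; apply/andP; split.
  by have := sqr_ge0 (1 + a); nra.
by have := sqr_ge0 (1 - a); nra.
Qed.

End ComplexParts.

(** * Integration of complex-valued functions *)

Section ComplexIntegral.
Context d (T : measurableType d) (R : realType).
Variables (mu : {measure set T -> \bar R}) (D : set T).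
Hypothesis mD : measurable D.
Implicit Types F G : T -> R[i].

Definition cmeas F :=
  measurable_fun D (fun t => complex.Re (F t)) /\
  measurable_fun D (fun t => complex.Im (F t)).

Definition cintegrable F :=
  mu.-integrable D (EFin \o (fun t => complex.Re (F t))) /\
  mu.-integrable D (EFin \o (fun t => complex.Im (F t))).

Definition cint F : R[i] :=
  Complex (Rintegral mu D (fun t => complex.Re (F t)))
          (Rintegral mu D (fun t => complex.Im (F t))).

Lemma cmeas_cst c : cmeas (fun _ => c).
Proof. by split; exact: measurable_cst. Qed.

Lemma cmeasD F G : cmeas F -> cmeas G -> cmeas (fun t => F t + G t).
Proof.
move=> [F1 F2] [G1 G2]; split.
- by under eq_fun do rewrite ReD; exact: measurable_funD.
- by under eq_fun do rewrite ImD; exact: measurable_funD.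
Qed.

Lemma cmeasM F G : cmeas F -> cmeas G -> cmeas (fun t => F t * G t).
Proof.
move=> [F1 F2] [G1 G2]; split.
- under eq_fun do rewrite ReM.
  by apply: measurable_funB; exact: measurable_funM.
- under eq_fun do rewrite ImM.
  by apply: measurable_funD; exact: measurable_funM.
Qed.

Lemma cmeasN F : cmeas F -> cmeas (fun t => - F t).
Proof.
move=> [F1 F2]; split.
- by under eq_fun do rewrite ReN; exact: measurable_funN.
- by under eq_fun do rewrite ImN; exact: measurable_funN.
Qed.

Lemma cmeasB F G : cmeas F -> cmeas G -> cmeas (fun t => F t - G t).
Proof. by move=> mF mG; exact: (cmeasD mF (cmeasN mG)). Qed.

Lemma cmeasJ F : cmeas F -> cmeas (fun t => conjc (F t)).
Proof.
move=> [F1 F2]; split.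
- by under eq_fun do rewrite ReJ.
- by under eq_fun do rewrite ImJ; exact: measurable_funN.
Qed.

Lemma cmeasX F n : cmeas F -> cmeas (fun t => F t ^+ n).
Proof.
move=> mF; elim: n => [|n IH].
  by under eq_fun do rewrite expr0; exact: cmeas_cst.
by under eq_fun do rewrite exprS; exact: cmeasM.
Qed.

Lemma cmeas_sum (I : Type) (s : seq I) (P : pred I) (F : I -> T -> R[i]) :
  (forall i, P i -> cmeas (F i)) -> cmeas (fun t => \sum_(i <- s | P i) F i t).
Proof.
move=> mF; elim: s => [|i s IH].
  by under eq_fun do rewrite big_nil; exact: cmeas_cst.
case Pi : (P i).
  by under eq_fun do rewrite big_cons Pi; exact: cmeasD (mF _ Pi) IH.
by under eq_fun do rewrite big_cons Pi.
Qed.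

Lemma measurable_sqnorm F : cmeas F -> measurable_fun D (fun t => sqnorm (F t)).
Proof.
by move=> [F1 F2]; apply: measurable_funD; exact: measurable_funX.
Qed.

Lemma cmeasR (f : T -> R) : measurable_fun D f -> cmeas (fun t => (f t)%:C%C).
Proof. by move=> mf; split => //=; exact: measurable_cst. Qed.

Lemma measurable_invR (f : T -> R) :
  measurable_fun D f -> measurable_fun D (fun t => (f t)^-1).
Proof.
move=> mf; apply: (measurable_comp _ _ _ mf (F := setT)) => //.
(* Inversion is continuous away from 0 only; on {0} it is the constant [0^-1 = 0]. *)
have -> : (setT : set R) = [set 0] `|` ~` [set 0] by rewrite setUv.
apply/measurable_funU; [exact: measurable_set1|by apply: measurableC; exact: measurable_set1|split].
  apply: (eq_measurable_fun (fun=> (0 : R)^-1)); last exact: measurable_cst.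
  by move=> x; rewrite inE => ->.
apply: open_continuous_measurable_fun; first by apply: closed_openC; exact: closed_eq.
move=> x; rewrite inE /= => /eqP x0.
exact: inv_continuous.
Qed.

Lemma cmeasV F : cmeas F -> cmeas (fun t => (F t)^-1).
Proof.
move=> mF; under eq_fun do rewrite invc_sqnorm.
apply: cmeasM; first exact: cmeasJ.
by apply: cmeasR; apply: measurable_invR; exact: measurable_sqnorm.
Qed.

Lemma cintegrable_le F (g : T -> R) : cmeas F ->
  mu.-integrable D (EFin \o g) ->
  (forall t, D t -> `|complex.Re (F t)| <= g t) ->
  (forall t, D t -> `|complex.Im (F t)| <= g t) -> cintegrable F.
Proof.
move=> [F1 F2] ig h1 h2; split; apply: (le_integrable mD _ _ ig).
- exact/measurable_EFinP.
- by move=> t Dt; rewrite /= lee_fin (le_trans (h1 _ Dt))// ler_norm.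
- exact/measurable_EFinP.
- by move=> t Dt; rewrite /= lee_fin (le_trans (h2 _ Dt))// ler_norm.
Qed.

Lemma cintegrableD F G :
  cintegrable F -> cintegrable G -> cintegrable (fun t => F t + G t).
Proof.
move=> [F1 F2] [G1 G2]; split.
- by under eq_fun do rewrite ReD; exact: (integrableD mD F1 G1).
- by under eq_fun do rewrite ImD; exact: (integrableD mD F2 G2).
Qed.

Lemma cintegrableZ c F : cintegrable F -> cintegrable (fun t => c * F t).
Proof.
move=> [F1 F2]; split.
- under eq_fun do rewrite ReM.
  exact: (integrableB mD (integrableZl mD _ F1) (integrableZl mD _ F2)).
- under eq_fun do rewrite ImM.
  exact: (integrableD mD (integrableZl mD _ F2) (integrableZl mD _ F1)).
Qed.

Lemma cintegrableN F : cintegrable F -> cintegrable (fun t => - F t).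
Proof.
move=> /(cintegrableZ (-1)); congr cintegrable.
by apply/funext => t; rewrite mulN1r.
Qed.

Lemma cintegrableB F G :
  cintegrable F -> cintegrable G -> cintegrable (fun t => F t - G t).
Proof. by move=> iF iG; exact: (cintegrableD iF (cintegrableN iG)). Qed.

Lemma cintegrableJ F : cintegrable F -> cintegrable (fun t => conjc (F t)).
Proof.
move=> [F1 F2]; split.
- by under eq_fun do rewrite ReJ.
- by under eq_fun do rewrite ImJ; exact: (integrableN F2).
Qed.

Lemma cintegrable0 : cintegrable (fun _ => 0).
Proof. by split; exact: integrable0. Qed.

Lemma cintegrable_sum (I : Type) (s : seq I) (P : pred I) (F : I -> T -> R[i]) :
  (forall i, P i -> cintegrable (F i)) ->
  cintegrable (fun t => \sum_(i <- s | P i) F i t).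
Proof.
move=> mF; elim: s => [|i s IH].
  by under eq_fun do rewrite big_nil; exact: cintegrable0.
case Pi : (P i).
  by under eq_fun do rewrite big_cons Pi; exact: cintegrableD (mF _ Pi) IH.
by under eq_fun do rewrite big_cons Pi.
Qed.

Lemma eq_cint F G : (forall t, D t -> F t = G t) -> cint F = cint G.
Proof.
by move=> h; congr Complex; apply: eq_Rintegral => t;
  rewrite inE => Dt; rewrite h.
Qed.

Lemma eq_cintegrable F G :
  (forall t, D t -> F t = G t) -> cintegrable F -> cintegrable G.
Proof.
by move=> h [F1 F2]; split; [move: F1|move: F2]; apply: eq_integrable => //= t;
  rewrite inE => Dt; rewrite h.
Qed.

Lemma cintD F G : cintegrable F -> cintegrable G ->
  cint (fun t => F t + G t) = cint F + cint G.
Proof.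
move=> [F1 F2] [G1 G2]; apply: complex_ext; rewrite ?ReD ?ImD /=.
- by under eq_Rintegral do rewrite ReD; exact: RintegralD.
- by under eq_Rintegral do rewrite ImD; exact: RintegralD.
Qed.

Lemma cintZ c F : cintegrable F -> cint (fun t => c * F t) = c * cint F.
Proof.
move=> [F1 F2]; apply: complex_ext; rewrite ?ReM ?ImM /=.
- under eq_Rintegral do rewrite ReM.
  rewrite RintegralB ?RintegralZl//.
    exact: (integrableZl mD _ F1).
  exact: (integrableZl mD _ F2).
- under eq_Rintegral do rewrite ImM.
  rewrite RintegralD ?RintegralZl//.
    exact: (integrableZl mD _ F2).
  exact: (integrableZl mD _ F1).
Qed.

Lemma cintN F : cintegrable F -> cint (fun t => - F t) = - cint F.
Proof.
move=> iF; rewrite -mulN1r -cintZ//; apply: eq_cint => t _; exact/esym/mulN1r.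
Qed.

Lemma cintB F G : cintegrable F -> cintegrable G ->
  cint (fun t => F t - G t) = cint F - cint G.
Proof. by move=> iF iG; rewrite cintD ?cintN//; exact: cintegrableN. Qed.

Lemma cint0 : cint (fun _ => 0) = 0.
Proof. by congr Complex; rewrite Rintegral_cst// mul0r. Qed.

Lemma cint_sum (I : Type) (s : seq I) (P : pred I) (F : I -> T -> R[i]) :
  (forall i, P i -> cintegrable (F i)) ->
  cint (fun t => \sum_(i <- s | P i) F i t) = \sum_(i <- s | P i) cint (F i).
Proof.
move=> mF; elim: s => [|i s IH].
  rewrite big_nil; apply: etrans cint0.
  by apply: eq_cint => t _; rewrite big_nil.
rewrite big_cons -IH; case Pi : (P i).
  rewrite -cintD; [|exact: mF|exact: cintegrable_sum].
  by apply: eq_cint => t _; rewrite big_cons Pi.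
by apply: eq_cint => t _; rewrite big_cons Pi.
Qed.

Lemma cintJ F : cintegrable F -> cint (fun t => conjc (F t)) = conjc (cint F).
Proof.
move=> [F1 F2]; apply: complex_ext; rewrite ?ReJ ?ImJ /=.
- by under eq_Rintegral do rewrite ReJ.
- under eq_Rintegral do rewrite ImJ -mulN1r.
  by rewrite RintegralZl// mulN1r.
Qed.

Definition sqint F :=
  cmeas F /\ mu.-integrable D (EFin \o (fun t => sqnorm (F t))).

Lemma sqintM_bounded F G (M : R) : cmeas F ->
  (forall t, D t -> sqnorm (F t) <= M) -> sqint G ->
  sqint (fun t => F t * G t).
Proof.
move=> mF bF [mG iG]; split; first exact: cmeasM.
apply: (le_integrable mD _ _ (integrableZl mD M iG)).
  by apply/measurable_EFinP/measurable_sqnorm; exact: cmeasM.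
move=> t Dt; rewrite /= lee_fin sqnormM.
rewrite !ger0_norm ?mulr_ge0 ?sqnorm_ge0 ?ler_wpM2r ?sqnorm_ge0 ?bF//.
exact: le_trans (sqnorm_ge0 _) (bF _ Dt).
Qed.

Lemma sqintD F G : sqint F -> sqint G -> sqint (fun t => F t + G t).
Proof.
move=> [mF iF] [mG iG]; split; first exact: cmeasD.
apply: (le_integrable mD _ _ (integrableZl mD 2 (integrableD mD iF iG))).
  by apply/measurable_EFinP/measurable_sqnorm; exact: cmeasD.
move=> t Dt; rewrite /= lee_fin !ger0_norm ?sqnorm_ge0 ?sqnormD_le//.
by rewrite mulr_ge0// addr_ge0// sqnorm_ge0.
Qed.

Lemma sqintZ c F : sqint F -> sqint (fun t => c * F t).
Proof.
by apply: (@sqintM_bounded (fun=> c) F (sqnorm c)) => //; exact: cmeas_cst.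
Qed.

Lemma eq_sqint F G : (forall t, D t -> F t = G t) -> sqint F -> sqint G.
Proof.
move=> h [[m1 m2] i1]; split; first split.
- by apply: eq_measurable_fun m1 => t; rewrite inE => Dt; rewrite h.
- by apply: eq_measurable_fun m2 => t; rewrite inE => Dt; rewrite h.
by apply: eq_integrable i1 => // t; rewrite inE => Dt /=; rewrite h.
Qed.

Lemma sqintB F G : sqint F -> sqint G -> sqint (fun t => F t - G t).
Proof.
move=> sF /(sqintZ (-1)) sG; apply: eq_sqint (sqintD sF sG) => t _.
by rewrite mulN1r.
Qed.

(** Real and imaginary parts of F conj G are dominated by |F|^2 + |G|^2. *)
Lemma cintegrable_mulJ F G : sqint F -> sqint G ->
  cintegrable (fun t => F t * conjc (G t)).
Proof.
move=> [mF iF] [mG iG].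
apply: (cintegrable_le _ (integrableD mD iF iG)).
- by apply: cmeasM => //; exact: cmeasJ.
- move=> t Dt; rewrite ReM ReJ ImJ /sqnorm /= ler_norml.
  set a := complex.Re (F t); set b := complex.Im (F t).
  set a' := complex.Re (G t); set b' := complex.Im (G t).
  have := sqr_ge0 (a - a'); have := sqr_ge0 (b - b').
  have := sqr_ge0 (a + a'); have := sqr_ge0 (b + b').
  have := sqr_ge0 a; have := sqr_ge0 b; have := sqr_ge0 a'; have := sqr_ge0 b'.
  by move=> *; apply/andP; split; nra.
- move=> t Dt; rewrite ImM ReJ ImJ /sqnorm /= ler_norml.
  set a := complex.Re (F t); set b := complex.Im (F t).
  set a' := complex.Re (G t); set b' := complex.Im (G t).
  have := sqr_ge0 (a - b'); have := sqr_ge0 (b - a').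
  have := sqr_ge0 (a + b'); have := sqr_ge0 (b + a').
  have := sqr_ge0 a; have := sqr_ge0 b; have := sqr_ge0 a'; have := sqr_ge0 b'.
  by move=> *; apply/andP; split; nra.
Qed.

Lemma sqint_bounded F (M : R) : (mu D < +oo)%E -> cmeas F ->
  (forall t, D t -> sqnorm (F t) <= M) -> sqint F.
Proof.
move=> muD mF bF; split => //.
apply: measurable_bounded_integrable => //; first exact: measurable_sqnorm.
exists M; split; first exact: num_real.
move=> N MN t Dt /=; rewrite ger0_norm ?sqnorm_ge0//.
exact: le_trans (bF _ Dt) (ltW MN).
Qed.

Lemma sqint_cintegrable F : (mu D < +oo)%E -> sqint F -> cintegrable F.
Proof.
move=> muD sF; have s1 : sqint (fun _ => 1).
  apply: (@sqint_bounded _ 1) => //.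
  by move=> t _; rewrite sqnorm1.
apply: eq_cintegrable (cintegrable_mulJ sF s1) => t _.
by rewrite conjc1 mulr1.
Qed.

End ComplexIntegral.
Arguments cint : simpl never.

(** * The L^2 inner product and the Cauchy-Schwarz inequality *)

Section InnerProduct.
Context d (T : measurableType d) (R : realType).
Variables (mu : {measure set T -> \bar R}) (D : set T).
Hypothesis mD : measurable D.
Implicit Types F G H : T -> R[i].
Local Notation sqint := (sqint mu D).

Definition cip F G := cint mu D (fun t => F t * conjc (G t)).
Arguments cip : simpl never.
Definition sqnormI F : R := Rintegral mu D (fun t => sqnorm (F t)).

Lemma cipDl F G H : sqint F -> sqint G -> sqint H ->
  cip (fun t => F t + G t) H = cip F H + cip G H.
Proof.
move=> sF sG sH; rewrite /cip -cintD//; try exact: cintegrable_mulJ.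
by apply: eq_cint => t _; rewrite mulrDl.
Qed.

Lemma cipJ F G : sqint F -> sqint G -> cip G F = conjc (cip F G).
Proof.
move=> sF sG; rewrite /cip -cintJ//; last exact: cintegrable_mulJ.
by apply: eq_cint => t _; rewrite conjcM conjcK mulrC.
Qed.

Lemma cipZl c F H : sqint F -> sqint H -> cip (fun t => c * F t) H = c * cip F H.
Proof.
move=> sF sH; rewrite /cip -cintZ//; try exact: cintegrable_mulJ.
by apply: eq_cint => t _; rewrite mulrA.
Qed.

Lemma cipDr F G H : sqint F -> sqint G -> sqint H ->
  cip H (fun t => F t + G t) = cip H F + cip H G.
Proof.
move=> sF sG sH; rewrite (cipJ (sqintD mD sF sG) sH) cipDl// conjcD.
by rewrite -!cipJ.
Qed.

Lemma cipZr c F H : sqint F -> sqint H ->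
  cip H (fun t => c * F t) = conjc c * cip H F.
Proof.
move=> sF sH; rewrite (cipJ (sqintZ mD c sF) sH) cipZl// conjcM.
by rewrite -!cipJ.
Qed.

Lemma cipBl F G H : sqint F -> sqint G -> sqint H ->
  cip (fun t => F t - G t) H = cip F H - cip G H.
Proof.
move=> sF sG sH; rewrite /cip -cintB//; try exact: cintegrable_mulJ.
by apply: eq_cint => t _; rewrite mulrBl.
Qed.

Lemma cipBr F G H : sqint F -> sqint G -> sqint H ->
  cip H (fun t => F t - G t) = cip H F - cip H G.
Proof.
move=> sF sG sH; rewrite (cipJ (sqintB mD sF sG) sH) cipBl// conjcB.
by rewrite -!cipJ.
Qed.

Lemma sqnormI_ge0 F : 0 <= sqnormI F.
Proof. by apply: Rintegral_ge0 => t _; exact: sqnorm_ge0. Qed.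

Lemma cip_self F : cip F F = (sqnormI F)%:C%C.
Proof.
rewrite /cip; have -> : cint mu D (fun t => F t * conjc (F t)) =
  cint mu D (fun t => (sqnorm (F t))%:C%C).
  by apply: eq_cint => t _; rewrite mulJ_sqnorm.
by apply: complex_ext; rewrite //= Rintegral_cst// mul0r.
Qed.

Lemma sqnormI_subZ c F G : sqint F -> sqint G ->
  sqnormI (fun t => F t - c * G t) =
  sqnormI F - 2 * complex.Re (conjc c * cip F G) + sqnorm c * sqnormI G.
Proof.
move=> sF sG; have sG' := sqintZ mD c sG.
apply: complexI; rewrite -cip_self cipBl//; last exact: sqintB.
rewrite !cipBr// cipZl// !cipZr// cipZl// (cipJ sF sG) !cip_self.
move: (cip F G) => z; apply: complex_ext.
  by rewrite !(ReD, ReN, ReM, ImM, ImD, ImN, ReJ, ImJ, ReR, ImR) /sqnorm; ring.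
by rewrite !(ReD, ReN, ReM, ImM, ImD, ImN, ReJ, ImJ, ReR, ImR) /sqnorm; ring.
Qed.

Lemma cip_CauchySchwarz F G : sqint F -> sqint G ->
  sqnorm (cip F G) <= sqnormI F * sqnormI G.
Proof.
move=> sF sG; set z := cip F G; set q := sqnorm z.
(* Expanding |F - s z G|^2 >= 0 for real s leaves a quadratic in s, to be used at its minimiser s =
   1/|G|^2 when G has positive norm. *)
have H (s : R) : 0 <= sqnormI F - 2 * s * q + s ^+ 2 * q * sqnormI G.
  have := sqnormI_ge0 (fun t => F t - (s%:C%C * z) * G t).
  rewrite sqnormI_subZ// -/z => /le_trans; apply; rewrite le_eqVlt; apply/orP; left.
  apply/eqP; rewrite /q /sqnorm.
  by rewrite !(ReM, ImM, ReJ, ImJ, ReR, ImR); ring.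
have q0 : 0 <= q by exact: sqnorm_ge0.
have F0 := sqnormI_ge0 F; have := sqnormI_ge0 G.
rewrite le_eqVlt => /predU1P[G0|G0].
  rewrite -G0 mulr0 leNgt; apply/negP => qp.
  (* With |G| = 0 the bound is affine in s, and this s gives it the value -1. *)
  have := H ((sqnormI F + 1) / (2 * q)); rewrite -G0 mulr0 addr0.
  have -> : 2 * ((sqnormI F + 1) / (2 * q)) * q = sqnormI F + 1.
    by field; rewrite gt_eqF.
  by lra.
have := H (sqnormI G)^-1.
have -> : sqnormI F - 2 * (sqnormI G)^-1 * q + (sqnormI G)^-1 ^+ 2 * q * sqnormI G
  = sqnormI F - q / sqnormI G by field; rewrite gt_eqF.
by rewrite subr_ge0 ler_pdivrMr.
Qed.

Lemma eq_cip F F' G G' : (forall t, D t -> F t = F' t) ->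
  (forall t, D t -> G t = G' t) -> cip F G = cip F' G'.
Proof. by move=> hF hG; apply: eq_cint => t Dt; rewrite hF ?hG. Qed.

End InnerProduct.

(** * The torus, Fubini with a countable exceptional set, and moments on the circle *)

Section Torus.
Variable R : realType.
Local Notation I2pi := (`[0%R, 2 * pi]%classic : set R).

Lemma pi2_gt0 : 0 < 2 * pi :> R.
Proof. by rewrite mulr_gt0// pi_gt0. Qed.

Lemma measurable_torus : measurable (@torus_dom R).
Proof. by apply: measurableX; exact: measurable_itv. Qed.

Lemma leb_I2pi : (@lebesgue_measure R I2pi = (2 * pi)%:E)%E.
Proof. by rewrite lebesgue_measure_itv /= lte_fin pi2_gt0 sube0. Qed.

Lemma leb2_torus : (@leb2 R (@torus_dom R) = (4 * pi ^+ 2)%:E)%E.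
Proof.
rewrite /leb2 product_measure1E; [|exact: measurable_itv|exact: measurable_itv].
by rewrite /= !leb_I2pi -EFinM; congr EFin; ring.
Qed.

Lemma leb2_torus_lty : (@leb2 R (@torus_dom R) < +oo)%E.
Proof. by rewrite leb2_torus ltry. Qed.

Lemma leb_I2pi_lty : (@lebesgue_measure R I2pi < +oo)%E.
Proof. by rewrite leb_I2pi ltry. Qed.

Lemma sqnorm_tor (t : R) : sqnorm (tor t) = 1.
Proof. by rewrite /sqnorm /= cos2Dsin2. Qed.

Lemma torJ (t : R) : conjc (tor t) * tor t = 1.
Proof. by rewrite mulrC mulJ_sqnorm sqnorm_tor. Qed.

Lemma tor_neq0 (t : R) : tor t != 0.
Proof. by rewrite -sqnorm_eq0 sqnorm_tor oner_neq0. Qed.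

Lemma torX (t : R) n : tor t ^+ n = tor (n%:R * t).
Proof.
elim: n => [|n IH]; first by rewrite expr0 mul0r /tor cos0 sin0.
rewrite exprS IH -natr1 mulrDl mul1r addrC.
apply: complex_ext; rewrite ?ReM ?ImM /= ?cosD ?sinD //; ring.
Qed.

Lemma cmeas_tor d (T : measurableType d) (D : set T) (f : T -> R) :
  measurable_fun D f -> cmeas D (fun t => tor (f t)).
Proof.
move=> mf; split => /=.
- apply: (measurableT_comp _ mf); apply: continuous_measurable_fun.
  exact: continuous_cos.
- apply: (measurableT_comp _ mf); apply: continuous_measurable_fun.
  exact: continuous_sin.
Qed.

(** Two equal points give cos(t - s) = 1 = 1 - 2 sin^2((t - s)/2), while the half-angle lies
    strictly between 0 and pi. *)
Lemma tor_inj : {in `[0%R, 2 * pi[ &, injective (@tor R)}.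
Proof.
suff H (s t : R) : 0 <= s -> s < t -> t < 2 * pi -> tor s <> tor t.
  move=> s t; rewrite !in_itv /= => /andP[s0 s2] /andP[t0 t2] st.
  have [h|h|//] := ltgtP s t; exfalso; [exact: (H s t)|
    by apply: (H t s)].
move=> s0 st t2 [] hc hs.
pose x := (t - s) / 2.
have x0 : 0 < x < pi by apply/andP; split; rewrite /x; lra.
have := sin_gt0_pi x0.
have cx : cos (x + x) = 1.
  have -> : x + x = t - s by rewrite /x; field.
  rewrite cosB hc hs -expr2 -[X in _ + X]expr2; exact: cos2Dsin2.
have : cos (x + x) = 1 - 2 * sin x ^+ 2.
  by rewrite cosD -!expr2 -[cos x ^+ 2](addrK (sin x ^+ 2)) cos2Dsin2; ring.
rewrite cx => h; have : sin x ^+ 2 = 0 by lra.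
by move/eqP; rewrite sqrf_eq0 => /eqP ->; rewrite ltxx.
Qed.

Lemma tor_roots_countable (D : {poly R[i]}) : D != 0 ->
  countable [set t : R | I2pi t /\ D.[tor t] = 0].
Proof.
move=> D0; have [rs Drs] := closed_field_poly_normal D.
have rsP z : D.[z] = 0 -> z \in rs.
  move/eqP; rewrite Drs hornerZ mulf_eq0 lead_coef_eq0 (negPf D0) /=.
  by rewrite -[_ == 0]/(root _ _) root_prod_XsubC.
(* The angle 2 pi repeats the point of angle 0: injectivity serves the half-open interval, and the
   endpoint is added by hand. *)
apply: (@sub_countable _ _ _
  ([set t | (0 <= t < 2 * pi) /\ tor t \in rs] `|` [set 2 * pi])).
  apply: subset_card_le => t [] /=; rewrite in_itv /= => /andP[t0 t2] Dt.
  have [t2'|t2'] := ltP t (2 * pi).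
    by left; split; [apply/andP|exact: rsP].
  by right; apply/eqP; rewrite eq_le t2 t2'.
apply: finite_set_countable; rewrite finite_setU; split => //.
have /eq_finite_set <- : (@tor R @` [set t | (0 <= t < 2 * pi) /\ tor t \in rs]
    #= [set t | (0 <= t < 2 * pi) /\ tor t \in rs])%card.
  apply: inj_card_eq => s t; rewrite !inE => -[h1 _] [h2 _]; apply: tor_inj; by rewrite in_itv /=.
apply: (@sub_finite_set _ _ [set` rs]) => //.
by move=> _ [t [_ h] <-].
Qed.

Section Fubini.
Variables (f : R * R -> R) (N : set R).
Hypothesis cN : countable N.
Hypothesis intf : (@leb2 R).-integrable (@torus_dom R) (EFin \o f).

Let intfT : (@leb2 R).-integrable setT ((EFin \o f) \_ (@torus_dom R)).
Proof. exact: ((@integrable_mkcond _ _ _ (@leb2 R) _ (EFin \o f) measurable_torus).1 intf). Qed.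

Let ae0 (G : R -> \bar R) : measurable_fun setT G ->
  (forall t, ~ N t -> G t = 0%E) -> (\int[lebesgue_measure]_t G t = 0)%E.
Proof.
move=> mG G0; rewrite (ae_eq_integral (cst 0%E))//; first exact: integral0.
exists N; split; first exact: (countable_measurable (fun x => measurable_set1 x)).
  exact: countable_lebesgue_measure0.
by move=> t /= /not_implyP[_ h]; apply: contrapT => nN; apply: h; exact: G0.
Qed.

(** The exceptional set is meant for the zeros of the resultant, over which a slice may fail to be
    integrable. *)
Lemma torus_integral12_eq0 :
  (forall t, I2pi t -> ~ N t ->
    (\int[lebesgue_measure]_(s in I2pi) (f (t, s))%:E = 0)%E) ->
  Rintegral (@leb2 R) (@torus_dom R) f = 0.
Proof.
move=> H; rewrite /Rintegral integral_mkcond -(integral12_prod_meas1 intfT).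
rewrite ae0//; first exact: (measurable_fubini_F intfT).
move=> t nN; rewrite /fubini_F.
have [tI|tI] := pselect (I2pi t); last first.
  rewrite integral0_eq// => s _; rewrite patchE memNset//.
  by case=> h1 h2; exact: tI.
rewrite -[RHS](H _ tI nN) [RHS]integral_mkcond; apply: eq_integral => s _.
rewrite !patchE; have [sI|sI] := pselect (I2pi s).
  by rewrite !mem_set.
by rewrite !memNset//; case.
Qed.

Lemma torus_integral21_eq0 :
  (forall s, I2pi s -> ~ N s ->
    (\int[lebesgue_measure]_(t in I2pi) (f (t, s))%:E = 0)%E) ->
  Rintegral (@leb2 R) (@torus_dom R) f = 0.
Proof.
move=> H; rewrite /Rintegral integral_mkcond -(integral21_prod_meas1 intfT).
rewrite ae0//; first exact: (measurable_fubini_G intfT).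
move=> s nN; rewrite /fubini_G.
have [sI|sI] := pselect (I2pi s); last first.
  rewrite integral0_eq// => t _; rewrite patchE memNset//.
  by case=> h1 h2; exact: sI.
rewrite -[RHS](H _ sI nN) [RHS]integral_mkcond; apply: eq_integral => t _.
rewrite !patchE; have [tI|tI] := pselect (I2pi t).
  by rewrite !mem_set.
by rewrite !memNset//; case.
Qed.

End Fubini.

Lemma cint_eq0 d (T : measurableType d) (mu : {measure set T -> \bar R})
    (D : set T) (F : T -> R[i]) : measurable D ->
  cintegrable mu D F -> cint mu D F = 0 ->
  (\int[mu]_(t in D) (complex.Re (F t))%:E = 0)%E /\
  (\int[mu]_(t in D) (complex.Im (F t))%:E = 0)%E.
Proof.
move=> mD [F1 F2] [h1 h2]; split.
- by rewrite -(fineK (integrable_fin_num mD F1)) -[fine _]/(Rintegral _ _ _) h1.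
- by rewrite -(fineK (integrable_fin_num mD F2)) -[fine _]/(Rintegral _ _ _) h2.
Qed.

Lemma torus_cint12_eq0 (F : R * R -> R[i]) (N : set R) : countable N ->
  cintegrable (@leb2 R) (@torus_dom R) F ->
  (forall t, I2pi t -> ~ N t ->
    cintegrable lebesgue_measure I2pi (fun s => F (t, s)) /\
    cint lebesgue_measure I2pi (fun s => F (t, s)) = 0) ->
  cint (@leb2 R) (@torus_dom R) F = 0.
Proof.
move=> cN [F1 F2] H; rewrite /cint.
rewrite (torus_integral12_eq0 cN F1); last first.
  move=> t It nN; have [a b] := H t It nN.
  by refine (proj1 (cint_eq0 _ a b)); exact: measurable_itv.
rewrite (torus_integral12_eq0 cN F2)// => t It nN; have [a b] := H t It nN.
by refine (proj2 (cint_eq0 _ a b)); exact: measurable_itv.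
Qed.

Lemma torus_cint21_eq0 (F : R * R -> R[i]) (N : set R) : countable N ->
  cintegrable (@leb2 R) (@torus_dom R) F ->
  (forall s, I2pi s -> ~ N s ->
    cintegrable lebesgue_measure I2pi (fun t => F (t, s)) /\
    cint lebesgue_measure I2pi (fun t => F (t, s)) = 0) ->
  cint (@leb2 R) (@torus_dom R) F = 0.
Proof.
move=> cN [F1 F2] H; rewrite /cint.
rewrite (torus_integral21_eq0 cN F1); last first.
  move=> t It nN; have [a b] := H t It nN.
  by refine (proj1 (cint_eq0 _ a b)); exact: measurable_itv.
rewrite (torus_integral21_eq0 cN F2)// => t It nN; have [a b] := H t It nN.
by refine (proj2 (cint_eq0 _ a b)); exact: measurable_itv.
Qed.

Lemma cos_n2pi n : cos (n%:R * (2 * pi)) = 1 :> R.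
Proof.
rewrite -[n%:R * _]add0r mulr_natl [2 * pi]mulr_natl.
by rewrite (periodicn (@cosD2pi R)) cos0.
Qed.

Lemma sin_n2pi n : sin (n%:R * (2 * pi)) = 0 :> R.
Proof.
rewrite -[n%:R * _]add0r mulr_natl [2 * pi]mulr_natl.
by rewrite (periodicn (@sinD2pi R)) sin0.
Qed.

Lemma is_derive_scale (f f' : R -> R) (a : R) :
  (forall x : R, is_derive x (1 : R) f (f' x)) ->
  forall x : R, is_derive x (1 : R) (fun t : R => f (a * t)) (a * f' (a * x)).
Proof.
move=> df x; have h := df (a * x).
have h2 : is_derive x (1 : R) (fun t : R => a * t) a.
  by apply: is_derive_eq; rewrite ?scaler0 ?add0r ?addr0 /GRing.scale /= mulr1.
by have := is_derive1_comp h h2; rewrite mulrC.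
Qed.

Lemma integral_I2pi_eq0 (F f : R -> R) : (forall x : R, is_derive x (1 : R) F (f x)) ->
  continuous f -> F 0 = F (2 * pi) ->
  (\int[lebesgue_measure]_(t in I2pi) (f t)%:E = 0)%E.
Proof.
move=> dF cf F0; rewrite (@continuous_FTC2 _ f F 0 (2 * pi)).
- by rewrite F0 subee.
- exact: pi2_gt0.
- exact: continuous_subspaceT.
- have cF : continuous F.
    move=> x; apply: differentiable_continuous; apply/derivable1_diffP.
    exact: (@ex_derive _ _ _ _ _ _ _ (dF x)).
  split.
  + by move=> x _; exact: (@ex_derive _ _ _ _ _ _ _ (dF x)).
  + by apply: cvg_at_right_filter; exact: cF.
  + by apply: cvg_at_left_filter; exact: cF.
- by move=> x _; rewrite derive1E; exact: (@derive_val _ _ _ _ _ _ _ (dF x)).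
Qed.

Lemma cint_torX n :
  cint (@lebesgue_measure R) I2pi (fun t => tor t ^+ n) =
  if n == 0%N then (2 * pi)%:C%C else 0.
Proof.
case: n => [|n] /=.
  apply: complex_ext => /=.
    apply: (etrans (Rintegral_cst _ _ _)); first exact: measurable_itv.
    rewrite mul1r; exact: (congr1 fine leb_I2pi).
  apply: (etrans (Rintegral_cst _ _ _)); first exact: measurable_itv.
  by rewrite mul0r.
set a : R := n.+1%:R.
have a0 : a != 0 by rewrite pnatr_eq0.
apply: complex_ext; rewrite /= /Rintegral.
- under eq_integral do rewrite torX /=.
  have dF (x : R) : is_derive x (1 : R) (fun t : R => a^-1 * sin (a * t)) (cos (a * x)).
    have h := is_derive_scale a (@is_derive_sin R) x.
    apply: is_derive_eq.
    by rewrite /GRing.scale /= ?mulr0 ?addr0 mulrA mulVf// mul1r.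
  rewrite (integral_I2pi_eq0 dF)//; last by rewrite mulr0 sin0 sin_n2pi.
  move=> x; apply: continuous_comp; last exact: continuous_cos.
  exact: mulrl_continuous.
- under eq_integral do rewrite torX /=.
  have dF (x : R) : is_derive x (1 : R) (fun t : R => - (a^-1 * cos (a * t))) (sin (a * x)).
    have h := is_derive_scale a (@is_derive_cos R) x.
    apply: is_derive_eq.
    by rewrite /GRing.scale /= ?mulr0 ?addr0 !mulrN opprK mulrA mulVf// mul1r.
  rewrite (integral_I2pi_eq0 dF)//; last by rewrite mulr0 cos0 cos_n2pi.
  move=> x; apply: continuous_comp; last exact: continuous_sin.
  exact: mulrl_continuous.
Qed.

End Torus.

(** * Bounded recurrences and analytic quotients in one variable *)

Section OneVariable.
Variable R : realType.
Implicit Types (P Q : {poly R[i]}) (u : nat -> R[i]).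

(** Left side, at position k, of the linear recurrence with characteristic polynomial [P]. *)
Definition recur u P k := \sum_(i < size P) P`_i * u (k + i)%N.

Lemma recur_wide u P k N : (size P <= N)%N ->
  recur u P k = \sum_(i < N) P`_i * u (k + i)%N.
Proof.
move=> sPN; rewrite /recur (big_ord_widen N (fun i => P`_i * u (k + i)%N) sPN).
rewrite big_mkcond; apply: eq_bigr => i _; case: ltnP => // h.
by rewrite nth_default ?mul0r.
Qed.

(** A root [r] of the characteristic polynomial splits off as the operator shift - r on sequences,
    which allows induction on the number of roots. *)
Lemma recurMX u Q r k :
  recur u (Q * ('X - r%:P)) k = recur (fun i => u i.+1 - r * u i) Q k.
Proof.
have sz : (size (Q * ('X - r%:P))%R <= (size Q).+1)%N.
  by apply: leq_trans (size_polyMleq _ _) _; rewrite size_XsubC addn2.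
rewrite (recur_wide _ _ sz) /recur big_ord_recl.
under [RHS]eq_bigr do rewrite mulrBr.
rewrite sumrB.
have E i : (Q * ('X - r%:P))`_i = (if i == 0%N then 0 else Q`_i.-1) - Q`_i * r.
  by rewrite mulrBr coefB coefMX coefMC.
rewrite E /= addn0.
under eq_bigr do rewrite E /bump /= add1n mulrBl addnS.
rewrite sumrB sub0r addrCA; congr (_ + _).
rewrite mulNr -opprD; congr (- _).
have -> : \sum_(i < size Q) Q`_i * (r * u (k + i)%N) =
  \sum_(i < (size Q).+1) Q`_i * (r * u (k + i)%N).
  by rewrite big_ord_recr /= nth_default// mul0r addr0.
rewrite big_ord_recl /= addn0 mulrA; congr (_ + _).
by apply: eq_bigr => i _; rewrite /bump /= add1n addnS mulrA.
Qed.

(** One root r is split off at a time. By induction u_(i+1) = r u_i, and |r| > 1 makes every nonzero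
    solution unbounded. *)
Lemma bounded_recur_eq0 u P (M : R) : P != 0 ->
  (forall z, sqnorm z <= 1 -> P.[z] != 0) ->
  (forall k, sqnorm (u k) <= M) -> (forall k, recur u P k = 0) ->
  forall k, u k = 0.
Proof.
move: {2}(size P) (leqnn (size P)) => s; elim: s P u M => [|s IH] P u M sP P0.
  by move: sP P0; rewrite leqn0 size_poly_eq0 => ->.
move=> hP bu ru k.
have [s1|s1] := leqP (size P) 1.
  have := ru k; rewrite (recur_wide _ _ s1) big_ord1 addn0 => /eqP.
  rewrite mulf_eq0 => /predU1P[h|/eqP//].
  by case/eqP: P0; rewrite (size1_polyC s1) h.
have /closed_rootP[r /factor_theorem[Q PQ]] : size P != 1%N by rewrite gtn_eqF.
have Q0 : Q != 0 by apply: contra_neq P0 => Q0; rewrite PQ Q0 mul0r.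
have r1 : 1 < sqnorm r.
  rewrite ltNge; apply/negP => /hP; rewrite PQ hornerM !hornerE subrr.
  by rewrite mulr0 eqxx.
have sQ : (size Q <= s)%N.
  by move: sP; rewrite PQ size_Mmonic ?monicXsubC// size_XsubC addn2.
pose w i := u i.+1 - r * u i.
have w0 : forall i, w i = 0.
  apply: (IH Q w (2 * (M + sqnorm r * M))) => // [z z1|i|i].
  - by have := hP z z1; rewrite PQ hornerM mulf_eq0 negb_or => /andP[].
  - apply: (le_trans (sqnormD_le _ _)); rewrite sqnormN sqnormM.
    by rewrite ler_pM2l// lerD// ler_pM2l ?bu// (lt_trans _ r1).
  - by rewrite -recurMX -PQ.
have uE j : u (k + j)%N = r ^+ j * u k.
  elim: j => [|j IHj]; first by rewrite addn0 mul1r.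
  by move/eqP: (w0 (k + j)%N); rewrite subr_eq0 addnS => /eqP ->; rewrite IHj exprS mulrA.
apply/eqP; rewrite -sqnorm_eq0; apply/negPn/negP => uk.
have uk0 : 0 < sqnorm (u k) by rewrite lt_def uk sqnorm_ge0.
(* Bernoulli's inequality: linear growth is already enough to exceed the bound [M]. *)
have bern j : 1 + j%:R * (sqnorm r - 1) <= sqnorm r ^+ j.
  elim: j => [|j IHj]; first by rewrite mul0r addr0 expr0.
  rewrite exprS -natr1.
  have h0 : 0 <= j%:R * (sqnorm r - 1) ^+ 2 :> R by rewrite mulr_ge0 ?sqr_ge0.
  have : sqnorm r * (1 + j%:R * (sqnorm r - 1)) <= sqnorm r * sqnorm r ^+ j.
    by rewrite ler_pM2l// (lt_trans _ r1).
  by apply: le_trans; rewrite -subr_ge0; apply: le_trans h0 _; rewrite le_eqVlt;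
    apply/orP; left; apply/eqP; ring.
have M0 : 0 <= M by exact: le_trans (sqnorm_ge0 _) (bu 0%N).
pose y := M / sqnorm (u k) / (sqnorm r - 1).
have y0 : 0 <= y by rewrite /y !divr_ge0 ?subr_ge0 ?(ltW r1)// ltW.
have /(archi_boundP) := y0; set j := Num.bound y => yj.
have := bu (k + j)%N; rewrite uE sqnormM sqnormX leNgt => /negP; apply.
rewrite -ltr_pdivrMr//; apply: lt_le_trans (bern j).
have : M / sqnorm (u k) < j%:R * (sqnorm r - 1).
  by rewrite -ltr_pdivrMr ?subr_gt0.
by lra.
Qed.

(** Factoring over the roots takes the place of compactness: each factor satisfies |z - r| >= |r| -
    1 > 0 on the closed disc. *)
Lemma poly_lower_bound P : (forall z, sqnorm z <= 1 -> P.[z] != 0) ->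
  exists2 e : R, 0 < e & forall z, sqnorm z <= 1 -> e <= sqnorm P.[z].
Proof.
move: {2}(size P) (leqnn (size P)) => s; elim: s P => [|s IH] P sP hP.
  move: sP; rewrite leqn0 size_poly_eq0 => /eqP P0.
  by have := hP 0; rewrite P0 horner0 eqxx sqnorm0 ler01 => /(_ isT).
have [s1|s1] := leqP (size P) 1.
  have := hP 0; rewrite sqnorm0 ler01 (size1_polyC s1) hornerC => /(_ isT) c0.
  exists (sqnorm P`_0); first by rewrite lt_def sqnorm_eq0 c0 sqnorm_ge0.
  by move=> z _; rewrite hornerC.
have /closed_rootP[r /factor_theorem[Q PQ]] : size P != 1%N by rewrite gtn_eqF.
have P0 : P != 0 by apply: contraTneq s1 => ->; rewrite size_poly0.
have Q0 : Q != 0 by apply: contra_neq P0 => Q0; rewrite PQ Q0 mul0r.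
have r1 : 1 < sqnorm r.
  rewrite ltNge; apply/negP => /hP; rewrite PQ hornerM !hornerE subrr.
  by rewrite mulr0 eqxx.
have sQ : (size Q <= s)%N.
  by move: sP; rewrite PQ size_Mmonic ?monicXsubC// size_XsubC addn2.
have [z z1|e e0 he] := IH Q sQ.
  by have := hP z z1; rewrite PQ hornerM mulf_eq0 negb_or => /andP[].
pose a : R := Num.sqrt (sqnorm r).
have a2 : a ^+ 2 = sqnorm r by rewrite sqr_sqrtr// ltW// (lt_trans _ r1).
have a1 : 1 < a by rewrite -(@ltr_pXn2r _ 2)// ?nnegrE ?sqrtr_ge0// a2 expr1n.
exists (e * (a - 1) ^+ 2); first by rewrite mulr_gt0// exprn_gt0// subr_gt0.
move=> z z1; rewrite PQ hornerM sqnormM hornerXsubC.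
apply: (@le_trans _ _ (sqnorm Q.[z] * (a - 1) ^+ 2)).
  by apply: ler_wpM2r; [exact: sqr_ge0|exact: he].
rewrite ler_wpM2l ?sqnorm_ge0//.
pose b : R := Num.sqrt (sqnorm z).
have b2 : b ^+ 2 = sqnorm z by rewrite sqr_sqrtr// sqnorm_ge0.
have b0 : 0 <= b by exact: sqrtr_ge0.
have b1 : b <= 1 by rewrite -(@ler_pXn2r _ 2)// ?nnegrE// b2 expr1n.
have h : (a - 1) ^+ 2 <= (a - b) ^+ 2.
  by rewrite ler_pXn2r// ?nnegrE; lra.
apply: le_trans h _; rewrite sqrrB a2 b2 /sqnorm ReD ImD ReN ImN.
set x := complex.Re z; set y := complex.Im z.
set x' := complex.Re r; set y' := complex.Im r.
(* |z - r| >= |r| - |z| comes down to the Cauchy-Schwarz inequality in the plane. *)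
suff : x * x' + y * y' <= a * b by lra.
apply: le_trans (ler_norm _) _.
rewrite -(@ler_pXn2r _ 2)// ?nnegrE ?mulr_ge0 ?(ltW (lt_trans _ a1))//.
rewrite real_normK ?num_real// exprMn a2 b2 /sqnorm -/x -/y -/x' -/y'.
have := sqr_ge0 (x * y' - y * x'); lra.
Qed.

Local Notation I2pi := (`[0%R, 2 * pi]%classic : set R).
Local Notation leb := (@lebesgue_measure R).

Lemma cmeas_horner d (T : measurableType d) (D : set T) (F : T -> R[i]) P :
  cmeas D F -> cmeas D (fun t => P.[F t]).
Proof.
move=> mF; under eq_fun do rewrite horner_coef.
by apply: cmeas_sum => i _; apply: cmeasM; [exact: cmeas_cst|exact: cmeasX].
Qed.

Lemma horner_tor_bounded P :
  exists M : R, forall z, sqnorm z = 1 -> sqnorm P.[z] <= M.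
Proof.
elim/poly_ind: P => [|P c [M hM]].
  by exists 0 => z _; rewrite horner0 sqnorm0.
exists (2 * (M + sqnorm c)) => z z1; rewrite hornerMXaddC.
by apply: le_trans (sqnormD_le _ _) _; rewrite sqnormM z1 mulr1 ler_pM2l// lerD2r hM.
Qed.

Section Quotient.
Variables P Q : {poly R[i]}.
Hypothesis hP : forall z, sqnorm z <= 1 -> P.[z] != 0.

Let u b := cint leb I2pi (fun t => Q.[tor t] / P.[tor t] * tor t ^+ b).

Let mI : @measurable _ (measurableTypeR R) I2pi.
Proof. exact: measurable_itv. Qed.

(** The bound is uniform in the exponent: it makes the moments [u] a bounded sequence. *)
Lemma sqint_quotient b :
  sqint leb I2pi (fun t => Q.[tor t] / P.[tor t] * tor t ^+ b) /\
  exists M : R, forall c t, sqnorm (Q.[tor t] / P.[tor t] * tor t ^+ c) <= M.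
Proof.
have [e e0 he] := poly_lower_bound hP; have [M hM] := horner_tor_bounded Q.
have B c t : sqnorm (Q.[tor t] / P.[tor t] * tor t ^+ c) <= M / e.
  rewrite !sqnormM sqnormX sqnorm_tor expr1n mulr1 sqnormV.
  apply: ler_pM; rewrite ?invr_ge0 ?sqnorm_ge0 ?hM ?sqnorm_tor//.
  by rewrite lef_pV2 ?posrE ?(lt_le_trans e0)// ?he ?sqnorm_tor.
split; last by exists (M / e).
have mt : cmeas I2pi (@tor R) by exact: (@cmeas_tor _ _ _ _ id).
apply: (@sqint_bounded _ _ _ _ _ _ _ (M / e)) => //.
- exact: leb_I2pi_lty.
- apply: cmeasM; last exact: cmeasX.
  by apply: cmeasM; [exact: cmeas_horner|apply: cmeasV; exact: cmeas_horner].
Qed.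

Lemma cintegrable_quotient b :
  cintegrable leb I2pi (fun t => Q.[tor t] / P.[tor t] * tor t ^+ b).
Proof.
by apply: sqint_cintegrable; [exact: measurable_itv|exact: leb_I2pi_lty|
  exact: (sqint_quotient b).1].
Qed.

(* The moments u b satisfy the recurrence with characteristic polynomial P and are bounded. *)
Lemma cint_quotient_eq0 b :
  cint leb I2pi (fun t => Q.[tor t] / P.[tor t] * tor t ^+ b.+1) = 0.
Proof.
have P0 : P != 0.
  by apply/eqP => P0; have := @hP 0; rewrite P0 horner0 eqxx sqnorm0 ler01 => /(_ isT).
have [_ [M hM]] := sqint_quotient 0.
have s1 : sqint leb I2pi (fun=> 1).
  apply: (@sqint_bounded _ _ _ leb _ mI _ 1 (@leb_I2pi_lty R)).
    exact: cmeas_cst.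
  by move=> t _; rewrite sqnorm1.
suff H : forall k, u k.+1 = 0 by exact: H.
have bu : forall k, sqnorm (u k.+1) <= M * (2 * pi) * sqnormI leb I2pi (fun=> 1).
  move=> k; have sq := (sqint_quotient k.+1).1.
  have := cip_CauchySchwarz mI sq s1.
  have -> : cip leb I2pi (fun t => Q.[tor t] / P.[tor t] * tor t ^+ k.+1) (fun=> 1) = u k.+1.
    by apply: eq_cint => t _; rewrite conjc1 mulr1.
  move=> /le_trans; apply; rewrite ler_wpM2r ?sqnormI_ge0//.
  have -> : M * (2 * pi) = Rintegral leb I2pi (fun=> M).
    rewrite (Rintegral_cst _ mI); congr (_ * _).
    exact/esym/(congr1 fine (@leb_I2pi R)).
  apply: (le_Rintegral mI); [exact: sq.2| |by move=> t _; exact: hM].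
  have [_] := sqintZ mI (Complex (Num.sqrt M) 0) s1.
  apply: eq_integrable => // t _ /=.
  by rewrite mulr1 /sqnorm /= expr0n addr0 sqr_sqrtr// (le_trans (sqnorm_ge0 _) (hM 0%N 0)).
apply: (bounded_recur_eq0 P0 hP bu) => k; rewrite /recur.
transitivity (cint leb I2pi (fun t => Q.[tor t] * tor t ^+ k.+1)).
  transitivity (\sum_(i < size P) cint leb I2pi
      (fun t => P`_i * (Q.[tor t] / P.[tor t] * tor t ^+ (k + i).+1))).
    by apply: eq_bigr => i _; rewrite (cintZ mI)//; exact: cintegrable_quotient.
  rewrite -(cint_sum mI); last first.
    by move=> i _; apply: (cintegrableZ mI); exact: cintegrable_quotient.
  apply: eq_cint => t _.
  have Pt : P.[tor t] != 0 by rewrite hP// sqnorm_tor.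
  rewrite -[RHS]mulr1 -(divff Pt).
  rewrite [X in _ = _ * (X / _)]horner_coef mulr_suml mulr_sumr.
  by apply: eq_bigr => i _; rewrite -addSn exprD; ring.
have it a : cintegrable leb I2pi (fun t => tor t ^+ a).
  apply: sqint_cintegrable; [exact: mI|exact: leb_I2pi_lty|].
  apply: (@sqint_bounded _ _ _ leb _ mI _ 1 (@leb_I2pi_lty R)).
    by apply: cmeasX; exact: (@cmeas_tor _ _ _ _ id).
  by move=> t _; rewrite sqnormX sqnorm_tor expr1n.
transitivity (\sum_(i < size Q) cint leb I2pi (fun t => Q`_i * tor t ^+ (i + k.+1))).
  rewrite -(cint_sum mI); last by move=> i _; exact: (cintegrableZ mI).
  apply: eq_cint => t _; rewrite horner_coef mulr_suml.
  by apply: eq_bigr => i _; rewrite exprD mulrA.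
by rewrite big1// => i _; rewrite (cintZ mI)// cint_torX addnS mulr0.
Qed.

End Quotient.

End OneVariable.

(** * Gauss's lemma and common factors in two variables *)

Section CommonFactor.
Variable K : closedFieldType.
Implicit Types (c : {poly K}) (f g p q : {poly {poly K}}).

Lemma lin_factor (a : K) f : (forall j, (f`_j).[a] = 0) ->
  exists g, f = ('X - a%:P)%:P * g.
Proof.
move=> fa; exists (\poly_(j < size f) (f`_j %/ ('X - a%:P))).
apply/polyP => j; rewrite coefCM coef_poly.
case: ltnP => jf; last by rewrite mulr0 nth_default.
by rewrite mulrC divpK// dvdp_XsubCl; apply/eqP.
Qed.

(** Over an algebraically closed field this says that the content, a polynomial in z1, is constant
    and nonzero. *)
Definition primitive g := forall a : K, exists j, (g`_j).[a] != 0.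

(** The linear factors of the content are removed one by one; the degree in z1 of the leading
    coefficient drops each time. *)
Lemma primitive_part g : g != 0 ->
  exists c g0, [/\ c != 0, g = c%:P * g0 & primitive g0].
Proof.
move: {2}(size (lead_coef g)) (leqnn (size (lead_coef g))) => s.
elim: s g => [|s IH] g sg g0.
  by move: sg; rewrite leqn0 size_poly_eq0 lead_coef_eq0 (negPf g0).
have [h|] := pselect (primitive g).
  by exists 1, g; rewrite oner_neq0 mul1r.
move=> /existsNP[a] /forallNP ga.
have [g' gE] : exists g', g = ('X - a%:P)%:P * g'.
  by apply: lin_factor => j; apply/eqP/negPn/negP; exact: ga.
have g'0 : g' != 0 by apply: contra_neq g0 => h; rewrite gE h mulr0.
have [|c [h [c0 g'E hp]]] := IH g' _ g'0.
  move: sg; rewrite gE lead_coefM lead_coefC mulrC.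
  by rewrite size_Mmonic ?lead_coef_eq0 ?monicXsubC// size_XsubC addn2.
exists (('X - a%:P) * c), h; split => //.
  by rewrite mulf_neq0 ?polyXsubC_eq0.
by rewrite gE g'E mulrA -polyCM.
Qed.

(** Gauss's lemma. At a root a of c the product of q(a, z2) and g(a, z2) vanishes in the domain
    K[z2], and g(a, z2) is nonzero by primitivity; hence z1 - a divides q and cancels. *)
Lemma gauss_clear c p q g : c != 0 -> primitive g ->
  c%:P * p = q * g -> exists r, p = g * r.
Proof.
move: {2}(size c) (leqnn (size c)) => s; elim: s c q => [|s IH] c q sc c0 gp E.
  by move: sc; rewrite leqn0 size_poly_eq0 (negPf c0).
have [s1|s1] := leqP (size c) 1.
  have ck := size1_polyC s1; have k0 : c`_0 != 0.
    by apply: contra_neq c0 => h; rewrite ck h.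
  exists (((c`_0)^-1%:P)%:P * q); rewrite mulrCA [g * q]mulrC -E mulrA.
  by rewrite [in c%:P]ck -!polyCM mulVf// mul1r.
have /closed_rootP[a ca] : size c != 1%N by rewrite gtn_eqF.
have [c' cE] := factor_theorem _ _ ca.
have c'0 : c' != 0 by apply: contra_neq c0 => h; rewrite cE h mul0r.
have [q' qE] : exists q', q = ('X - a%:P)%:P * q'.
  have := congr1 (map_poly (horner_eval a)) E.
  rewrite !rmorphM /= map_polyC /= [horner_eval a c](eqP ca) mul0r => /esym/eqP.
  rewrite mulf_eq0 => /orP[/eqP h|/eqP h].
    apply: lin_factor => j; have := congr1 (fun r : {poly K} => r`_j) h.
    by rewrite /= coef_map coef0.
  have [j] := gp a; have := congr1 (fun r : {poly K} => r`_j) h.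
  by rewrite /= coef_map coef0 /= /horner_eval => ->; rewrite eqxx.
apply: (IH c' q') => //.
  by move: sc; rewrite cE size_Mmonic ?monicXsubC// size_XsubC addn2.
have X0 : ('X - a%:P)%:P != 0 :> {poly {poly K}} by rewrite polyC_eq0 polyXsubC_eq0.
by apply: (mulfI X0); rewrite !mulrA -qE -E cE polyCM [_ * c'%:P]mulrC.
Qed.

Import Pdiv.Idomain.

(** If p and q were coprime in z2, then p would divide be, whose degree is too small. The gcd and
    its divisibility hold only up to factors in K[z1], so the primitive part is taken and
    [gauss_clear] restores honest divisibility. *)
Lemma common_factor p q (al be : {poly {poly K}}) : be != 0 -> (size be < size p)%N ->
  p * al = q * be ->
  exists g : {poly {poly K}}, [/\ (1 < size g)%N, exists r, p = g * r & exists r, q = g * r].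
Proof.
move=> be0 sbe E.
have p0 : p != 0 by rewrite -size_poly_gt0; apply: leq_ltn_trans sbe.
have [cop|ncop] := boolP (coprimep p q).
  have : p %| q * be by rewrite -E dvdp_mulr.
  rewrite mulrC Gauss_dvdpl// => /(dvdp_leq be0).
  by rewrite leqNgt sbe.
set g := gcdp p q.
have g0 : g != 0 by rewrite gcdp_eq0 negb_and p0.
have [c [h [c0 gE hp]]] := primitive_part g0.
have sh : size h = size g by rewrite gE size_Cmul.
exists h; split.
- rewrite sh ltn_neqAle eq_sym size_poly_gt0 g0 andbT.
  by move: ncop; rewrite /coprimep.
- have := dvdp_gcdl p q; rewrite -/g dvdp_eq -mul_polyC => /eqP.
  rewrite gE mulrA; apply: gauss_clear => //.
  by rewrite expf_neq0// lead_coef_eq0 -gE.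
- have := dvdp_gcdr p q; rewrite -/g dvdp_eq -mul_polyC => /eqP.
  rewrite gE mulrA; apply: gauss_clear => //.
  by rewrite expf_neq0// lead_coef_eq0 -gE.
Qed.

End CommonFactor.

Lemma size_mulXn_leq (A : nzSemiRingType) (f : {poly A}) k :
  (size (f * 'X^k)%R <= size f + k)%N.
Proof. by apply: leq_trans (size_polyMleq _ _) _; rewrite size_polyXn addnS. Qed.

(** * Evaluation at a point of the projective line in z2 *)

Section HomogeneousEvaluation.
Variables (K : closedFieldType) (a v : K).

(** This is v^N f(a, 1/v) for f of formal z2-degree N. At v = 0 it is the coefficient of z2^N at a,
    so the point at infinity is covered by the same formula. *)
Definition hev N (f : {poly {poly K}}) : K := \sum_(j < N.+1) (f`_j).[a] * v ^+ (N - j).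

Lemma hevD N f g : hev N (f + g) = hev N f + hev N g.
Proof.
rewrite /hev -big_split; apply: eq_bigr => j _.
by rewrite coefD hornerD mulrDl.
Qed.
Lemma hevZ N c f : hev N (c%:P * f) = c.[a] * hev N f.
Proof.
rewrite /hev mulr_sumr; apply: eq_bigr => j _.
by rewrite coefCM hornerM mulrA.
Qed.
Lemma hevN N f : hev N (- f) = - hev N f.
Proof. by rewrite -mulN1r -polyCN hevZ hornerN hornerC mulN1r. Qed.
Lemma hev0 N : hev N 0 = 0.
Proof. by apply: big1 => j _; rewrite coef0 horner0 mul0r. Qed.
Lemma hev_sum (I : Type) (s : seq I) (P : pred I) N (F : I -> {poly {poly K}}) :
  hev N (\sum_(i <- s | P i) F i) = \sum_(i <- s | P i) hev N (F i).
Proof. exact: (big_morph (hev N) (hevD N) (hev0 N)). Qed.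

Lemma hev_wide N k (f : {poly {poly K}}) : (size f <= N.+1)%N -> hev (N + k) f = v ^+ k * hev N f.
Proof.
move=> sf; rewrite /hev mulr_sumr.
rewrite (big_ord_widen (N + k).+1 (fun j => v ^+ k * ((f`_j).[a] * v ^+ (N - j))));
  last by lia.
rewrite [RHS]big_mkcond; apply: eq_bigr => j _; case: ltnP => h.
  rewrite mulrCA -exprD; congr (_ * v ^+ _); lia.
by rewrite nth_default ?horner0 ?mul0r// (leq_trans sf).
Qed.

Lemma hevXn N k (f : {poly {poly K}}) : hev (N + k) (f * 'X^k) = hev N f.
Proof.
rewrite /hev.
rewrite -(big_mkord xpredT (fun j => ((f * 'X^k)`_j).[a] * v ^+ (N + k - j))).
rewrite (@big_cat_nat _ _ _ k)//=; last by lia.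
rewrite big1_seq ?add0r; last first.
  move=> j; rewrite mem_index_iota => /andP[_ /andP[_ jk]].
  by rewrite coefMXn jk horner0 mul0r.
rewrite -{1}[k]add0n -addSn big_addn addnK big_mkord; apply: eq_bigr => j _.
by rewrite coefMXn ltnNge leq_addl /= addnK; congr (_ * v ^+ _); lia.
Qed.

End HomogeneousEvaluation.

(** * The Bezoutian and the resultant in z2 *)

Section Bezoutian.
Variable K : closedFieldType.
Variables (m : nat) (p q : {poly {poly K}}).
Hypotheses (sp : (size p <= m.+1)%N) (sq : (size q <= m.+1)%N).

(** [bezt i] is the coefficient of x^(m-i) in p(z2) q(x) - q(z2) p(x), and [bezl j] that of
    x^(m-1-j) in its quotient by x - z2, as produced by synthetic division. *)
Definition bezt i : {poly {poly K}} := p * (q`_(m - i))%:P - q * (p`_(m - i))%:P.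
Definition bezl j : {poly {poly K}} := \sum_(0 <= i < j.+1) bezt i * 'X^(j - i).

Lemma rev_expansion (f : {poly {poly K}}) : (size f <= m.+1)%N ->
  \sum_(0 <= i < m.+1) (f`_(m - i))%:P * 'X^(m - i) = f.
Proof.
move=> sf; rewrite big_mkord (reindex_inj rev_ord_inj) /=.
rewrite -[RHS]coefK poly_def (big_ord_widen m.+1 (fun i => f`_i *: 'X^i) sf).
rewrite [RHS]big_mkcond /=; apply: eq_bigr => i _; rewrite mul_polyC.
rewrite subSS subKn; last by rewrite -ltnS.
by case: ltnP => // h; rewrite nth_default// scale0r.
Qed.

(** The complete sum of the [bezt i] z2^(m-i) is pq - qp = 0, so its head is minus its tail. The
    tail reveals that L_j has z2-degree below m, which is invisible in the head. *)
Lemma bezlE j : (j < m)%N ->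
  bezl j * 'X^(m - j) = - \sum_(j.+1 <= i < m.+1) bezt i * 'X^(m - i).
Proof.
move=> jm; apply/eqP; rewrite -subr_eq0 opprK.
have -> : bezl j * 'X^(m - j) = \sum_(0 <= i < j.+1) bezt i * 'X^(m - i).
  rewrite /bezl mulr_suml; apply: eq_big_nat => i /andP[_ ij].
  by rewrite -mulrA -exprD; congr (_ * 'X^_); lia.
rewrite -big_cat_nat//=; last by lia.
under eq_bigr do rewrite mulrBl -!mulrA.
by rewrite sumrB -!mulr_sumr !rev_expansion// mulrC subrr.
Qed.

Lemma size_bezt i : (size (bezt i) <= m.+1)%N.
Proof.
apply: leq_trans (size_polyD _ _) _; rewrite size_polyN geq_max.
apply/andP; split; rewrite mulrC mul_polyC.
  exact: leq_trans (size_scale_leq _ _) sp.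
exact: leq_trans (size_scale_leq _ _) sq.
Qed.

Lemma size_bezl j : (j < m)%N -> (size (bezl j) <= m)%N.
Proof.
move=> jm; have [->|L0] := eqVneq (bezl j) 0; first by rewrite size_poly0.
have : (size (bezl j * 'X^(m - j))%R <= m + (m - j))%N.
  rewrite bezlE// size_polyN; apply: (leq_trans (size_sum _ _ _)).
  apply/bigmax_leqP_seq => i; rewrite mem_index_iota => /andP[ij im] _.
  apply: leq_trans (size_mulXn_leq _ _) _.
  by apply: leq_trans (leq_add (size_bezt i) (leqnn _)) _; lia.
by rewrite size_Mmonic ?monicXn// size_polyXn addnS leq_add2r.
Qed.

Definition bezmx : 'M[{poly K}]_m := \matrix_(j, i) (bezl j)`_i.
(** The Bezout determinant: up to sign, the z2-resultant of p and q in formal degree m. *)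
Definition bezD : {poly K} := \det bezmx.

(** Cramer's rule: the adjugate expresses the powers of z2 through the L_j with common denominator
    [bezD]. *)
Lemma bezD_span (i : 'I_m) :
  bezD%:P * 'X^i = \sum_(j < m) ((\adj bezmx) i j)%:P * bezl j.
Proof.
apply/polyP => k; rewrite coefCM coefXn coef_sum.
under eq_bigr do rewrite coefCM.
have [km|km] := ltnP k m; last first.
  rewrite big1; last first.
    by move=> j _; rewrite nth_default ?mulr0// (leq_trans (size_bezl _)).
  by rewrite gtn_eqF ?mulr0// (leq_trans (ltn_ord i)).
have := congr1 (fun M : 'M[{poly K}]_m => M i (Ordinal km)) (mul_adj_mx bezmx).
rewrite !mxE => e.
have -> : \sum_(j < m) (\adj bezmx) i j * (bezl j)`_k = \det bezmx *+ (i == Ordinal km).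
  by rewrite -e; apply: eq_bigr => j _; congr (_ * _); rewrite mxE.
by rewrite -/bezD -(inj_eq val_inj) /= eq_sym mulr_natr.
Qed.

(** A kernel vector v combines the L_j to 0. Separating the multiples of p from those of q in this
    combination gives p al = q be with be of smaller z2-degree than p. *)
Lemma bezD_eq0 : size p = m.+1 -> bezD = 0 ->
  exists g : {poly {poly K}}, [/\ (1 < size g)%N, exists r, p = g * r & exists r, q = g * r].
Proof.
move=> spE /eqP/det0P[v v0 vB].
pose al := \sum_(j < m) (v 0 j)%:P * \sum_(0 <= i < j.+1) (q`_(m - i))%:P * 'X^(j - i).
pose be := \sum_(j < m) (v 0 j)%:P * \sum_(0 <= i < j.+1) (p`_(m - i))%:P * 'X^(j - i).
have E : p * al - q * be = \sum_(j < m) (v 0 j)%:P * bezl j.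
  rewrite /al /be !mulr_sumr -sumrB; apply: eq_bigr => j _.
  rewrite mulrCA [q * _]mulrCA -mulrBr; congr (_ * _).
  rewrite /bezl !mulr_sumr -sumrB; apply: eq_bigr => i _.
  by rewrite /bezt mulrBl !mulrA.
have E0 : p * al = q * be.
  apply/eqP; rewrite -subr_eq0 E; apply/eqP/polyP => k.
  rewrite coef_sum coef0; under eq_bigr do rewrite coefCM.
  have [km|km] := ltnP k m; last first.
    by apply: big1 => j _; rewrite nth_default ?mulr0// (leq_trans (size_bezl _)).
  have := congr1 (fun M : 'rV[{poly K}]_m => M 0 (Ordinal km)) vB.
  rewrite !mxE => e; rewrite -[RHS]e.
  by apply: eq_bigr => j _; congr (_ * _); rewrite mxE.
have szin (j : 'I_m) i : (size ((p`_(m - i))%:P * 'X^(j - i))%R <= m)%N.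
  apply: leq_trans (size_mulXn_leq _ _) _.
  apply: leq_trans (leq_add (size_polyC_leq1 _) (leqnn _)) _.
  by have := ltn_ord j; lia.
apply: (common_factor _ _ E0); last first.
  rewrite spE ltnS; apply: (leq_trans (size_sum _ _ _)).
  apply/bigmax_leqP => j _; rewrite mul_polyC.
  apply: leq_trans (size_scale_leq _ _) _.
  apply: (leq_trans (size_sum _ _ _)); apply/bigmax_leqP_seq => i _ _; exact: szin.
have [j0 vj0] : exists j0, v 0 j0 != 0.
  apply/existsP; rewrite -negb_forall; apply: contra v0 => /forallP h.
  by apply/eqP/rowP => j; rewrite mxE; apply/eqP.
(* With J the last index at which v is nonzero, z2^J enters be only through v_J p_m; so be is
   nonzero. *)
pose J := [arg max_(j > j0 | v 0 j != 0) j : nat].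
have [vJ Jmax] : v 0 J != 0 /\ forall j : 'I_m, (J < j)%N -> v 0 j = 0.
  rewrite /J; case: arg_maxnP => // j vj jmax; split => // k jk.
  by apply: contraTeq jk => /jmax; rewrite -leqNgt.
apply/eqP => be0; have := congr1 (fun f : {poly {poly K}} => f`_J) be0.
rewrite coef0 /be coef_sum (bigD1 J)//= [X in _ + X]big1 ?addr0; last first.
  move=> j jJ; rewrite coefCM; have [h|h] := ltnP J j; first by rewrite Jmax ?mul0r.
  rewrite coef_sum big1 ?mulr0// => i _; rewrite coefCM coefXn.
  have jJ' : (j : nat) <> J by move=> /val_inj/eqP; rewrite (negPf jJ).
  by case: eqP => [e|_]; rewrite ?mulr0//; lia.
rewrite coefCM coef_sum big_nat_recl// subn0 coefCM coefXn subn0 eqxx mulr1.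
rewrite big1_seq ?addr0; last first.
  move=> i; rewrite mem_index_iota => /andP[_ iJ]; rewrite coefCM coefXn.
  by case: eqP => [e|_]; rewrite ?mulr0//; lia.
move/eqP; rewrite mulf_eq0 (negPf vJ) /=.
have : lead_coef p != 0 by rewrite lead_coef_eq0 -size_poly_gt0 spE.
by rewrite /lead_coef spE /= => /negPf ->.
Qed.

(** The tail form of L_j z2^(m-j) is evaluated: there each [bezt i], a K[z1]-combination of p and q,
    is seen in a formal degree at least m. The head would impose the formal degree m - 1, too low
    for [bezt i]. *)
Lemma hev_bezl (a v : K) j : (j < m)%N ->
  hev a v m p = 0 -> hev a v m q = 0 -> hev a v m.-1 (bezl j) = 0.
Proof.
move=> jm hp hq; rewrite -(hevXn a v _ (m - j)) bezlE// hevN hev_sum.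
rewrite big1_seq ?oppr0// => i; rewrite mem_index_iota => /andP[_ /andP[ji im]].
have -> : (m.-1 + (m - j) = m + (i - j.+1) + (m - i))%N by lia.
rewrite hevXn hev_wide ?size_bezt// /bezt [p * _]mulrC [q * _]mulrC.
rewrite hevD hevN !hevZ.
by rewrite hp hq !mulr0 subrr mulr0.
Qed.

End Bezoutian.

(** * Values on the torus, and estimates for zero-free polynomials *)

Section Eval2.
Variable R : realType.
Implicit Types (f g : {poly {poly R[i]}}) (a z : R[i]).

Lemma eval2E f a z : eval2 f a z = (map_poly (horner_eval a) f).[z].
Proof. by []. Qed.
Lemma eval2D f g a z : eval2 (f + g) a z = eval2 f a z + eval2 g a z.
Proof. by rewrite !eval2E rmorphD hornerD. Qed.
Lemma eval2N f a z : eval2 (- f) a z = - eval2 f a z.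
Proof. by rewrite !eval2E rmorphN hornerN. Qed.
Lemma eval2B f g a z : eval2 (f - g) a z = eval2 f a z - eval2 g a z.
Proof. by rewrite eval2D eval2N. Qed.
Lemma eval2M f g a z : eval2 (f * g) a z = eval2 f a z * eval2 g a z.
Proof. by rewrite !eval2E rmorphM hornerM. Qed.
Lemma eval2C (c : {poly R[i]}) a z : eval2 c%:P a z = c.[a].
Proof. by rewrite !eval2E map_polyC hornerC. Qed.
Lemma eval2Xn k a z : eval2 'X^k a z = z ^+ k.
Proof. by rewrite !eval2E map_polyXn hornerXn. Qed.
Lemma eval20 a z : eval2 0 a z = 0.
Proof. by rewrite eval2E rmorph0 horner0. Qed.
Lemma eval2_sum (I : Type) (s : seq I) (P : pred I) (F : I -> {poly {poly R[i]}}) a z :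
  eval2 (\sum_(i <- s | P i) F i) a z = \sum_(i <- s | P i) eval2 (F i) a z.
Proof.
by elim/big_rec2: _ => [|i x y _ <-]; rewrite ?eval20 ?eval2D.
Qed.
Lemma eval2_coef f a z k : (size f <= k)%N ->
  eval2 f a z = \sum_(j < k) (f`_j).[a] * z ^+ j.
Proof.
move=> sf; rewrite eval2E (horner_coef_wide _ (n := k)).
  by apply: eq_bigr => j _; rewrite coef_map.
exact: leq_trans (size_poly _ _) sf.
Qed.

Lemma conj_horner_wide (q : {poly R[i]}) N a : (size q <= N.+1)%N -> sqnorm a = 1 ->
  a ^+ N * conjc q.[a] = (\poly_(i < N.+1) conjc q`_(N - i)).[a].
Proof.
move=> sq a1; have aJ : a * conjc a = 1 by rewrite mulJ_sqnorm a1.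
rewrite horner_poly (horner_coef_wide _ sq) conjc_sum mulr_sumr.
rewrite (reindex_inj rev_ord_inj) /=; apply: eq_bigr => i _.
rewrite subSS conjcM mulrCA; congr (_ * _); rewrite conjcX.
have iN : (i <= N)%N by rewrite -ltnS.
rewrite -{1}(subnKC iN) exprD -mulrA -exprMn aJ expr1n mulr1 //.
Qed.

Lemma ptilde_coef n m f a i : (forall j, (size (f`_j)%R <= n.+1)%N) -> sqnorm a = 1 ->
  (i <= m)%N -> ((ptilde n m f)`_(m - i)).[a] = a ^+ n * conjc (f`_i).[a].
Proof.
move=> sf a1 im; rewrite coef_poly ltnS leq_subr subKn//.
by rewrite conj_horner_wide.
Qed.

Lemma eval2_ptilde n m f a z : (size f <= m.+1)%N ->
  (forall j, (size (f`_j)%R <= n.+1)%N) -> sqnorm a = 1 -> sqnorm z = 1 ->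
  eval2 (ptilde n m f) a z = a ^+ n * z ^+ m * conjc (eval2 f a z).
Proof.
move=> sf sfj a1 z1; have zJ : z * conjc z = 1 by rewrite mulJ_sqnorm z1.
rewrite (eval2_coef _ _ (k := m.+1)) ?size_poly// (eval2_coef _ _ sf).
rewrite conjc_sum mulr_sumr (reindex_inj rev_ord_inj) /=; apply: eq_bigr => i _.
have im : (i <= m)%N by rewrite -ltnS.
rewrite subSS (ptilde_coef sfj a1 im) conjcM conjcX.
have -> : z ^+ m = z ^+ (m - i) * z ^+ i by rewrite -exprD subnK.
have -> : a ^+ n * (z ^+ (m - i) * z ^+ i) * (conjc (f`_i).[a] * conjc z ^+ i) =
  a ^+ n * conjc (f`_i).[a] * z ^+ (m - i) * (z ^+ i * conjc z ^+ i) by ring.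
by rewrite -exprMn zJ expr1n mulr1.
Qed.

(** Along a ray, inequalities between squared moduli become inequalities between real polynomials in
    r, which pass from r < 1 to r = 1. *)
Lemma horner_ray (q : {poly R[i]}) a : exists A B : {poly R},
  forall r : R, q.[r%:C%C * a] = Complex A.[r] B.[r].
Proof.
elim/poly_ind: q => [|q c [A [B h]]].
  by exists 0, 0 => r; rewrite !horner0.
case: a h => x y h; case: c => u v.
exists (A * x%:P * 'X - B * y%:P * 'X + u%:P), (A * y%:P * 'X + B * x%:P * 'X + v%:P) => r.
rewrite hornerMXaddC h !(hornerE, hornerD, hornerM, hornerN, hornerC).
by apply: complex_ext; rewrite !(ReD, ImD, ReM, ImM) /=; ring.
Qed.

Lemma sqnorm_horner_ray (q : {poly R[i]}) a : exists A : {poly R},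
  forall r : R, sqnorm q.[r%:C%C * a] = A.[r].
Proof.
have [A [B h]] := horner_ray q a.
by exists (A ^+ 2 + B ^+ 2) => r; rewrite h /sqnorm hornerD !horner_exp.
Qed.

Lemma poly_ge0_left (A : {poly R}) : (forall r, 0 <= r -> r < 1 -> 0 <= A.[r]) ->
  0 <= A.[1].
Proof.
move=> h; rewrite leNgt; apply/negP => A1.
have e0 : 0 < - A.[1] by rewrite oppr_gt0.
have [d d0 hd] := polyrcf.poly_cont 1 A e0.
pose r := Num.max 0 (1 - d / 2).
have r0 : 0 <= r by rewrite le_max lexx.
have r1 : r < 1 by rewrite gt_max ltr01; lra.
have := hd r; rewrite distrC gtr0_norm ?subr_gt0//.
have : 1 - d / 2 <= r by rewrite le_max lexx orbT.
move=> h1 /(_ ltac:(lra)); have := h r r0 r1 => h2.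
rewrite gtr0_norm; lra.
Qed.

(** A Harnack-type estimate, factor by factor over roots with |r| >= 1: |z - r|^2 <= 2(|z|^2 +
    |r|^2) <= 4|r|^2 and |z - r| >= (1 - |z|)|r|. The constants depend on N only, so they survive a
    limit of polynomials; this does the work of Hurwitz's theorem. *)
Lemma zero_free_bounds (P : {poly R[i]}) N :
  (size P <= N)%N -> (forall z, sqnorm z < 1 -> P.[z] != 0) ->
  (forall z, sqnorm z <= 1 -> sqnorm P.[z] <= 4 ^+ N * sqnorm P.[0]) /\
  (forall z, sqnorm z < 1 ->
     (1 - Num.sqrt (sqnorm z)) ^+ 2 ^+ N * sqnorm P.[0] <= sqnorm P.[z]).
Proof.
elim: N P => [|N IH] P.
  rewrite leqn0 size_poly_eq0 => /eqP -> h.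
  by have := h 0; rewrite horner0 eqxx sqnorm0 ltr01 => /(_ isT).
move=> sP hP; have [s1|s1] := leqP (size P) 1.
  have := hP 0; rewrite sqnorm0 ltr01 (size1_polyC s1) hornerC => /(_ isT) c0.
  have p4 : 1 <= 4 ^+ N.+1 :> R by rewrite exprn_ege1//; lra.
  split => z z1; rewrite !hornerC; first by rewrite ler_peMl ?sqnorm_ge0.
  have b1 : Num.sqrt (sqnorm z) < 1.
    by rewrite -sqrtr1 ltr_sqrt.
  have b0 : 0 <= Num.sqrt (sqnorm z) by exact: sqrtr_ge0.
  rewrite ler_piMl ?sqnorm_ge0// -exprM exprn_ile1//; lra.
have /closed_rootP[r /factor_theorem[Q PQ]] : size P != 1%N by rewrite gtn_eqF.
have P0 : P != 0 by apply: contraTneq s1 => ->; rewrite size_poly0.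
have Q0 : Q != 0 by apply: contra_neq P0 => Q0; rewrite PQ Q0 mul0r.
have r1 : 1 <= sqnorm r.
  rewrite leNgt; apply/negP => /hP; rewrite PQ hornerM hornerXsubC subrr.
  by rewrite mulr0 eqxx.
have sQ : (size Q <= N)%N.
  by move: sP; rewrite PQ size_Mmonic ?monicXsubC// size_XsubC addn2.
have [z z1|h1 h2] := IH Q sQ.
  by have := hP z z1; rewrite PQ hornerM mulf_eq0 negb_or => /andP[].
have E z : sqnorm P.[z] = sqnorm Q.[z] * sqnorm (z - r).
  by rewrite PQ hornerM sqnormM hornerXsubC.
have E0 : sqnorm P.[0] = sqnorm Q.[0] * sqnorm r by rewrite E sub0r sqnormN.
split => z z1; rewrite (E z) E0.
  have -> : 4 ^+ N.+1 * (sqnorm Q.[0] * sqnorm r) =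
    (4 ^+ N * sqnorm Q.[0]) * (4 * sqnorm r) by rewrite exprS; ring.
  apply: ler_pM; [exact: sqnorm_ge0|exact: sqnorm_ge0|exact: h1|].
  by have := sqnormD_le z (- r); rewrite sqnormN; lra.
set c : R := (1 - Num.sqrt (sqnorm z)) ^+ 2; have c0 : 0 <= c by exact: sqr_ge0.
have -> : c ^+ N.+1 * (sqnorm Q.[0] * sqnorm r) =
  (c ^+ N * sqnorm Q.[0]) * (c * sqnorm r) by rewrite exprS; ring.
apply: ler_pM; [|by rewrite mulr_ge0 ?sqnorm_ge0|exact: h2|].
  exact: (mulr_ge0 (exprn_ge0 _ c0) (sqnorm_ge0 _)).
rewrite /c; set b : R := Num.sqrt (sqnorm z).
have b2 : b ^+ 2 = sqnorm z by rewrite sqr_sqrtr// sqnorm_ge0.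
have b0 : 0 <= b by exact: sqrtr_ge0.
have b1 : b < 1 by rewrite -sqrtr1 ltr_sqrt.
pose a : R := Num.sqrt (sqnorm r).
have a2 : a ^+ 2 = sqnorm r by rewrite sqr_sqrtr// sqnorm_ge0.
have a0 : 0 <= a by exact: sqrtr_ge0.
have a1 : 1 <= a by rewrite -(@ler_pXn2r _ 2)// ?nnegrE// a2 expr1n.
apply: (@le_trans _ _ ((a - b) ^+ 2)).
  rewrite -a2 -exprMn ler_pXn2r// ?nnegrE ?mulr_ge0//; nra.
rewrite sqrrB a2 b2 /sqnorm ReD ImD ReN ImN.
set x := complex.Re z; set y := complex.Im z.
set x' := complex.Re r; set y' := complex.Im r.
suff : x * x' + y * y' <= a * b by lra.
apply: le_trans (ler_norm _) _.
rewrite -(@ler_pXn2r _ 2)// ?nnegrE ?mulr_ge0//.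
rewrite real_normK ?num_real// exprMn a2 b2 /sqnorm -/x -/y -/x' -/y'.
have := sqr_ge0 (x * y' - y * x'); lra.
Qed.

Lemma poly_disc_eq0 (P : {poly R[i]}) : (forall z, sqnorm z <= 1 -> P.[z] = 0) -> P = 0.
Proof.
move=> h; apply/eqP/negPn/negP => P0.
pose s := [seq (k.+1%:R)^-1 : R[i] | k <- iota 0 (size P)].
have us : uniq s.
  rewrite map_inj_uniq ?iota_uniq// => i j /invr_inj/eqP.
  by rewrite eqr_nat => /eqP[].
suff as_ : all (root P) s.
  by have := max_poly_roots P0 as_ us; rewrite size_map size_iota ltnn.
apply/allP => _ /mapP[k _ ->]; apply/eqP/h.
rewrite sqnormV; have -> : sqnorm (k.+1%:R : R[i]) = k.+1%:R ^+ 2.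
  by rewrite -(rmorph_nat (real_complex R)) /sqnorm /= expr0n addr0.
by rewrite invf_le1 ?exprn_gt0// exprn_ege1// ler1n.
Qed.

End Eval2.

(** * Zeros of a semi-stable polynomial on the boundary of the bidisc *)

Section Boundary.
Variables (R : realType) (n m : nat) (p : {poly {poly R[i]}}).
Hypothesis ss : semi_stable n m p.
Local Notation pt := (ptilde n m p).
Local Notation D := (bezD m p pt).

Lemma ss_size : size p = m.+1. Proof. by case: ss => -[]. Qed.
Lemma ss_sizej j : (size (p`_j)%R <= n.+1)%N. Proof. by case: ss => -[]. Qed.
Lemma size_pt : (size pt <= m.+1)%N. Proof. exact: size_poly. Qed.

Lemma ss_disc a z : sqnorm a < 1 -> sqnorm z < 1 -> eval2 p a z != 0.
Proof.
have S (x : R[i]) : sqnorm x < 1 -> `|x| < 1.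
  move=> h; rewrite -(@ltr_pXn2r _ 2)// ?nnegrE// expr1n sqnormE.
  by rewrite ltcR.
by move=> /S ha /S hz; case: ss => _ + _; apply.
Qed.

Lemma ss_no_factor (g : {poly {poly R[i]}}) : nonconstant g ->
  (exists r, p = g * r) -> (exists r, pt = g * r) -> False.
Proof. by move=> ng h1 h2; case: ss => _ _; apply; exists g. Qed.

Lemma bezD_neq0 : D != 0.
Proof.
apply/eqP => /(bezD_eq0 (eq_leq ss_size) size_pt ss_size)[g [sg h1 h2]].
apply: (ss_no_factor _ h1 h2) => -[c gc]; move: sg; rewrite gc.
by rewrite ltnNge size_polyC_leq1.
Qed.

(** For r < 1 the slice p(r a, z2) has no zero in the disc, so [zero_free_bounds] applies; both
    estimates are polynomial in r and persist at r = 1. *)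
Lemma ss_ray_bounds a z N : sqnorm a = 1 -> (size p <= N)%N ->
  (sqnorm z <= 1 -> sqnorm (eval2 p a z) <= 4 ^+ N * sqnorm (p`_0).[a]) /\
  (sqnorm z < 1 ->
   (1 - Num.sqrt (sqnorm z)) ^+ 2 ^+ N * sqnorm (p`_0).[a] <= sqnorm (eval2 p a z)).
Proof.
move=> a1 sN.
have p0E b : eval2 p b 0 = (p`_0).[b].
  rewrite (eval2_coef _ _ (eq_leq ss_size)) big_ord_recl expr0 mulr1 big1 ?addr0//.
  by move=> i _; rewrite expr0n mulr0.
(* z2 is frozen, so that p becomes a polynomial in z1 to be restricted to the ray through a. *)
pose q := \sum_(j < size p) p`_j * (z ^+ j)%:P.
have qE b : eval2 p b z = q.[b].
  rewrite (eval2_coef _ _ (leqnn _)) /q -horner_evalE rmorph_sum /=.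
  by apply: eq_bigr => j _; rewrite /horner_eval hornerM hornerC.
have [A hA] := sqnorm_horner_ray q a.
have [B hB] := sqnorm_horner_ray p`_0 a.
have H r : 0 <= r -> r < 1 -> _ := fun r0 r1 => @zero_free_bounds R
  (map_poly (horner_eval (r%:C%C * a)) p) N (leq_trans (size_poly _ _) sN)
  (fun z hz => @ss_disc (r%:C%C * a) z (ltac:(rewrite sqnormM a1 mulr1 /sqnorm /= expr0n addr0 expr2;nra)) hz).
have E1 : eval2 p a z = q.[(1%:C)%C * a] by rewrite qE mul1r.
have E2 : (p`_0).[a] = (p`_0).[(1%:C)%C * a] by rewrite mul1r.
split => z1; rewrite E1 E2 hA hB.
  rewrite -subr_ge0 -hornerZ -hornerN -hornerD; apply: poly_ge0_left => r r0 r1.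
  rewrite hornerD hornerN hornerZ subr_ge0 -hA -hB -qE -p0E.
  by have [+ _] := H r r0 r1; apply.
rewrite -subr_ge0 -hornerZ -hornerN -hornerD; apply: poly_ge0_left => r r0 r1.
rewrite hornerD hornerN hornerZ subr_ge0 -hA -hB -qE -p0E.
by have [_] := H r r0 r1; apply.
Qed.

(** If p(a, 0) = 0 with |a| = 1, the upper bound forces p(a, z2) to vanish identically; then z1 - a
    divides p and, by reflection, [ptilde]. *)
Lemma ss_coef0_neq0 a : sqnorm a <= 1 -> (p`_0).[a] != 0.
Proof.
rewrite le_eqVlt => /orP[/eqP a1|a1]; last first.
  have := @ss_disc a 0 a1; rewrite sqnorm0 ltr01 => /(_ isT).
  rewrite (eval2_coef _ _ (eq_leq ss_size)) big_ord_recl expr0 mulr1 big1 ?addr0//.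
  by move=> i _; rewrite expr0n mulr0.
apply/eqP => p0a.
have Pa0 : map_poly (horner_eval a) p = 0.
  apply: poly_disc_eq0 => z z1; rewrite -eval2E; apply/eqP; rewrite -sqnorm_eq0.
  have [/(_ z1) + _] := ss_ray_bounds z a1 (leqnn _).
  by rewrite p0a sqnorm0 mulr0 eq_le sqnorm_ge0 andbT.
have pj j : (p`_j).[a] = 0.
  by have := congr1 (fun f : {poly R[i]} => f`_j) Pa0; rewrite /= coef_map coef0.
apply: (@ss_no_factor ('X - a%:P)%:P); last 2 first.
- exact: lin_factor.
- apply: lin_factor => j; have [jm|jm] := leqP j m.
    by rewrite -(subKn jm) (ptilde_coef ss_sizej a1) ?leq_subr// pj conjc0 mulr0.
  by rewrite nth_default ?horner0// (leq_trans size_pt).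
move=> [c /polyC_inj h]; have := size_XsubC a; rewrite h => e.
by have := size_polyC_leq1 c; rewrite e.
Qed.

Lemma ss_circle a z : sqnorm a = 1 -> sqnorm z < 1 -> eval2 p a z != 0.
Proof.
move=> a1 z1; rewrite -sqnorm_eq0 gt_eqF//.
have [_ /(_ z1)] := ss_ray_bounds z a1 (leqnn _); apply: lt_le_trans.
have b1 : Num.sqrt (sqnorm z) < 1 by rewrite -sqrtr1 ltr_sqrt.
rewrite mulr_gt0 ?exprn_gt0 ?subr_gt0//.
by rewrite lt_def sqnorm_ge0 sqnorm_eq0 ss_coef0_neq0// a1.
Qed.

(** On the torus a zero of p is a zero of [ptilde], hence of every L_j, hence of [D] times z2^0. *)
Lemma ss_torus a z : (0 < m)%N -> sqnorm a = 1 -> D.[a] != 0 -> sqnorm z <= 1 ->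
  eval2 p a z != 0.
Proof.
move=> m0 a1 Da; rewrite le_eqVlt => /orP[/eqP z1|z1]; last exact: ss_circle.
apply: contra_neq Da => pz.
have ptz : eval2 pt a z = 0.
  by rewrite eval2_ptilde ?(eq_leq ss_size)//; [rewrite pz conjc0 mulr0|exact: ss_sizej].
have := bezD_span (eq_leq ss_size) size_pt (Ordinal m0).
move=> /(congr1 (fun f => eval2 f a z)); rewrite eval2M eval2C eval2Xn mulr1 => ->.
rewrite eval2_sum big1// => j _; rewrite eval2M /bezl eval2_sum big1 ?mulr0// => i _.
by rewrite eval2M /bezt eval2B !eval2M pz ptz !mul0r subrr mul0r.
Qed.

End Boundary.

(** * The weighted space and Fourier coefficients on the torus *)

Section TorusSpace.
Variables (R : realType) (n m : nat) (p : {poly {poly R[i]}}).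
Hypothesis ss : semi_stable n m p.
Hypothesis m_gt0 : (0 < m)%N.
Local Notation pt := (ptilde n m p).
Local Notation D := (bezD m p pt).
Local Notation L := (bezl m p pt).
Local Notation leb := (@lebesgue_measure R).
Local Notation mu := (@leb2 R).
Local Notation TT := (@torus_dom R).
Local Notation I2pi := (`[0%R, 2 * pi]%classic : set R).
Local Notation tint := (cint mu TT).
Implicit Types (f g h s : {poly {poly R[i]}}) (t : R * R).

Let mT : @measurable _ (measurableTypeR R * measurableTypeR R)%type TT := @measurable_torus R.

Definition tev f t := eval2 f (tor t.1) (tor t.2).
(** The space L^2(1/|p|^2) is studied through the quotients f/p in the unweighted L^2. Where p = 0
    the quotient is 0 by convention. [nrm] is the square of the norm. *)
Definition quo f t := tev f t / tev p t.
Definition inA f := sqint mu TT (quo f).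
Definition dot f g := cip mu TT (quo f) (quo g).
Definition nrm f := sqnormI mu TT (quo f).

Lemma measurable_fst_torus : measurable_fun TT (fun t => t.1).
Proof. exact: (measurable_funS _ _ measurable_fst). Qed.
Lemma measurable_snd_torus : measurable_fun TT (fun t => t.2).
Proof. exact: (measurable_funS _ _ measurable_snd). Qed.

Lemma cmeas_tev f : cmeas TT (tev f).
Proof.
have m1 := cmeas_tor measurable_fst_torus.
have m2 := cmeas_tor measurable_snd_torus.
have -> : tev f = fun t => \sum_(j < size f) (f`_j).[tor t.1] * tor t.2 ^+ j.
  by apply/funext => t; rewrite /tev (eval2_coef _ _ (leqnn _)).
by apply: cmeas_sum => j _; apply: cmeasM; [exact: cmeas_horner|exact: cmeasX].
Qed.

Lemma cmeas_quo f : cmeas TT (quo f).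
Proof. by apply: cmeasM; [exact: cmeas_tev|apply: cmeasV; exact: cmeas_tev]. Qed.

Lemma tev_bounded f : exists M : R, forall t, sqnorm (tev f t) <= M.
Proof.
elim/poly_ind: f => [|f c [M hM]].
  by exists 0 => t; rewrite /tev eval20 sqnorm0.
have [M' hM'] := horner_tor_bounded c.
exists (2 * (M + M')) => t; rewrite /tev eval2D eval2M -['X]expr1 eval2Xn expr1 eval2C.
apply: le_trans (sqnormD_le _ _) _; rewrite sqnormM sqnorm_tor mulr1 ler_pM2l//.
by rewrite lerD ?hM ?hM' ?sqnorm_tor.
Qed.

Lemma tevM f g t : tev (f * g) t = tev f t * tev g t.
Proof. exact: eval2M. Qed.
Lemma quoM s f t : quo (s * f) t = tev s t * quo f t.
Proof. by rewrite /quo tevM mulrA. Qed.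
Lemma quoD f g t : quo (f + g) t = quo f t + quo g t.
Proof. by rewrite /quo /tev eval2D mulrDl. Qed.
Lemma quoN f t : quo (- f) t = - quo f t.
Proof. by rewrite /quo /tev eval2N mulNr. Qed.
Lemma quoB f g t : quo (f - g) t = quo f t - quo g t.
Proof. by rewrite quoD quoN. Qed.
Lemma quo0 t : quo 0 t = 0.
Proof. by rewrite /quo /tev eval20 mul0r. Qed.
Lemma quoC (c : R[i]) f t : quo (c%:P%:P * f) t = c * quo f t.
Proof. by rewrite quoM /tev eval2C hornerC. Qed.

Lemma inAD f g : inA f -> inA g -> inA (f + g).
Proof.
move=> fA gA; have := sqintD mT fA gA; apply: (eq_sqint mT) => t _; exact/esym/quoD.
Qed.
Lemma inAM s f : inA f -> inA (s * f).
Proof.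
move=> fA; have [M hM] := tev_bounded s.
have := sqintM_bounded mT (cmeas_tev s) (fun t _ => hM t) fA.
by apply: (eq_sqint mT) => t _; rewrite quoM.
Qed.
Lemma inAN f : inA f -> inA (- f).
Proof. by move=> /(inAM (-1)); rewrite mulN1r. Qed.
Lemma inAB f g : inA f -> inA g -> inA (f - g).
Proof. by move=> fA gA; apply: inAD => //; exact: inAN. Qed.
Lemma inA_sum (I : Type) (r : seq I) (P : pred I) (F : I -> {poly {poly R[i]}}) :
  (forall i, P i -> inA (F i)) -> inA (\sum_(i <- r | P i) F i).
Proof.
move=> h; elim/big_ind: _ => // [|x y]; last exact: inAD.
apply: (@sqint_bounded _ _ _ _ _ mT _ 0 (@leb2_torus_lty R)).
  exact: cmeas_quo.
by move=> t _; rewrite quo0 sqnorm0.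
Qed.

Lemma inA_p : inA p.
Proof.
apply: (@sqint_bounded _ _ _ _ _ mT _ 1 (@leb2_torus_lty R)).
  exact: cmeas_quo.
move=> t _; rewrite /quo; have [->|e] := eqVneq (tev p t) 0.
  by rewrite mul0r sqnorm0 ler01.
by rewrite divff// sqnorm1.
Qed.

Lemma sqnorm_tev_ptilde f n' m' t : (size f <= m'.+1)%N ->
  (forall j, (size (f`_j)%R <= n'.+1)%N) ->
  sqnorm (tev (ptilde n' m' f) t) = sqnorm (tev f t).
Proof.
move=> sf sfj; rewrite /tev eval2_ptilde ?sqnorm_tor//.
by rewrite !sqnormM !sqnormX !sqnorm_tor !expr1n !mul1r sqnormJ.
Qed.

Lemma inA_ptilde f n' m' : (size f <= m'.+1)%N ->
  (forall j, (size (f`_j)%R <= n'.+1)%N) -> inA f -> inA (ptilde n' m' f).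
Proof.
move=> sf sfj [_ fA]; split; first exact: cmeas_quo.
apply: (eq_integrable mT) fA => // t _ /=.
by rewrite /quo !sqnormM sqnorm_tev_ptilde.
Qed.

Lemma inA_L j : inA (L j).
Proof.
apply: inA_sum => i _; rewrite mulrC; apply: inAM; apply: inAB; rewrite mulrC;
  apply: inAM; first exact: inA_p.
apply: inA_ptilde; [exact: eq_leq (ss_size ss)|exact: (ss_sizej ss)|exact: inA_p].
Qed.

(** [D] is a combination of the L_j with polynomial coefficients in z1, and these lie in the space
    because |p| = |ptilde| on the torus. *)
Lemma inA_D s : inA (D%:P * s).
Proof.
have := bezD_span (eq_leq (ss_size ss)) (size_pt n m p) (Ordinal m_gt0).
rewrite expr0 mulr1 => ->; rewrite mulrC; apply: inAM; apply: inA_sum => j _.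
by apply: inAM; exact: inA_L.
Qed.

Definition badset : set R := [set t : R | I2pi t /\ D.[tor t] = 0].

Lemma countable_badset : countable badset.
Proof. exact: (tor_roots_countable (bezD_neq0 ss)). Qed.

Lemma tev_p_neq0 t : TT t -> ~ badset t.1 -> tev p t != 0.
Proof.
move=> [t1 t2] nb; apply: (ss_torus ss m_gt0); rewrite ?sqnorm_tor//.
by apply/eqP => h; apply: nb.
Qed.

Lemma cintegrable_quoM f (F : R * R -> R[i]) (M : R) : inA f -> cmeas TT F ->
  (forall t, TT t -> sqnorm (F t) <= M) -> cintegrable mu TT (fun t => F t * quo f t).
Proof.
move=> fA mF bF; apply: (sqint_cintegrable mT (@leb2_torus_lty R)).
exact: (sqintM_bounded mT mF bF fA).
Qed.

Lemma tint_eq0_off (F : R * R -> R[i]) : cintegrable mu TT F ->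
  (forall t, TT t -> ~ badset t.1 -> F t = 0) -> tint F = 0.
Proof.
move=> iF F0; apply: (torus_cint12_eq0 countable_badset iF) => t1 It1 nb.
have E : forall t2 : R, I2pi t2 -> (fun=> 0) t2 = F (t1, t2).
  by move=> t2 It2; rewrite F0.
have mI : @measurable _ (measurableTypeR R) I2pi by exact: measurable_itv.
split; first by apply: (eq_cintegrable mI E); exact: cintegrable0.
by rewrite -(eq_cint leb E) cint0.
Qed.

(** For all but countably many z1 the slice of f/p is analytic in z2 on the closed disc, so it has
    no negative z2-frequency. *)
Lemma tint_quo_eq0 f (s : {poly R[i]}) b : inA f ->
  tint (fun t => conjc s.[tor t.1] * tor t.2 ^+ b.+1 * quo f t) = 0.
Proof.
move=> fA; have [M hM] := horner_tor_bounded s.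
have m1 := cmeas_tor measurable_fst_torus.
have m2 := cmeas_tor measurable_snd_torus.
have iF : cintegrable mu TT (fun t => conjc s.[tor t.1] * tor t.2 ^+ b.+1 * quo f t).
  apply: (cintegrable_quoM (M := M)) => //.
    by apply: cmeasM; [apply: cmeasJ; exact: cmeas_horner|exact: cmeasX].
  by move=> t _; rewrite sqnormM sqnormX sqnormJ sqnorm_tor expr1n mulr1 hM ?sqnorm_tor.
apply: (torus_cint12_eq0 countable_badset iF) => t1 It1 nb.
pose P := map_poly (horner_eval (tor t1)) p.
pose Q := map_poly (horner_eval (tor t1)) f.
have hP z : sqnorm z <= 1 -> P.[z] != 0.
  move=> z1; rewrite -eval2E; apply: (ss_torus ss m_gt0) => //; first exact: sqnorm_tor.
  by apply/eqP => h; apply: nb.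
have mI : @measurable _ (measurableTypeR R) I2pi by exact: measurable_itv.
have E (t2 : R) : I2pi t2 -> conjc s.[tor t1] * (Q.[tor t2] / P.[tor t2] * tor t2 ^+ b.+1) =
   conjc s.[tor t1] * tor t2 ^+ b.+1 * quo f (t1, t2).
  by move=> _; rewrite /quo /tev !eval2E; ring.
have iQ := cintegrable_quotient Q hP b.+1.
split; first by apply: (eq_cintegrable mI E); exact: (cintegrableZ mI).
by rewrite -(eq_cint leb E) (cintZ mI)// cint_quotient_eq0// mulr0.
Qed.

Definition vol : R[i] := ((4 * pi ^+ 2)%:C)%C.

Lemma cintegrable_tev f (F : R * R -> R[i]) (M : R) : cmeas TT F ->
  (forall t, TT t -> sqnorm (F t) <= M) -> cintegrable mu TT (fun t => F t * tev f t).
Proof.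
move=> mF bF; apply: (sqint_cintegrable mT (@leb2_torus_lty R)).
apply: (sqintM_bounded mT mF bF); have [M' hM'] := tev_bounded f.
apply: (@sqint_bounded _ _ _ _ _ mT _ M' (@leb2_torus_lty R)) => //.
exact: cmeas_tev.
Qed.

Lemma tint_monomial a b k j :
  tint (fun t => conjc (tor t.1 ^+ k * tor t.2 ^+ j) * (tor t.1 ^+ a * tor t.2 ^+ b)) =
  if (a == k) && (b == j) then vol else 0.
Proof.
have m1 := cmeas_tor measurable_fst_torus.
have m2 := cmeas_tor measurable_snd_torus.
have mI : @measurable _ (measurableTypeR R) I2pi by exact: measurable_itv.
pose F t := conjc (tor t.1 ^+ k * tor t.2 ^+ j) * (tor t.1 ^+ a * tor t.2 ^+ b) : R[i].
have iF : cintegrable mu TT F.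
  apply: (sqint_cintegrable mT (@leb2_torus_lty R)).
  apply: (@sqint_bounded _ _ _ _ _ mT _ 1 (@leb2_torus_lty R)).
    by apply: cmeasM; [apply: cmeasJ|]; apply: cmeasM; exact: cmeasX.
  move=> t _; rewrite /F sqnormM sqnormJ !sqnormM !sqnormX !sqnorm_tor.
  by rewrite !expr1n !mulr1.
have JX (x : R) c d : conjc (tor x) ^+ c * tor x ^+ d =
    if (c <= d)%N then tor x ^+ (d - c) else conjc (tor x ^+ (c - d)).
  case: leqP => h.
    by rewrite -{1}(subnKC h) exprD mulrA -exprMn torJ expr1n mul1r.
  by rewrite -{1}(subnKC (ltnW h)) exprD conjcX -mulrA mulrCA -exprMn torJ expr1n mulr1.
have iX c : cintegrable leb I2pi (fun x => tor x ^+ c).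
  apply: (sqint_cintegrable mI (@leb_I2pi_lty R)).
  apply: (@sqint_bounded _ _ _ leb _ mI _ 1 (@leb_I2pi_lty R)).
    by apply: cmeasX; exact: (@cmeas_tor _ _ _ _ id).
  by move=> t _; rewrite sqnormX sqnorm_tor expr1n.
have Z1 c d : c != d ->
    cintegrable leb I2pi (fun x => conjc (tor x) ^+ c * tor x ^+ d) /\
    cint leb I2pi (fun x => conjc (tor x) ^+ c * tor x ^+ d) = 0.
  move=> cd; have -> : (fun x : R => conjc (tor x) ^+ c * tor x ^+ d) = fun x =>
      if (c <= d)%N then tor x ^+ (d - c) else conjc (tor x ^+ (c - d)).
    by apply/funext => x; exact: JX.
  case: leqP => h.
    by split; [exact: iX|rewrite cint_torX subn_eq0 leqNgt ltn_neqAle cd h].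
  split; first by apply: cintegrableJ; exact: iX.
  by rewrite (cintJ mI)// cint_torX subn_eq0 leqNgt h conjc0.
have [e1|ne1] := eqVneq a k; last first.
  apply: (torus_cint21_eq0 (@countable0 R) iF) => s _ _.
  have [i1 z1] := Z1 k a (ltac:(by rewrite eq_sym)).
  pose c := conjc (tor s) ^+ j * tor s ^+ b.
  have E (t : R) : I2pi t -> c * (conjc (tor t) ^+ k * tor t ^+ a) = F (t, s).
    by move=> _; rewrite /F /c /= conjcM !conjcX; ring.
  split; first by apply: (eq_cintegrable mI E); exact: (cintegrableZ mI).
  by rewrite -(eq_cint leb E) (cintZ mI)// z1 mulr0.
have [e2|ne2] := eqVneq b j; last first.
  apply: (torus_cint12_eq0 (@countable0 R) iF) => s _ _.
  have [i1 z1] := Z1 j b (ltac:(by rewrite eq_sym)).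
  pose c := conjc (tor s) ^+ k * tor s ^+ a.
  have E (t : R) : I2pi t -> c * (conjc (tor t) ^+ j * tor t ^+ b) = F (s, t).
    by move=> _; rewrite /F /c /= conjcM !conjcX; ring.
  split; first by apply: (eq_cintegrable mI E); exact: (cintegrableZ mI).
  by rewrite -(eq_cint leb E) (cintZ mI)// z1 mulr0.
have E t : TT t -> F t = 1.
  move=> _; rewrite /F e1 e2 mulrC mulJ_sqnorm sqnormM !sqnormX !sqnorm_tor.
  by rewrite !expr1n mulr1.
transitivity (tint (fun=> 1)); first exact: eq_cint.
apply: complex_ext => /=.
  apply: (etrans (Rintegral_cst _ mT _)); rewrite mul1r.
  exact: (congr1 fine (@leb2_torus R)).
by apply: (etrans (Rintegral_cst _ mT _)); rewrite mul0r.
Qed.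

Lemma cmeas_monomialJ k j : cmeas TT (fun t => conjc (tor t.1 ^+ k * tor t.2 ^+ j)).
Proof.
apply: cmeasJ; apply: cmeasM; apply: cmeasX; apply: cmeas_tor.
  exact: measurable_fst_torus.
exact: measurable_snd_torus.
Qed.

Lemma tint_coef f k j :
  tint (fun t => conjc (tor t.1 ^+ k * tor t.2 ^+ j) * tev f t) = vol * (f`_j)`_k.
Proof.
pose mon a b := 'X^a%:P * 'X^b : {poly {poly R[i]}}.
have monE a b t : tev (mon a b) t = tor t.1 ^+ a * tor t.2 ^+ b.
  by rewrite /tev /mon eval2M eval2C hornerXn eval2Xn.
have fE t : tev f t = \sum_(b < size f) \sum_(a < size f`_b) (f`_b)`_a * tev (mon a b) t.
  rewrite /tev (eval2_coef _ _ (leqnn _)); apply: eq_bigr => b _.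
  rewrite horner_coef mulr_suml; apply: eq_bigr => a _.
  by rewrite -[eval2 (mon a b) _ _]/(tev (mon a b) t) monE mulrA.
have mJ := cmeas_monomialJ k j.
have bJ t : TT t -> sqnorm (conjc (tor t.1 ^+ k * tor t.2 ^+ j)) <= 1.
  by move=> _; rewrite sqnormJ sqnormM !sqnormX !sqnorm_tor !expr1n mulr1.
have iM a b : cintegrable mu TT
  (fun t => (f`_b)`_a * (conjc (tor t.1 ^+ k * tor t.2 ^+ j) * tev (mon a b) t)).
  by apply: (cintegrableZ mT); exact: (cintegrable_tev _ mJ bJ).
have -> : tint (fun t => conjc (tor t.1 ^+ k * tor t.2 ^+ j) * tev f t) =
  \sum_(b < size f) \sum_(a < size f`_b)
    tint (fun t => (f`_b)`_a * (conjc (tor t.1 ^+ k * tor t.2 ^+ j) * tev (mon a b) t)).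
  transitivity (\sum_(b < size f) tint (fun t => \sum_(a < size f`_b)
      (f`_b)`_a * (conjc (tor t.1 ^+ k * tor t.2 ^+ j) * tev (mon a b) t))).
    rewrite -(cint_sum mT); last by move=> b _; apply: (cintegrable_sum mT).
    apply: eq_cint => t _; rewrite fE mulr_sumr; apply: eq_bigr => b _.
    by rewrite mulr_sumr; apply: eq_bigr => a _; rewrite mulrCA.
  by apply: eq_bigr => b _; rewrite (cint_sum mT).
have E a b : tint (fun t => (f`_b)`_a * (conjc (tor t.1 ^+ k * tor t.2 ^+ j) *
    tev (mon a b) t)) = (f`_b)`_a * (if (a == k) && (b == j) then vol else 0).
  rewrite (cintZ mT); last exact: (cintegrable_tev _ mJ bJ).
  by rewrite -tint_monomial; congr (_ * _); apply: eq_cint => t _; rewrite monE.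
under eq_bigr do under eq_bigr do rewrite E.
have [jf|jf] := ltnP j (size f); last first.
  rewrite [f`_j]nth_default// coef0 mulr0 big1// => b _; rewrite big1// => a _.
  by rewrite [(b : nat) == j]ltn_eqF ?andbF ?mulr0// (leq_trans (ltn_ord b)).
rewrite (bigD1 (Ordinal jf))//= [X in _ + X]big1 ?addr0; last first.
  move=> b; rewrite -val_eqE /= => /negPf bj; rewrite big1// => a _.
  by rewrite bj andbF mulr0.
have [kf|kf] := ltnP k (size f`_j); last first.
  rewrite [(f`_j)`_k]nth_default// mulr0 big1// => a _.
  by rewrite [(a : nat) == k]ltn_eqF ?mulr0// (leq_trans (ltn_ord a)).
rewrite (bigD1 (Ordinal kf))//= [X in _ + X]big1 ?addr0; last first.
  by move=> a; rewrite -val_eqE /= => /negPf ak; rewrite ak mulr0.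
by rewrite !eqxx mulrC.
Qed.

End TorusSpace.

(** * Algebra of the weighted inner product *)

Section DotProduct.
Variables (R : realType) (p : {poly {poly R[i]}}).
Local Notation inA := (inA p).
Local Notation dot := (dot p).
Local Notation nrm := (nrm p).
Local Notation quo := (quo p).
Implicit Types (f g h s : {poly {poly R[i]}}).

Let mT : @measurable _ (measurableTypeR R * measurableTypeR R)%type (@torus_dom R) :=
  @measurable_torus R.

Lemma dotDl f g h : inA f -> inA g -> inA h -> dot (f + g) h = dot f h + dot g h.
Proof.
move=> fA gA hA; rewrite -(cipDl mT fA gA hA); apply: eq_cip => // t _; exact: quoD.
Qed.
Lemma dotBl f g h : inA f -> inA g -> inA h -> dot (f - g) h = dot f h - dot g h.
Proof.
move=> fA gA hA; rewrite -(cipBl mT fA gA hA); apply: eq_cip => // t _; exact: quoB.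
Qed.
Lemma dotZl (c : R[i]) f h : inA f -> inA h -> dot (c%:P%:P * f) h = c * dot f h.
Proof.
move=> fA hA; rewrite -(cipZl mT _ fA hA); apply: eq_cip => // t _; exact: quoC.
Qed.
Lemma dotJ f g : inA f -> inA g -> dot g f = conjc (dot f g).
Proof. by move=> fA gA; exact: (cipJ mT). Qed.
Lemma dotDr f g h : inA f -> inA g -> inA h -> dot h (f + g) = dot h f + dot h g.
Proof.
move=> fA gA hA; rewrite -(cipDr mT fA gA hA); apply: eq_cip => // t _; exact: quoD.
Qed.
Lemma dotBr f g h : inA f -> inA g -> inA h -> dot h (f - g) = dot h f - dot h g.
Proof.
move=> fA gA hA; rewrite -(cipBr mT fA gA hA); apply: eq_cip => // t _; exact: quoB.
Qed.
Lemma dotZr (c : R[i]) f h : inA f -> inA h -> dot h (c%:P%:P * f) = conjc c * dot h f.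
Proof.
move=> fA hA; rewrite -(cipZr mT _ fA hA); apply: eq_cip => // t _; exact: quoC.
Qed.
Lemma dot0l h : dot 0 h = 0.
Proof.
rewrite -(cint0 (@leb2 R) mT); apply: eq_cint => t _.
by rewrite quo0 mul0r.
Qed.
Lemma inA0 : inA 0.
Proof. by rewrite -(mul0r p); apply: inAM; exact: inA_p. Qed.
Lemma dot_suml (I : Type) (r : seq I) (P : pred I) (F : I -> {poly {poly R[i]}}) h :
  (forall i, P i -> inA (F i)) -> inA h ->
  dot (\sum_(i <- r | P i) F i) h = \sum_(i <- r | P i) dot (F i) h.
Proof.
move=> FA hA; elim: r => [|i r IH]; first by rewrite !big_nil dot0l.
rewrite !big_cons; case Pi : (P i) => //; rewrite dotDl ?IH//; first exact: FA.
exact: inA_sum.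
Qed.
Lemma dot_sumr (I : Type) (r : seq I) (P : pred I) (F : I -> {poly {poly R[i]}}) h :
  (forall i, P i -> inA (F i)) -> inA h ->
  dot h (\sum_(i <- r | P i) F i) = \sum_(i <- r | P i) dot h (F i).
Proof.
move=> FA hA; rewrite (dotJ (inA_sum _ FA) hA) dot_suml// conjc_sum.
by apply: eq_bigr => i Pi; rewrite -(dotJ (FA i Pi) hA).
Qed.
Lemma dot_self f : dot f f = ((nrm f)%:C)%C.
Proof. exact: cip_self. Qed.
Lemma nrm_ge0 f : 0 <= nrm f.
Proof. exact: sqnormI_ge0. Qed.
Lemma dot_CauchySchwarz f g : inA f -> inA g -> sqnorm (dot f g) <= nrm f * nrm g.
Proof. exact: (cip_CauchySchwarz mT). Qed.

Lemma dot_unimodular s f g : (forall t, sqnorm (tev s t) = 1) ->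
  dot (s * f) (s * g) = dot f g.
Proof.
move=> s1; apply: eq_cint => t _; rewrite !quoM conjcM.
have -> : tev s t * quo f t * (conjc (tev s t) * conjc (quo g t)) =
  (tev s t * conjc (tev s t)) * (quo f t * conjc (quo g t)) by ring.
by rewrite mulJ_sqnorm s1 mul1r.
Qed.

Lemma nrm_unimodular s f : (forall t, sqnorm (tev s t) = 1) -> nrm (s * f) = nrm f.
Proof. by move=> s1; apply: complexI; rewrite -!dot_self dot_unimodular. Qed.

Lemma inA_sqnorm f g : (forall t, sqnorm (tev f t) = sqnorm (tev g t)) ->
  inA f -> inA g.
Proof.
move=> fg [_ fA]; split; first exact: cmeas_quo.
by apply: (eq_integrable mT) fA => // t _ /=; rewrite !sqnormM fg.
Qed.

Lemma quo_polyC (c : {poly R[i]}) f t : quo (c%:P * f) t = c.[tor t.1] * quo f t.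
Proof. by rewrite quoM /tev eval2C. Qed.

Lemma inA_polyC (c c' : {poly R[i]}) f :
  (forall x : R, sqnorm c.[tor x] = sqnorm c'.[tor x]) -> inA (c'%:P * f) ->
  inA (c%:P * f).
Proof.
move=> cc'; apply: inA_sqnorm => t.
by rewrite (tevM c%:P f) (tevM c'%:P f) !sqnormM /tev !eval2C cc'.
Qed.

Lemma tev_Xn k (t : R * R) : tev ('X^k)%:P t = tor t.1 ^+ k.
Proof. by rewrite /tev eval2C hornerXn. Qed.

Lemma sqnorm_tev_Xn k (t : R * R) : sqnorm (tev ('X^k)%:P t) = 1.
Proof. by rewrite tev_Xn sqnormX sqnorm_tor expr1n. Qed.

Lemma sqnorm_tev_z2 k (t : R * R) : sqnorm (tev 'X^k t) = 1.
Proof. by rewrite /tev eval2Xn sqnormX sqnorm_tor expr1n. Qed.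

End DotProduct.

(* Otherwise unification compares integrals with 0 by unfolding. *)
Global Opaque dot bezD bezl.

(** The algebra of [quo_bezl_expand], detached from the torus: P and Pc are p and its conjugate, y
    is z2; c, d, e are z1^n, z1^k, z1^N; a, b, e' are z2^(j-i), z2^(m-1), z2^i; conjugates of
    unimodular factors appear as inverses. *)
Lemma bezl_summand_identity (F : fieldType) (P Pc y H q1 q3 a b c d e e' : F) :
  P != 0 -> Pc != 0 -> y != 0 -> e' != 0 -> b != 0 -> a != 0 -> e != 0 -> d != 0 ->
  c != 0 ->
  c * (H / P) *
  (d^-1 * ((Pc * (c^-1 * q1) - c^-1 * (b^-1 / y) * P * q3) / a / Pc)) =
  d^-1 * (a^-1 / e') * (e' * q1) * (H / P) -
  e * (y^-1 / a) * (d^-1 * q3 * (e^-1 / b * H) / Pc).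
Proof. by move=> *; field; do ?[apply/andP; split]. Qed.

(** * The Bezoutian coefficients as reproducing kernels *)

Section Reproducing.
Variables (R : realType) (n m : nat) (p : {poly {poly R[i]}}).
Hypothesis ss : semi_stable n m p.
Hypothesis m_gt0 : (0 < m)%N.
Local Notation pt := (ptilde n m p).
Local Notation L := (bezl m p pt).
Local Notation mu := (@leb2 R).
Local Notation TT := (@torus_dom R).
Local Notation tint := (cint mu TT).
Local Notation inA := (inA p).
Local Notation dot := (dot p).
Local Notation nrm := (nrm p).
Local Notation quo := (quo p).
Implicit Types (f g h s : {poly {poly R[i]}}).

Let mT : @measurable _ (measurableTypeR R * measurableTypeR R)%type (@torus_dom R) :=
  @measurable_torus R.

Lemma torV (x : R) : conjc (tor x) = (tor x)^-1.
Proof. by apply: (mulIf (tor_neq0 x)); rewrite torJ mulVf// tor_neq0. Qed.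

Let partA h k j i (t : R * R) : R[i] :=
  conjc (tor t.1 ^+ k * tor t.2 ^+ j) * (tor t.2 ^+ i * tev (p`_i)%:P t) * quo h t.

Let partB h N k j i (t : R * R) : R[i] :=
  conjc (conjc ('X^N).[tor t.1] * tor t.2 ^+ (j - i).+1 *
    quo (('X^k * p`_(m - i))%:P * ptilde N m.-1 h) t).

(** On the torus [ptilde] is z1^n z2^m conj p and its coefficient of z2^(m-i) is z1^n conj p_i. In
    the first half of [bezt i] the factor z1^n cancels and p_i h/p remains. In the second half p/p
    cancels, and expressing h by its reflection leaves the conjugate of conj(z1^N) z2^(j-i+1) times
    a polynomial over p. *)
Lemma quo_bezl_expand h N k j (t : R * R) : (size h <= m)%N ->
  (forall b, (size (h`_b)%R <= N.+1)%N) -> (j < m)%N ->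
  quo (('X^n)%:P * h) t * conjc (quo (('X^k)%:P * L j) t) =
  \sum_(0 <= i < j.+1) (partA h k j i t - partB h N k j i t).
Proof.
move=> sh shN jm; rewrite /partA /partB.
have [P0|P0] := eqVneq (tev p t) 0.
  have q0 f : quo f t = 0 by rewrite /quo P0 invr0 mulr0.
  rewrite q0 mul0r; symmetry; apply: big1 => i _.
  by rewrite !q0 !mulr0 conjc0 subr0.
rewrite !quoM.
rewrite /quo [tev (L j) t]eval2_sum mulr_suml.
rewrite [tev ('X^k)%:P t * _]mulr_sumr conjc_sum mulr_sumr.
apply: eq_big_nat => i /andP[_ ij].
rewrite eval2M eval2Xn eval2B !eval2M !eval2C !tev_Xn.
have im : (i <= m)%N by lia.
rewrite (ptilde_coef (ss_sizej ss)) ?sqnorm_tor//.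
rewrite (eval2_ptilde (eq_leq (ss_size ss)) (ss_sizej ss)) ?sqnorm_tor//.
have sh' : (size h <= m.-1.+1)%N by rewrite prednK.
rewrite tevM [tev (_ * p`_(m - i))%:P t]eval2C [tev (ptilde _ _ h) t](eval2_ptilde sh' shN) ?sqnorm_tor//.
rewrite [tev (p`_i)%:P t]eval2C !hornerM !hornerXn.
rewrite -[eval2 p _ _]/(tev p t) -[eval2 h _ _]/(tev h t).
have P0' : conjc (tev p t) != 0 by rewrite conjc_eq0.
have -> : tor t.2 ^+ m = tor t.2 ^+ m.-1 * tor t.2 by rewrite -exprSr prednK.
have -> : tor t.2 ^+ j = tor t.2 ^+ (j - i) * tor t.2 ^+ i by rewrite -exprD subnK.
rewrite exprS !(conjcM, conjcB, conjcV, conjcX, conjcK) !torV.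
have x0 := tor_neq0 t.1; have y0 := tor_neq0 t.2.
rewrite !exprVn.
have := expf_neq0 n x0; have := expf_neq0 k x0; have := expf_neq0 N x0.
have := expf_neq0 (j - i) y0; have := expf_neq0 m.-1 y0; have := expf_neq0 i y0.
move: (tor t.1 ^+ n) (tor t.1 ^+ k) (tor t.1 ^+ N) (tor t.2 ^+ i).
move: (tor t.2 ^+ (j - i)) (tor t.2 ^+ m.-1) P0 P0' y0.
move: (tev p t) (conjc (tev p t)) (tor t.2) (tev h t) => P Pc y H.
move: (p`_i).[_] (conjc (p`_(m - i)).[_]) => q1 q3.
move=> a b P0 Pc0 y0 c d e e' i0 b0 a0 e0 d0 c0.
exact: bezl_summand_identity.
Qed.

Lemma tint_partB h N k j i : inA h -> (size h <= m)%N ->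
  (forall b, (size (h`_b)%R <= N.+1)%N) ->
  cintegrable mu TT (partB h N k j i) /\ tint (partB h N k j i) = 0.
Proof.
move=> hA sh shN.
have sh' : (size h <= m.-1.+1)%N by rewrite prednK.
have gA : inA (('X^k * p`_(m - i))%:P * ptilde N m.-1 h).
  by apply: inAM; exact: inA_ptilde.
have z := tint_quo_eq0 ss m_gt0 'X^N (j - i) gA.
have i1 : cintegrable mu TT (fun t => conjc ('X^N).[tor t.1] * tor t.2 ^+ (j - i).+1 *
    quo (('X^k * p`_(m - i))%:P * ptilde N m.-1 h) t).
  apply: (cintegrable_quoM (M := 1)) => //.
    apply: cmeasM; first (apply: cmeasJ; apply: cmeas_horner).
      exact: (cmeas_tor (@measurable_fst_torus R)).
    by apply: cmeasX; exact: (cmeas_tor (@measurable_snd_torus R)).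
  move=> t _; rewrite sqnormM sqnormJ hornerXn !sqnormX !sqnorm_tor.
  by rewrite !expr1n mulr1.
split; first exact: cintegrableJ.
by rewrite [LHS](cintJ mT i1) z conjc0.
Qed.

Lemma cintegrable_partA h k j i : inA h -> cintegrable mu TT (partA h k j i).
Proof.
move=> hA; have [M hM] := tev_bounded (p`_i)%:P.
apply: (cintegrable_quoM (M := M)) => //.
  apply: cmeasM; first exact: cmeas_monomialJ.
  apply: cmeasM; last exact: cmeas_tev.
  by apply: cmeasX; exact: (cmeas_tor (@measurable_snd_torus R)).
move=> t _; rewrite !sqnormM sqnormJ sqnormM !sqnormX !sqnorm_tor.
by rewrite !expr1n !mul1r.
Qed.

(* Terms with i > j carry a positive power of z2 over p and integrate to 0, so
   the sum may be extended to all of p, which cancels the denominator. *)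
Lemma tint_sum_partA h k j : inA h -> (j < m)%N ->
  \sum_(0 <= i < j.+1) tint (partA h k j i) = vol R * (h`_j)`_k.
Proof.
move=> hA jm; rewrite -tint_coef.
have z i : (j < i)%N -> tint (partA h k j i) = 0.
  move=> ji; rewrite -[RHS](tint_quo_eq0 ss m_gt0 'X^k (i - j).-1 (inAM (p`_i)%:P hA)).
  apply: eq_cint => t _; rewrite /partA quoM hornerXn conjcM [conjc (tor t.2 ^+ j)]conjcX.
  have -> : tor t.2 ^+ i = tor t.2 ^+ j * tor t.2 ^+ (i - j).-1.+1.
    by rewrite -exprD; congr (_ ^+ _); lia.
  have yJ : conjc (tor t.2) ^+ j * tor t.2 ^+ j = 1 by rewrite -exprMn torJ expr1n.
  rewrite -[RHS]mul1r -yJ; ring.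
have -> : \sum_(0 <= i < j.+1) tint (partA h k j i) =
    \sum_(0 <= i < m.+1) tint (partA h k j i).
  rewrite [RHS](@big_cat_nat _ _ _ j.+1)//=; last by lia.
  rewrite [X in _ = _ + X]big1_seq ?addr0// => i.
  by rewrite mem_index_iota => /andP[_ /andP[ji _]]; exact: z.
rewrite -(cint_sum mT); last by move=> i _; exact: cintegrable_partA.
have mJ := cmeas_monomialJ R k j.
have bJ (t : R * R) : TT t -> sqnorm (conjc (tor t.1 ^+ k * tor t.2 ^+ j)) <= 1.
  by move=> _; rewrite sqnormJ sqnormM !sqnormX !sqnorm_tor !expr1n mulr1.
have i1 : cintegrable mu TT (fun t => \sum_(0 <= i < m.+1) partA h k j i t).
  by apply: (cintegrable_sum mT) => i _; exact: cintegrable_partA.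
have i2 := cintegrable_tev h mJ bJ.
apply/eqP; rewrite -subr_eq0 -(cintB mT i1 i2); apply/eqP.
apply: (tint_eq0_off ss); first exact: (cintegrableB mT i1 i2).
move=> t Tt nb; have P0 := tev_p_neq0 ss m_gt0 Tt nb.
apply/eqP; rewrite subr_eq0; apply/eqP.
transitivity (conjc (tor t.1 ^+ k * tor t.2 ^+ j) * tev p t * quo h t).
  rewrite big_mkord {1}/tev (eval2_coef _ _ (eq_leq (ss_size ss))).
  rewrite mulr_sumr mulr_suml; apply: eq_bigr => i _; rewrite /partA.
  by rewrite [tev (p`_i)%:P t]eval2C [(p`_i).[_] * _]mulrC.
by rewrite -mulrA [tev p t * _]mulrC divfK.
Qed.

(** The shift z1^n matches the factor z1^n in [ptilde]. The z1-degree of h is arbitrary, which is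
    essential for the construction of gaps. *)
Lemma dot_bezl h k j : inA h -> (size h <= m)%N -> (j < m)%N ->
  dot (('X^n)%:P * h) (('X^k)%:P * L j) = vol R * (h`_j)`_k.
Proof.
move=> hA sh jm; pose N := (\max_(b < size h) size (h`_b)%R)%N.
have shN b : (size (h`_b)%R <= N.+1)%N.
  have [bh|bh] := ltnP b (size h); last by rewrite nth_default// size_poly0.
  by apply: leqW; exact: (leq_bigmax (Ordinal bh)).
rewrite -(tint_sum_partA k hA jm).
have hB i := tint_partB k j i hA sh shN.
have iA i : cintegrable mu TT (partA h k j i) by exact: cintegrable_partA.
transitivity (tint (fun t => \sum_(0 <= i < j.+1) (partA h k j i t - partB h N k j i t))).
  by apply: eq_cint => t _; exact: quo_bezl_expand.
rewrite (cint_sum mT); last first.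
  by move=> i _; apply: (cintegrableB mT (iA i)); case: (hB i).
apply: eq_bigr => i _; have [iB zB] := hB i.
by rewrite [LHS](cintB mT (iA i) iB) zB subr0.
Qed.

Lemma vol_gt0 : 0 < 4 * pi ^+ 2 :> R.
Proof. by rewrite mulr_gt0// exprn_gt0// pi_gt0. Qed.

Lemma vol_neq0 : vol R != 0.
Proof. by rewrite -sqnorm_eq0 /sqnorm /= expr0n addr0 sqrf_eq0 gt_eqF// vol_gt0. Qed.

(** Multiplication by z1^k is isometric, so Cauchy-Schwarz against z1^k L_j gives a constant
    independent of k and of the z1-degree of h. *)
Lemma coef_bound : exists2 C : R, 0 <= C & forall h k j,
  inA h -> (size h <= m)%N -> sqnorm (h`_j)`_k <= C * nrm h.
Proof.
pose C := (sqnorm (vol R))^-1 * \sum_(j < m) nrm (L j).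
have v0 : 0 <= (sqnorm (vol R))^-1 by rewrite invr_ge0 sqnorm_ge0.
exists C.
  by rewrite mulr_ge0// sumr_ge0// => j _; exact: nrm_ge0.
move=> h k j hA sh; have [jm|jm] := ltnP j m; last first.
  rewrite [h`_j]nth_default ?(leq_trans sh)// coef0 sqnorm0 mulr_ge0 ?nrm_ge0//.
  by rewrite mulr_ge0// sumr_ge0// => i _; exact: nrm_ge0.
have LA := inA_L ss j.
have := dot_CauchySchwarz (inAM ('X^n)%:P hA) (inAM ('X^k)%:P LA).
rewrite dot_bezl// !nrm_unimodular; try exact: sqnorm_tev_Xn.
rewrite sqnormM => le1; rewrite /C -mulrA mulrC ler_pdivlMr; last first.
  by rewrite lt_def sqnorm_ge0 sqnorm_eq0 vol_neq0.
rewrite mulrC; apply: le_trans le1 _; rewrite mulrC ler_wpM2r ?nrm_ge0//.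
rewrite (bigD1 (Ordinal jm))//= lerDl sumr_ge0// => i _; exact: nrm_ge0.
Qed.

End Reproducing.

(** * Orthogonal projection onto finitely spanned subspaces *)

Section Projection.
Variables (R : realType) (p : {poly {poly R[i]}}).
Local Notation inA := (inA p).
Local Notation dot := (dot p).
Local Notation nrm := (nrm p).
Local Notation V := {poly {poly R[i]}}.
Implicit Types (f g h q x : V) (s : seq V).

(** Linear span of a list over C, by recursion, as the ambient ring of polynomials is not of finite
    dimension. *)
Fixpoint spanned s q : Prop :=
  if s is x :: s' then exists c : R[i], exists2 q', q = c%:P%:P * x + q' & spanned s' q'
  else q = 0.

Definition lin_closed (S : V -> Prop) :=
  S 0 /\ forall (c : R[i]) f g, S f -> S g -> S (c%:P%:P * f + g).

Lemma spanned_closed (S : V -> Prop) s q : lin_closed S ->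
  (forall x, x \in s -> S x) -> spanned s q -> S q.
Proof.
move=> [S0 SD]; elim: s q => [|x s IH] q hs /=; first by move=> ->.
move=> [c [q' -> sq']]; apply: SD; first by apply: hs; rewrite mem_head.
by apply: IH sq' => y ys; apply: hs; rewrite inE ys orbT.
Qed.

Lemma spanned0 s : spanned s 0.
Proof.
by elim: s => //= x s IH; exists 0, 0 => //; rewrite !polyC0 mul0r addr0.
Qed.

Lemma spanned_mem s x : x \in s -> spanned s x.
Proof.
elim: s => //= y s IH; rewrite inE => /predU1P[->|xs].
  by exists 1, 0; [rewrite !polyC1 mul1r addr0|exact: spanned0].
by exists 0, x; [rewrite !polyC0 mul0r add0r|exact: IH].
Qed.

Lemma spanned_lin s : lin_closed (spanned s).
Proof.
split; first exact: spanned0.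
elim: s => [|x s IH] c f g /=; first by move=> -> ->; rewrite mulr0 addr0.
move=> [a [f' -> sf]] [b [g' -> sg]]; exists (c * a + b), (c%:P%:P * f' + g').
  by rewrite !polyCD !polyCM; ring.
exact: IH.
Qed.

Lemma lin_inA : lin_closed inA.
Proof.
by split=> [|c f g fA gA]; [exact: inA0|apply: inAD => //; exact: inAM].
Qed.

Lemma nrm0_dot x h : inA x -> inA h -> nrm x = 0 -> dot h x = 0.
Proof.
move=> xA hA x0; apply/eqP; rewrite -sqnorm_eq0 eq_le sqnorm_ge0 andbT.
by apply: le_trans (dot_CauchySchwarz hA xA) _; rewrite x0 mulr0.
Qed.

(** Gram-Schmidt by induction on the list: the head is first made orthogonal to the span of the
    tail. *)
Lemma projection s r : (forall x, x \in s -> inA x) -> inA r ->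
  exists2 q, spanned s q & forall x, spanned s x -> dot (r - q) x = 0.
Proof.
elim: s r => [|x s IH] r sA rA.
  exists 0 => // x /= ->; rewrite subr0.
  by rewrite (dotJ (inA0 p) rA) dot0l conjc0.
have sA' y : y \in s -> inA y by move=> ys; apply: sA; rewrite inE ys orbT.
have xA : inA x by apply: sA; rewrite mem_head.
have spA q : spanned s q -> inA q by exact: spanned_closed lin_inA sA'.
have [qx sqx ox] := IH x sA' xA.
have [q1 sq1 o1] := IH r sA' rA.
set y := x - qx; have yA : inA y by apply: inAB => //; exact: spA.
have r1A : inA (r - q1) by apply: inAB => //; exact: spA.
(* If [nrm y] is 0 then c = 0 by the convention on inverses, and y is orthogonal to everything by
   Cauchy-Schwarz; linearly dependent lists are thus covered. *)
pose c : R[i] := dot (r - q1) y * ((nrm y)^-1%:C)%C.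
have sy : spanned (x :: s) y.
  exists 1, (-1%:P%:P * qx + 0); first by rewrite !polyC1 /y; ring.
  have [_ h] := spanned_lin s; rewrite -!polyCN; exact: h (spanned0 s).
have lift q : spanned s q -> spanned (x :: s) q.
  by move=> sq; exists 0, q; rewrite ?polyC0 ?mul0r ?add0r.
have [_ lin] := spanned_lin (x :: s).
exists (c%:P%:P * y + q1); first by apply: lin => //; exact: lift.
have -> : r - (c%:P%:P * y + q1) = (r - q1) - c%:P%:P * y by ring.
have cyA : inA (c%:P%:P * y) by exact: inAM.
have os z : spanned s z -> dot ((r - q1) - c%:P%:P * y) z = 0.
  move=> sz; have zA := spA _ sz.
  by rewrite dotBl// dotZl// o1// ox// mulr0 subr0.
have oy : dot ((r - q1) - c%:P%:P * y) y = 0.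
  rewrite dotBl// dotZl// dot_self.
  have [y0|y0] := eqVneq (nrm y) 0; first by rewrite y0 mulr0 subr0 nrm0_dot.
  rewrite /c -mulrA -rmorphM /= mulVf// -[RHS](subrr (dot (r - q1) y)).
  by congr (_ - _); rewrite mulr1.
move=> z [a [z' -> sz']].
have -> : a%:P%:P * x + z' = a%:P%:P * y + (a%:P%:P * qx + z') by rewrite /y; ring.
have z'A := spA _ sz'; have qxA := spA _ sqx.
have RA : inA ((r - q1) - c%:P%:P * y) by exact: inAB.
have ayA := inAM a%:P%:P yA.
have restA := inAD (inAM a%:P%:P qxA) z'A.
rewrite (dotDr ayA restA RA) (dotZr a yA RA) oy mulr0 add0r.
by apply: os; have [_ h] := spanned_lin s; exact: h.
Qed.

(** [S] is a mere predicate. Among the matrix subspaces that [phi] maps into [S], one of maximal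
    dimension contains every matrix mapped into [S]; the image of its basis is the list. *)
Lemma subspace_spanned (n m : nat) (S : V -> Prop) : lin_closed S ->
  (forall f, S f -> (size f <= m)%N /\ forall j, (size (f`_j)%R <= n)%N) ->
  exists s, (forall x, x \in s -> S x) /\ forall f, S f -> spanned s f.
Proof.
move=> [S0 SL] Sb.
pose phi (M : 'M[R[i]]_(m, n)) : V :=
  \sum_(j < m) (\sum_(k < n) (M j k)%:P * 'X^k)%:P * 'X^j.
have phiL c M N : phi (c *: M + N) = c%:P%:P * phi M + phi N.
  rewrite /phi mulr_sumr -big_split; apply: eq_bigr => j _ /=.
  rewrite mulrA -polyCM -mulrDl -polyCD; congr (_%:P * _).
  rewrite mulr_sumr -big_split; apply: eq_bigr => k _ /=.
  by rewrite !mxE polyCD polyCM; ring.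
have phiS f : S f -> exists M, f = phi M.
  move=> /Sb[sf sfj]; exists (\matrix_(j, k) (f`_j)`_k).
  rewrite -[LHS]coefK poly_def (big_ord_widen m (fun i => f`_i *: 'X^i) sf).
  rewrite big_mkcond /=; apply: eq_bigr => j _; rewrite -mul_polyC.
  case: ltnP => h; last first.
    rewrite big1 ?polyC0 ?mul0r// => k _.
    by rewrite mxE [f`_j]nth_default// coef0 polyC0 mul0r.
  congr (_%:P * _); rewrite -[LHS]coefK poly_def.
  rewrite (big_ord_widen n (fun i => (f`_j)`_i *: 'X^i) (sfj j)) big_mkcond /=.
  apply: eq_bigr => k _; rewrite mxE -mul_polyC.
  by case: ltnP => // h'; rewrite [(f`_j)`_k]nth_default// polyC0 mul0r.
pose P (U : {vspace 'M[R[i]]_(m, n)}) := forall M, M \in U -> S (phi M).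
pose Pd d := `[< exists2 U, P U & \dim U = d >].
have exP : exists d, Pd d.
  exists 0%N; apply/asboolP; exists 0%VS; last exact: dimv0.
  move=> M; rewrite memv0 => /eqP ->.
  have -> : phi 0 = 0 by have := phiL (-1) 0 0; rewrite scaler0 addr0 !polyCN !polyC1 mulN1r addNr.
  exact: S0.
have bP d : Pd d -> (d <= \dim {:'M[R[i]]_(m, n)})%N.
  by move=> /asboolP[U _ <-]; rewrite dimvS// subvf.
case: (ex_maxnP exP bP) => d /asboolP[U PU dU] dmax.
exists [seq phi M | M <- vbasis U]; split.
  move=> _ /mapP[M /vbasis_mem MU ->]; exact: PU.
move=> f Sf; have [M fM] := phiS f Sf.
have MU : M \in U.
  apply/negPn/negP => nMU.
  have PU' : P (<[M]> + U)%VS.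
    move=> N /memv_addP[_ /vlineP[c ->] [N' NU ->]].
    by rewrite phiL; apply: SL; [rewrite -fM|exact: PU].
  have : Pd (\dim (<[M]> + U)) by apply/asboolP; exists (<[M]> + U)%VS.
  move=> /dmax; rewrite -dU leqNgt => /negP; apply.
  rewrite ltn_neqAle dimvS ?addvSr// andbT; apply/eqP => e.
  have : (U == <[M]> + U)%VS by rewrite -dimv_leqif_eq ?addvSr// e.
  move=> /eqP h; move: nMU; rewrite h => /negP; apply.
  have : M + 0 \in (<[M]> + U)%VS by rewrite memv_add ?mem0v ?memv_line.
  by rewrite addr0.
rewrite fM (coord_vbasis MU).
have phi0 : phi 0 = 0.
  by have := phiL (-1) 0 0; rewrite scaler0 addr0 !polyCN !polyC1 mulN1r addNr.
have [_ lin] := spanned_lin [seq phi M | M <- vbasis U].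
elim/big_rec: _ => [|i N _ IH]; first by rewrite phi0; exact: spanned0.
rewrite phiL; apply: lin => //; apply: spanned_mem; apply: map_f.
by rewrite mem_nth// size_tuple.
Qed.

End Projection.

(** * Limits along an ultrafilter *)

Section UltraLimit.
Variables (R : realType) (U : set_system nat).
Context {UU : UltraFilter U}.
Implicit Types F G : nat -> R[i].

Definition ccvg F (l : R[i]) :=
  (complex.Re (F N) @[N --> U] --> complex.Re l) /\
  (complex.Im (F N) @[N --> U] --> complex.Im l).

(** Takes the place of a diagonal extraction: all coefficient sequences converge along one and the
    same [U]. *)
Lemma ultra_bounded (x : nat -> R) B : (forall N, - B <= x N <= B) ->
  exists l : R, x N @[N --> U] --> l.
Proof.
move=> xB; have := @segment_compact R (- B) B => /(_ (x @ U) _) [].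
  by apply: (@filterS _ U _ setT _ _ filterT) => N _ /=; rewrite in_itv /=; exact: xB.
move=> l [_ cl]; exists l => V nV.
have [//|nUV] := in_ultra_setVsetC (x @^-1` V) UU.
by have [y [yV]] := cl (~` V) V nUV nV.
Qed.

Lemma ccvg_bounded F B : (forall N, sqnorm (F N) <= B) -> exists l, ccvg F l.
Proof.
move=> FB; have H (a : R) : a ^+ 2 <= B -> - (1 + B) <= a <= 1 + B.
  by move=> aB; rewrite -ler_norml; have := normr_le1D a; lra.
have [x hx] := @ultra_bounded (fun N => complex.Re (F N)) (1 + B)
  (fun N => H _ (le_trans (sqnormRe _) (FB N))).
have [y hy] := @ultra_bounded (fun N => complex.Im (F N)) (1 + B)
  (fun N => H _ (le_trans (sqnormIm _) (FB N))).
by exists (Complex x y).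
Qed.

Lemma ccvg_cst c : ccvg (fun=> c) c.
Proof. by split; exact: cvg_cst. Qed.

Lemma ccvgD F G l k : ccvg F l -> ccvg G k -> ccvg (fun N => F N + G N) (l + k).
Proof.
move=> [F1 F2] [G1 G2]; split; rewrite ?ReD ?ImD.
  by under eq_fun do rewrite ReD; exact: cvgD.
by under eq_fun do rewrite ImD; exact: cvgD.
Qed.

Lemma ccvgM F G l k : ccvg F l -> ccvg G k -> ccvg (fun N => F N * G N) (l * k).
Proof.
move=> [F1 F2] [G1 G2]; split; rewrite ?ReM ?ImM.
  by under eq_fun do rewrite ReM; apply: cvgB; exact: cvgM.
by under eq_fun do rewrite ImM; apply: cvgD; exact: cvgM.
Qed.

Lemma ccvg_sum (I : Type) (r : seq I) (P : pred I) (F : I -> nat -> R[i]) l :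
  (forall i, P i -> ccvg (F i) (l i)) ->
  ccvg (fun N => \sum_(i <- r | P i) F i N) (\sum_(i <- r | P i) l i).
Proof.
move=> h; elim: r => [|i r IH].
  by rewrite big_nil; under eq_fun do rewrite big_nil; exact: ccvg_cst.
rewrite big_cons; under eq_fun do rewrite big_cons.
by case Pi : (P i) => //; apply: ccvgD => //; exact: h.
Qed.

Lemma ccvg_near F G l : (\forall N \near U, F N = G N) -> ccvg F l -> ccvg G l.
Proof.
move=> FG [F1 F2]; split; [apply: cvg_trans F1|apply: cvg_trans F2];
  by apply: near_eq_cvg; apply: filterS FG => N /= ->.
Qed.

Lemma ccvg_unique F l k : ccvg F l -> ccvg F k -> l = k.
Proof.
by move=> [a1 a2] [b1 b2]; apply: complex_ext; [exact: cvg_unique a1 b1|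
  exact: cvg_unique a2 b2].
Qed.

Lemma ccvg_sqnorm_le F l (B : nat -> R) : ccvg F l ->
  (forall e : R, 0 < e -> \forall N \near U, B N <= e) ->
  (forall N, sqnorm (F N) <= B N) -> l = 0.
Proof.
move=> [F1 F2] B0 FB; apply/eqP; rewrite -sqnorm_eq0 eq_le sqnorm_ge0 andbT.
apply/ler_addgt0Pr => e e0; rewrite add0r.
have h : sqnorm (F N) @[N --> U] --> sqnorm l.
  by apply: cvgD; under eq_fun do rewrite expr2; rewrite expr2; exact: cvgM.
apply: (closed_cvg (fun y => y <= e) (@closed_le _ e) _ _ h).
by apply: filterS (B0 e e0) => N; exact: le_trans (FB N).
Qed.

Lemma ccvg_sqnorm_bound F l (B : R) : ccvg F l -> (forall N, sqnorm (F N) <= B) ->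
  sqnorm l <= B.
Proof.
move=> [F1 F2] FB.
have h : sqnorm (F N) @[N --> U] --> sqnorm l.
  by apply: cvgD; under eq_fun do rewrite expr2; rewrite expr2; exact: cvgM.
apply: (closed_cvg (fun y => y <= B) (@closed_le _ B) _ _ h).
by apply: filterS filterT => N _; exact: FB.
Qed.

End UltraLimit.

(** The geometric series bound, free of division so that it follows by induction along Horner's
    scheme, from b = b|w| + b(1 - |w|). *)
Lemma horner_tail (C : numClosedFieldType) (q : {poly C}) (w b : C) : `|w| < 1 ->
  (forall k, `|q`_k| <= b) -> `|q.[w]| * (1 - `|w|) <= b.
Proof.
move=> w1; have w1' : 0 <= 1 - `|w| by rewrite subr_ge0 ltW.
elim/poly_ind: q => [|q c IH] h.
  by rewrite horner0 normr0 mul0r; have := h 0%N; rewrite coef0 normr0.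
have hq k : `|q`_k| <= b by have := h k.+1; rewrite coefD coefMX coefC addr0.
have hc : `|c| <= b by have := h 0%N; rewrite coefD coefMX coefC add0r.
rewrite hornerMXaddC.
apply: (le_trans (ler_wpM2r w1' (ler_normD _ _))).
rewrite normrM mulrDl mulrAC.
have -> : b = b * `|w| + b * (1 - `|w|) by ring.
by rewrite lerD ?ler_wpM2r ?IH.
Qed.

(** * A weight in z1 that compensates the zeros of p *)

Section CutOff.
Variables (R : realType) (n m : nat) (p : {poly {poly R[i]}}).
Hypothesis ss : semi_stable n m p.
Hypothesis m_gt0 : (0 < m)%N.
Local Notation pt := (ptilde n m p).
Local Notation D := (bezD m p pt).
Local Notation L := (bezl m p pt).
Local Notation inA := (inA p).
Local Notation dot := (dot p).
Local Notation quo := (quo p).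
Implicit Types (f g h s y : {poly {poly R[i]}}).

Lemma polyC_span_L y : (size y <= m)%N -> exists C : nat -> {poly R[i]},
  D%:P * y = \sum_(j < m) (C j)%:P * L j.
Proof.
move=> sy; pose adj := \adj (bezmx m p pt).
pose C (j : 'I_m) := \sum_(i < m) y`_i * adj i j.
exists (fun j => if insub j is Some j' then C j' else 0).
under eq_bigr do rewrite valK.
have -> : D%:P * y = \sum_(i < m) (y`_i)%:P * (D%:P * 'X^i).
  rewrite -{1}[y]coefK poly_def (big_ord_widen m (fun i => y`_i *: 'X^i) sy).
  rewrite big_mkcond mulr_sumr; apply: eq_bigr => i _ /=; rewrite -mul_polyC.
  case: ltnP => h; first by rewrite mulrCA.
  by rewrite nth_default// polyC0 mulr0 mul0r.
transitivity (\sum_(i < m) \sum_(j < m) (y`_i)%:P * ((adj i j)%:P * L j)).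
  apply: eq_bigr => i _.
  by rewrite (bezD_span (eq_leq (ss_size ss)) (size_pt n m p)) mulr_sumr.
rewrite exchange_big /=; apply: eq_bigr => j _.
rewrite /C rmorph_sum /= mulr_suml; apply: eq_bigr => i _.
by rewrite polyCM mulrA.
Qed.

(** Pairing with a multiple of [D] sees finitely many coefficients of g, with weights independent of
    g; such pairings are therefore continuous under coefficientwise limits. *)
Lemma dot_D_coef y : (size y <= m)%N ->
  exists (B : nat) (r : nat -> nat -> R[i]), forall g, inA g -> (size g <= m)%N ->
  dot g (D%:P * y) = \sum_(j < m) \sum_(k < B) r j k * (g`_j)`_(n + k).
Proof.
move=> sy; have [C hC] := polyC_span_L sy.
pose B := (\max_(j < m) size (C j))%N.
exists B, (fun j k => conjc (C j)`_k * vol R) => g gA sg.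
have XA k j : inA (('X^k)%:P * L j) by apply: inAM; exact: inA_L.
rewrite -(dot_unimodular p (s := ('X^n)%:P)); last exact: sqnorm_tev_Xn.
have -> : ('X^n)%:P * (D%:P * y) =
   \sum_(j < m) \sum_(k < B) ((C j)`_k)%:P%:P * (('X^(n + k))%:P * L j).
  rewrite hC mulr_sumr; apply: eq_bigr => j _.
  have sC : (size (C j) <= B)%N by exact: (leq_bigmax j).
  have -> : (C j)%:P = \sum_(k < B) ((C j)`_k)%:P%:P * ('X^k)%:P :> {poly {poly R[i]}}.
    rewrite -{1}[C j]coefK poly_def (big_ord_widen B (fun i => (C j)`_i *: 'X^i) sC).
    rewrite big_mkcond rmorph_sum; apply: eq_bigr => k _ /=.
    by case: ltnP => h; rewrite -polyCM mul_polyC// nth_default// scale0r polyC0.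
  rewrite mulr_suml mulr_sumr; apply: eq_bigr => k _.
  by rewrite exprD polyCM; ring.
have gA' := inAM ('X^n)%:P gA.
rewrite dot_sumr//; last by move=> j _; apply: inA_sum => k _; exact: inAM.
apply: eq_bigr => j _; rewrite dot_sumr//; last by move=> k _; exact: inAM.
apply: eq_bigr => k _; rewrite (dotZr _ (XA _ _) gA').
by rewrite (dot_bezl ss m_gt0)// mulrA.
Qed.

(** On the circle this is x^d conj q(x) with d = (size q).-1, a polynomial substitute for the
    conjugate of q. *)
Definition crev (q : {poly R[i]}) : {poly R[i]} :=
  \poly_(i < (size q).-1.+1) conjc q`_((size q).-1 - i).

Lemma crevE q (x : R) : (crev q).[tor x] = tor x ^+ (size q).-1 * conjc q.[tor x].
Proof. by rewrite conj_horner_wide ?sqnorm_tor// leqSpred. Qed.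

Lemma psi_exists : exists2 c : R, 0 < c & forall x : R, sqnorm (D ^+ 2).[tor x] <= c.
Proof.
have [M hM] := horner_tor_bounded (D ^+ 2).
exists (M + 1); last first.
  by move=> x; apply: le_trans (hM _ (sqnorm_tor x)) _; rewrite lerDl ler01.
have := le_trans (sqnorm_ge0 _) (hM _ (sqnorm_tor 0)); lra.
Qed.

(** For c as in [psi_exists] this lies in [0, 1] and equals 1 exactly where [D] = 0, so its powers
    tend to 0 elsewhere. The square of [D] supplies one factor for each side of an inner product. *)
Definition psi (c : R) (t : R * R) : R := 1 - sqnorm (D ^+ 2).[tor t.1] / c.

(** 1 - psi^K is divisible by 1 - psi = |D|^4/c. Multiplication by x^d, d the degree of D^2, yields
    polynomials: Z = x^d and Y = x^d (1 - psi) on the circle, and Z^K - (Z - Y)^K has the factor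
    Y. *)
Lemma cutoff_poly (c : R) K : exists (T : nat) (W : {poly R[i]}), forall t,
  ((1 - psi c t ^+ K)%:C)%C = tor t.1 ^+ T * conjc ((D ^+ 2).[tor t.1] * W.[tor t.1]).
Proof.
set E := D ^+ 2; pose d := (size E).-1.
pose Y := (c^-1%:C%C)%:P * (E * crev E); pose Z : {poly R[i]} := 'X^d.
pose W := (c^-1%:C%C)%:P * crev E * \sum_(i < K) Z ^+ (K.-1 - i) * (Z - Y) ^+ i.
have EW : E * W = Z ^+ K - (Z - Y) ^+ K.
  rewrite subrXX opprB addrCA subrr addr0 /W /Y mulrA; congr (_ * _); ring.
exists (d * K)%N, W => t; set x := tor t.1.
have xJ k : x ^+ k * conjc (x ^+ k) = 1.
  by rewrite mulJ_sqnorm sqnormX sqnorm_tor expr1n.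
have RC1 (a : R) : ((1 - a)%:C)%C = 1 - (a%:C)%C by rewrite rmorphB rmorph1.
have RCX (a : R) : ((a ^+ K)%:C)%C = (a%:C)%C ^+ K by rewrite rmorphXn.
have Zx : Z.[x] = x ^+ d by rewrite hornerXn.
have Yx : Y.[x] = x ^+ d * ((1 - psi c t)%:C)%C.
  rewrite /Y hornerM hornerC hornerM crevE -/x -/d /psi -/E -/x.
  rewrite [E.[x] * _]mulrCA mulJ_sqnorm opprB addrCA subrr addr0.
  by rewrite rmorphM /= mulrCA [(_ * _%:C%C)]mulrC.
have -> : E.[x] * W.[x] = x ^+ (d * K) * ((1 - psi c t ^+ K)%:C)%C.
  rewrite -hornerM EW hornerD hornerN !horner_exp hornerD hornerN Zx Yx.
  have -> : x ^+ d - x ^+ d * ((1 - psi c t)%:C)%C = x ^+ d * ((psi c t)%:C)%C.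
    by rewrite RC1 mulrBr mulr1 opprB addrCA subrr addr0.
  by rewrite hornerX exprMn RC1 RCX -!exprM mulrBr mulr1.
by rewrite conjcM mulrA xJ mul1r conjc_real.
Qed.

(** Of the two conjugate factors [D], one moves to the left argument through [crev], the other stays
    on the right. Both arguments then lie in the space, whatever h and y are. *)
Lemma cutoff_dot (c : R) K : exists P Q : {poly R[i]},
  (forall h, inA (P%:P * h)) /\
  forall h y (t : R * R), ((1 - psi c t ^+ K)%:C)%C * (quo h t * conjc (quo y t)) =
    quo (P%:P * h) t * conjc (quo (D%:P * (Q%:P * y)) t).
Proof.
have [T [W hW]] := cutoff_poly c K.
exists ('X^T * crev D), ('X^((size D).-1) * W); split=> [h|h y t].
  apply: (inA_polyC _ (inA_D ss m_gt0 h)) => x; rewrite hornerM hornerXn crevE.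
  by rewrite !sqnormM !sqnormX !sqnorm_tor !expr1n !mul1r sqnormJ.
rewrite hW (quo_polyC _ _ h) (quo_polyC _ D) (quo_polyC _ _ y).
rewrite (hornerM 'X^T) (hornerM 'X^_) !hornerXn crevE expr2 (hornerM D).
set x := tor t.1; set d := (size D).-1.
have xJ : x ^+ d * conjc (x ^+ d) = 1.
  by rewrite mulJ_sqnorm sqnormX sqnorm_tor expr1n.
rewrite (conjcM (D.[x] * D.[x])) (conjcM D.[x] D.[x]) (conjcM D.[x]).
rewrite (conjcM (x ^+ d * W.[x])) (conjcM (x ^+ d)).
move: (x ^+ d) (conjc (x ^+ d)) (x ^+ T) (conjc D.[x]) (conjc W.[x]) (quo h t)
  (conjc (quo y t)) xJ => X Xc T' Dc W' h' y' XXc.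
transitivity ((X * Xc) * (T' * (Dc * Dc * W') * (h' * y'))); last by ring.
by rewrite XXc mul1r.
Qed.

End CutOff.

(** * Weighted norms and their monotone limit *)

Section CutOffIntegral.
Variables (R : realType) (n m : nat) (p : {poly {poly R[i]}}).
Hypothesis ss : semi_stable n m p.
Hypothesis m_gt0 : (0 < m)%N.
Local Notation pt := (ptilde n m p).
Local Notation D := (bezD m p pt).
Local Notation inA := (inA p).
Local Notation dot := (dot p).
Local Notation nrm := (nrm p).
Local Notation quo := (quo p).
Local Notation mu := (@leb2 R).
Local Notation TT := (@torus_dom R).
Variables (c : R) (a : {poly {poly R[i]}}).
Hypothesis c_gt0 : 0 < c.
Hypothesis hc : forall x : R, sqnorm (D ^+ 2).[tor x] <= c.
Local Notation psi := (psi n m p c).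
Implicit Types (f g h y : {poly {poly R[i]}}) (K : nat).

Let mT : @measurable _ (measurableTypeR R * measurableTypeR R)%type TT :=
  @measurable_torus R.

Lemma psi_ge0 t : 0 <= psi t.
Proof. by rewrite subr_ge0 ler_pdivrMr// mul1r hc. Qed.
Lemma psi_le1 t : psi t <= 1.
Proof. by rewrite lerBlDr lerDl divr_ge0 ?sqnorm_ge0// ltW. Qed.

Lemma measurable_psi : measurable_fun TT psi.
Proof.
apply: measurable_funB; first exact: measurable_cst.
apply: measurable_funM; last exact: measurable_cst.
apply: measurable_sqnorm; apply: cmeas_horner.
exact: (cmeas_tor (@measurable_fst_torus R)).
Qed.

Definition cutw K t : R := 1 - psi t ^+ K.

Lemma cutw_ge0 K t : 0 <= cutw K t.
Proof. by rewrite subr_ge0 exprn_ile1 ?psi_ge0 ?psi_le1. Qed.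
Lemma cutw_le1 K t : cutw K t <= 1.
Proof. by rewrite lerBlDr lerDl exprn_ge0// psi_ge0. Qed.

Lemma measurable_cutw K : measurable_fun TT (cutw K).
Proof.
apply: measurable_funB; first exact: measurable_cst.
by apply: measurable_funX; exact: measurable_psi.
Qed.

Definition cutJ K : R := Rintegral mu TT (fun t => cutw K t * sqnorm (quo a t)).

Lemma quo_selfJ t K : ((cutw K t * sqnorm (quo a t))%:C)%C =
  ((cutw K t)%:C)%C * (quo a t * conjc (quo a t)).
Proof. by rewrite mulJ_sqnorm rmorphM. Qed.

Lemma cutJ_integrable K :
  mu.-integrable TT (EFin \o (fun t => cutw K t * sqnorm (quo a t))).
Proof.
have [P [Q [PA E]]] := cutoff_dot ss m_gt0 c K.
have [+ _] := cintegrable_mulJ mT (PA a) (inA_D ss m_gt0 (Q%:P * a)).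
apply: (eq_integrable mT) => // t _ /=; congr (_%:E).
by rewrite -E -quo_selfJ.
Qed.

Lemma cutJ_dot K (P Q : {poly R[i]}) :
  (forall h y t, ((cutw K t)%:C)%C * (quo h t * conjc (quo y t)) =
     quo (P%:P * h) t * conjc (quo (D%:P * (Q%:P * y)) t)) ->
  dot (P%:P * a) (D%:P * (Q%:P * a)) = ((cutJ K)%:C)%C.
Proof.
move=> E; transitivity (cint mu TT (fun t => ((cutw K t * sqnorm (quo a t))%:C)%C)).
  by apply: eq_cint => t _; rewrite -E quo_selfJ.
by apply: complex_ext; rewrite //= Rintegral_cst// mul0r.
Qed.

Lemma cutJ_ge0 K : 0 <= cutJ K.
Proof. by apply: Rintegral_ge0 => t _; rewrite mulr_ge0 ?cutw_ge0 ?sqnorm_ge0. Qed.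

(** 0 <= W <= 1 gives W^2 <= W, so W F is square integrable as soon as W |F|^2 is integrable. *)
Lemma sqint_weighted (W : R * R -> R) (F : R * R -> R[i]) : measurable_fun TT W ->
  cmeas TT F -> (forall t, 0 <= W t <= 1) ->
  mu.-integrable TT (EFin \o (fun t => W t * sqnorm (F t))) ->
  sqint mu TT (fun t => ((W t)%:C)%C * F t) /\
  sqnormI mu TT (fun t => ((W t)%:C)%C * F t) <=
  Rintegral mu TT (fun t => W t * sqnorm (F t)).
Proof.
move=> mW mF W01 iWF.
have mWF : cmeas TT (fun t => ((W t)%:C)%C * F t) by apply: cmeasM => //; exact: cmeasR.
have le t : sqnorm (((W t)%:C)%C * F t) <= W t * sqnorm (F t).
  have /andP[W0 W1] := W01 t.
  rewrite sqnormM /sqnorm /= expr0n addr0 -/(sqnorm (F t)) ler_wpM2r ?sqnorm_ge0//.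
  by rewrite expr2 ler_piMl.
have iS : mu.-integrable TT (EFin \o (fun t => sqnorm (((W t)%:C)%C * F t))).
  apply: (le_integrable mT _ _ iWF); first exact/measurable_EFinP/measurable_sqnorm.
  move=> t _ /=; rewrite lee_fin ger0_norm ?sqnorm_ge0//.
  by apply: le_trans (le t) _; exact: ler_norm.
by split=> //; apply: le_Rintegral.
Qed.

(** The pairing is <f, (1 - psi^K) a>. Its right argument is square integrable even when a/p is
    not. *)
Lemma cut_dot_bound K (P Q : {poly R[i]}) f : inA f ->
  (forall h y t, ((cutw K t)%:C)%C * (quo h t * conjc (quo y t)) =
     quo (P%:P * h) t * conjc (quo (D%:P * (Q%:P * y)) t)) ->
  sqnorm (dot (P%:P * f) (D%:P * (Q%:P * a))) <= nrm f * cutJ K.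
Proof.
move=> fA E.
have [sW leW] := sqint_weighted (measurable_cutw K) (cmeas_quo p a)
  (fun t => ltac:(by rewrite cutw_ge0 cutw_le1)) (cutJ_integrable K).
have -> : dot (P%:P * f) (D%:P * (Q%:P * a)) =
    cip mu TT (quo f) (fun t => ((cutw K t)%:C)%C * quo a t).
  apply: eq_cint => t _; rewrite -E (conjcM ((cutw K t)%:C)%C) conjc_real.
  by rewrite mulrCA.
apply: le_trans (cip_CauchySchwarz mT fA sW) _.
by rewrite ler_wpM2l ?sqnormI_ge0.
Qed.

Lemma cutJ_le K : inA a -> cutJ K <= nrm a.
Proof.
move=> [_ ia]; apply: (le_Rintegral mT (cutJ_integrable K) ia) => t _.
by rewrite ler_piMl ?sqnorm_ge0 ?cutw_le1.
Qed.

(** Orthogonality to a exchanges the weight 1 - psi^K for -psi^K, whose squared norm on a is at most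
    [nrm a] - J_K and shrinks with K. *)
Lemma cut_dot_orth_bound K (P Q : {poly R[i]}) f : inA f -> inA a -> dot f a = 0 ->
  (forall h y t, ((cutw K t)%:C)%C * (quo h t * conjc (quo y t)) =
     quo (P%:P * h) t * conjc (quo (D%:P * (Q%:P * y)) t)) ->
  sqnorm (dot (P%:P * f) (D%:P * (Q%:P * a))) <= nrm f * (nrm a - cutJ K).
Proof.
move=> fA aA fa0 E.
have iW : mu.-integrable TT (EFin \o (fun t => psi t ^+ K * sqnorm (quo a t))).
  have [_ ia] := aA.
  apply: (eq_integrable mT) (integrableB mT ia (cutJ_integrable K)) => // t _ /=.
  by rewrite -EFinB /cutw; congr (_%:E); ring.
have [sW leW] := sqint_weighted (measurable_funX K measurable_psi) (cmeas_quo p a)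
  (fun t => ltac:(by rewrite exprn_ge0 ?exprn_ile1 ?psi_ge0 ?psi_le1)) iW.
have -> : dot (P%:P * f) (D%:P * (Q%:P * a)) =
    - cip mu TT (quo f) (fun t => ((psi t ^+ K)%:C)%C * quo a t).
  have [sC _] := sqint_weighted (measurable_cutw K) (cmeas_quo p a)
    (fun t => ltac:(by rewrite cutw_ge0 cutw_le1)) (cutJ_integrable K).
  transitivity (cip mu TT (quo f) (fun t => ((cutw K t)%:C)%C * quo a t)).
    apply: eq_cint => t _; rewrite -E (conjcM ((cutw K t)%:C)%C) conjc_real.
    by rewrite mulrCA.
  apply/eqP; rewrite -addr_eq0 -(cipDr mT sC sW fA); apply/eqP.
  rewrite -[RHS]fa0; apply: eq_cip => // t _.
  by rewrite -mulrDl -rmorphD /= /cutw subrK mul1r.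
rewrite sqnormN; apply: le_trans (cip_CauchySchwarz mT fA sW) _.
rewrite ler_wpM2l ?sqnormI_ge0//; apply: le_trans leW _.
have [_ ia] := aA; rewrite -(RintegralB mT ia (cutJ_integrable K)).
apply: le_Rintegral => //; last by move=> t _; rewrite /cutw; lra.
exact: (integrableB mT ia (cutJ_integrable K)).
Qed.

(** D/D is the indicator function of D <> 0, because 0/0 = 0. *)
Definition quo' t : R[i] := D.[tor t.1] / D.[tor t.1] * quo a t.

Lemma cutw_quo' K t : cutw K t * sqnorm (quo' t) = cutw K t * sqnorm (quo a t).
Proof.
rewrite /quo'; have [D0|D0] := eqVneq D.[tor t.1] 0; last by rewrite divff// mul1r.
rewrite /cutw /psi horner_exp D0 expr0n sqnorm0 mul0r subr0 expr1n subrr.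
by rewrite !mul0r.
Qed.

Lemma cutw_cvg t : (cutw K t * sqnorm (quo a t))%:E @[K --> \oo] --> (sqnorm (quo' t))%:E.
Proof.
apply: cvg_EFin; first by apply: nearW.
under eq_fun do rewrite /= -cutw_quo'.
have [D0|D0] := eqVneq D.[tor t.1] 0.
  rewrite /quo' D0 mul0r mul0r sqnorm0.
  by under eq_fun do rewrite mulr0; exact: cvg_cst.
have h : psi t ^+ K @[K --> \oo] --> (0 : R).
  apply: cvg_expr; rewrite ger0_norm ?psi_ge0//.
  rewrite ltrBlDr ltrDl divr_gt0// lt_def sqnorm_ge0 andbT sqnorm_eq0 horner_exp.
  by rewrite expf_neq0.
have := cvgM (cvgB (cvg_cst (1 : R)) h) (cvg_cst (sqnorm (quo' t))).
by rewrite subr0 mul1r => h2; exact: h2.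
Qed.

Lemma measurable_quo' : cmeas TT quo'.
Proof.
have mD : cmeas TT (fun t => D.[tor t.1]).
  by apply: cmeas_horner; exact: (cmeas_tor (@measurable_fst_torus R)).
by apply: cmeasM; [apply: cmeasM => //; exact: cmeasV|exact: cmeas_quo].
Qed.

Lemma integral_quo' : (\int[mu]_(t in TT) (sqnorm (quo' t))%:E =
  \int[mu]_(t in TT) (sqnorm (quo a t))%:E)%E.
Proof.
apply: ae_eq_integral => //.
- exact/measurable_EFinP/measurable_sqnorm/measurable_quo'.
- exact/measurable_EFinP/measurable_sqnorm/cmeas_quo.
have mb : @measurable _ (measurableTypeR R) (badset n m p).
  by apply: (countable_measurable (fun x => measurable_set1 x)); exact: countable_badset.
exists (badset n m p `*` setT); split.
- exact: measurableX.
- have e : mu (badset n m p `*` setT) =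
      (lebesgue_measure (badset n m p) * lebesgue_measure (@setT R))%E.
    by exact: (product_measure1E _ _ mb measurableT).
  rewrite [LHS]e countable_lebesgue_measure0 ?mul0e//; exact: countable_badset.
move=> t /= /not_implyP[Tt ne]; split => //; split; first by case: Tt.
by apply: contrapT => /eqP D0; apply: ne; rewrite /quo' divff// mul1r.
Qed.

(** Monotone convergence in the extended reals: the limit may be infinite, so the statement can
    serve to prove that a lies in the space. *)
Lemma cutJ_cvg : ((cutJ K)%:E @[K --> \oo] --> \int[mu]_(t in TT) (sqnorm (quo a t))%:E)%E.
Proof.
have -> : (fun K => (cutJ K)%:E) =
    (fun K => \int[mu]_(t in TT) (cutw K t * sqnorm (quo a t))%:E)%E.
  by apply/funext => K; rewrite /cutJ fineK//; exact: (integrable_fin_num mT (cutJ_integrable K)).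
rewrite -integral_quo'.
have -> : (\int[mu]_(t in TT) (sqnorm (quo' t))%:E =
    \int[mu]_(t in TT) limn (fun K => (cutw K t * sqnorm (quo a t))%:E))%E.
  by apply: eq_integral => t _; apply/esym/cvg_lim => //; exact: cutw_cvg.
apply: (cvg_monotone_convergence mT).
- move=> K; apply/measurable_EFinP; apply: measurable_funM; first exact: measurable_cutw.
  exact/measurable_sqnorm/cmeas_quo.
- by move=> K t _; rewrite lee_fin mulr_ge0 ?cutw_ge0 ?sqnorm_ge0.
- move=> t _ K K' KK'; rewrite lee_fin ler_wpM2r ?sqnorm_ge0// lerD2l lerN2.
  by rewrite ler_wiXn2l ?psi_ge0 ?psi_le1.
Qed.

End CutOffIntegral.

(** * Vanishing of [ev] on the orthogonal complement of G *)

Section KeyOrthogonality.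
Variables (R : realType) (n m : nat) (p : {poly {poly R[i]}}).
Hypothesis ss : semi_stable n m p.
Hypothesis m_gt0 : (0 < m)%N.
Local Notation pt := (ptilde n m p).
Local Notation D := (bezD m p pt).
Local Notation L := (bezl m p pt).
Local Notation inA := (inA p).
Local Notation dot := (dot p).
Local Notation nrm := (nrm p).
Local Notation quo := (quo p).
Variables (w v : R[i]).
Hypothesis w1 : `|w| < 1.
Hypothesis hp : hev w v m p = 0.
Hypothesis hpt : hev w v m pt = 0.
Local Notation ev := (hev w v m.-1).
Implicit Types (f g h r y : {poly {poly R[i]}}).

Definition finG f := [/\ (size f <= m)%N, (forall j, (size (f`_j)%R <= n)%N) & inA f].

Lemma finG_lin : lin_closed finG.
Proof.
split=> [|c f g [sf sfj fA] [sg sgj gA]].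
  by split=> [|j|]; rewrite ?size_poly0// ?coef0 ?size_poly0//; exact: inA0.
split.
- apply: leq_trans (size_polyD _ _) _; rewrite geq_max sg andbT mul_polyC.
  exact: leq_trans (size_scale_leq _ _) sf.
- move=> j; rewrite coefD coefCM; apply: leq_trans (size_polyD _ _) _.
  rewrite geq_max sgj andbT mul_polyC.
  exact: leq_trans (size_scale_leq _ _) (sfj j).
- by apply: inAD => //; exact: inAM.
Qed.

(** The pairing reads off a coefficient of z1^(n+k), and elements of G have z1-degree below n. *)
Lemma dot_finG_bezl g k j : finG g -> (j < m)%N -> dot g (('X^k)%:P * L j) = 0.
Proof.
move=> [sg sgj gA] jm.
rewrite -(dot_unimodular p (s := ('X^n)%:P)); last exact: sqnorm_tev_Xn.
have -> : ('X^n)%:P * (('X^k)%:P * L j) = ('X^(n + k))%:P * L j.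
  by rewrite mulrA -polyCM -exprD.
rewrite (dot_bezl ss m_gt0)// nth_default ?mulr0//.
by apply: leq_trans (sgj j) _; rewrite leq_addr.
Qed.

Lemma approximant r N : inA r -> (size r <= m)%N ->
  (forall g, finG g -> dot r g = 0) ->
  exists f, [/\ [/\ inA f, (size f <= m)%N & nrm f <= nrm r], ev f = ev r,
    (forall g, finG g -> dot f g = 0) &
    forall j k, (k < N)%N -> (f`_j)`_(n + k) = 0].
Proof.
move=> rA sr rG.
pose s := [seq ('X^k)%:P * L j | k <- iota 0 N, j <- iota 0 m].
pose S q := [/\ inA q, (size q <= m)%N, ev q = 0 & forall g, finG g -> dot q g = 0].
have Sl : lin_closed S.
  split=> [|c f g [fA sf ef fG] [gA sg eg gG]].
    by split; [exact: inA0|rewrite size_poly0|exact: hev0|move=> g _; rewrite dot0l].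
  split.
  - by apply: inAD => //; exact: inAM.
  - apply: leq_trans (size_polyD _ _) _; rewrite geq_max sg andbT mul_polyC.
    exact: leq_trans (size_scale_leq _ _) sf.
  - by rewrite hevD hevZ ef eg mulr0 addr0.
  - move=> h hG; have hA : inA h by case: hG.
    by rewrite dotDl ?dotZl ?fG ?gG ?mulr0 ?addr0//; exact: inAM.
have memS q : q \in s -> S q.
  move=> /allpairsP[[k' j'] /= [_ + ->]].
  rewrite mem_iota /= add0n => jm.
  have LA := inAM ('X^k')%:P (inA_L ss j').
  split=> //.
  - rewrite mul_polyC; apply: leq_trans (size_scale_leq _ _) _.
    exact: (size_bezl (eq_leq (ss_size ss)) (size_pt n m p) jm).
  - by rewrite hevZ (hev_bezl (eq_leq (ss_size ss)) (size_pt n m p) jm hp hpt) mulr0.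
  - move=> g gG; have gA : inA g by case: gG.
    by rewrite (dotJ gA LA) dot_finG_bezl// conjc0.
have sA q : q \in s -> inA q by move=> /memS[].
have [q sq oq] := projection sA rA.
have [qA sqm eq qG] := spanned_closed Sl memS sq.
have fA : inA (r - q) by exact: inAB.
have sf : (size (r - q)%R <= m)%N.
  by apply: leq_trans (size_polyD _ _) _; rewrite size_polyN geq_max sr.
exists (r - q); split.
- split => //.
  have e : dot (r - q) (r - q) = dot (r - q) r by rewrite (dotBr rA qA fA) (oq q sq) subr0.
  have := dot_CauchySchwarz fA rA; rewrite -e dot_self /sqnorm /= expr0n addr0 expr2.
  have := nrm_ge0 p (r - q); rewrite le_eqVlt => /predU1P[<-|f0]; first by rewrite nrm_ge0.
  by rewrite ler_pM2l.
- by rewrite hevD hevN eq subr0.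
- move=> g gG; have gA : inA g by case: gG.
  by rewrite (dotBl rA qA gA) rG// qG// subr0.
- move=> j k kN; have [jm|jm] := ltnP j m; last first.
    have -> : (r - q)`_j = 0 by rewrite nth_default// (leq_trans sf).
    by rewrite coef0.
  have : ('X^k)%:P * L j \in s.
    by apply/allpairsP; exists (k, j); rewrite !mem_iota.
  move=> /spanned_mem/oq.
  rewrite -(dot_unimodular p (s := ('X^n)%:P)); last exact: sqnorm_tev_Xn.
  have -> : ('X^n)%:P * (('X^k)%:P * L j) = ('X^(n + k))%:P * L j.
    by rewrite mulrA -polyCM -exprD.
  rewrite (dot_bezl ss m_gt0)// => /eqP; rewrite mulf_eq0.
  by rewrite (negPf (vol_neq0 R)) => /eqP.
Qed.

Section Limit.
Variables (r : {poly {poly R[i]}}) (F : nat -> {poly {poly R[i]}}).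
Hypothesis FA : forall N, inA (F N).
Hypothesis Fm : forall N, (size (F N) <= m)%N.
Hypothesis Fr : forall N, nrm (F N) <= nrm r.
Hypothesis Fev : forall N, ev (F N) = ev r.
Hypothesis FG : forall N g, finG g -> dot (F N) g = 0.
Hypothesis Fgap : forall N j k, (k < N)%N -> ((F N)`_j)`_(n + k) = 0.
Variable U : set_system nat.
Context {UU : UltraFilter U}.
Hypothesis Uoo : \oo `<=` U.

Lemma near_oo (P : nat -> Prop) N0 : (forall N, (N0 <= N)%N -> P N) -> \forall N \near U, P N.
Proof. by move=> h; apply: Uoo; exists N0 => // N /h. Qed.

Lemma coef_limit : exists a : {poly {poly R[i]}}, [/\ (size a <= m)%N,
  (forall j, (size (a`_j)%R <= n)%N) &
  forall j k, ccvg U (fun N => ((F N)`_j)`_k) (a`_j)`_k].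
Proof.
have [C C0 hC] := coef_bound ss m_gt0.
have lim j k : exists l, ccvg U (fun N => ((F N)`_j)`_k) l.
  apply: (@ccvg_bounded R U _ _ (C * nrm r)) => N.
  by apply: le_trans (hC _ k j (FA N) (Fm N)) _; rewrite ler_wpM2l.
have [l hl] : exists l, forall j k, ccvg U (fun N => ((F N)`_j)`_k) (l j k).
  have [l0 h0] := choice (fun jk : nat * nat => lim jk.1 jk.2).
  by exists (fun j k => l0 (j, k)) => j k; exact: (h0 (j, k)).
exists (\poly_(j < m) \poly_(k < n) l j k); split; first exact: size_poly.
  by move=> j; rewrite coef_poly; case: ifP => _; rewrite ?size_poly0// size_poly.
move=> j k; rewrite coef_poly; case: ltnP => jm; last first.
  have z N : (F N)`_j = 0 by rewrite nth_default// (leq_trans (Fm N)).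
  rewrite coef0; under eq_fun do rewrite z coef0.
  exact: ccvg_cst.
rewrite coef_poly; case: ltnP => kn; first exact: hl.
(* Every fixed index k >= n is eventually inside the gap, so the limit has z1-degree below n. *)
apply: (ccvg_near (F := fun=> 0)); last exact: ccvg_cst.
apply: (@near_oo _ k.+1) => N kN.
by rewrite -(subnKC kn) Fgap//; lia.
Qed.

Variable a : {poly {poly R[i]}}.
Hypothesis am : (size a <= m)%N.
Hypothesis an : forall j, (size (a`_j)%R <= n)%N.
Hypothesis acvg : forall j k, ccvg U (fun N => ((F N)`_j)`_k) (a`_j)`_k.

(** The right argument is a fixed multiple of [D], so [dot_D_coef] leaves only convergence of
    coefficients. The hypothesis on P puts P a in the space while a is not yet known to be there. *)
Lemma dot_limit (P Q : {poly R[i]}) : (forall h, inA (P%:P * h)) ->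
  ccvg U (fun N => dot (P%:P * F N) (D%:P * (Q%:P * a))) (dot (P%:P * a) (D%:P * (Q%:P * a))).
Proof.
move=> PA; have sP (c : {poly R[i]}) h : (size h <= m)%N -> (size (c%:P * h)%R <= m)%N.
  by move=> sh; rewrite mul_polyC; exact: leq_trans (size_scale_leq _ _) sh.
have [B [e he]] := dot_D_coef ss m_gt0 (sP Q a am).
rewrite he ?sP//; under eq_fun do rewrite he ?sP//.
apply: ccvg_sum => j _; apply: ccvg_sum => k _; apply: ccvgM; first exact: ccvg_cst.
rewrite coefCM coefM; under eq_fun do rewrite coefCM coefM.
by apply: ccvg_sum => i _; apply: ccvgM; [exact: ccvg_cst|exact: acvg].
Qed.

(** Below the gap the coefficients converge. Above it they are bounded and come with powers of w of
    exponent at least n + N, so |w| < 1 sends that tail to 0. *)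
Lemma ev_limit : ev a = ev r.
Proof.
suff H : ccvg U (fun N => ev (F N)) (ev a).
  apply: (ccvg_unique H); under eq_fun do rewrite Fev; exact: ccvg_cst.
apply: ccvg_sum => j _; apply: ccvgM; last exact: ccvg_cst.
pose T N := (drop_poly (n + N) (F N)`_j).[w] * w ^+ (n + N).
have E N : ((F N)`_j).[w] = (a`_j).[w] + (\sum_(k < n) (((F N)`_j)`_k - (a`_j)`_k) * w ^+ k) + T N.
  rewrite -{1}(poly_take_drop (n + N) (F N)`_j) hornerD hornerM hornerXn; congr (_ + _).
  rewrite (horner_coef_wide _ (an j)) -big_split /=.
  rewrite (horner_coef_wide _ (size_take_poly _ _)) big_split_ord /=.
  rewrite [X in _ + X]big1 ?addr0; last first.
    by move=> k _; rewrite coef_take_poly ltn_add2l ltn_ord Fgap// mul0r.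
  apply: eq_bigr => k _; rewrite coef_take_poly (leq_trans (ltn_ord k)) ?leq_addr//.
  by rewrite -mulrDl addrC subrK.
have [C C0 hC] := coef_bound ss m_gt0.
pose rho : R := Num.sqrt (sqnorm w).
have rhoE : `|w| = (rho%:C)%C by rewrite normc_def.
have rho1 : 0 < 1 - rho by rewrite subr_gt0 -ltcR -rhoE.
pose beta : R := Num.sqrt (C * nrm r).
have b2 : beta ^+ 2 = C * nrm r by rewrite sqr_sqrtr// mulr_ge0// nrm_ge0.
have TB N : sqnorm (T N) <= (beta / (1 - rho)) ^+ 2 * sqnorm w ^+ (n + N).
  rewrite sqnormM sqnormX ler_wpM2r ?exprn_ge0 ?sqnorm_ge0//.
  have hb k : `|(drop_poly (n + N) (F N)`_j)`_k| <= (beta%:C)%C.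
    rewrite coef_drop_poly normc_def lecR; apply: ler_wsqrtr.
    by apply: le_trans (hC _ _ _ (FA N) (Fm N)) _; rewrite ler_wpM2l.
  have := horner_tail w1 hb; rewrite rhoE.
  set z := (drop_poly _ _).[w] => hz.
  have : Num.sqrt (sqnorm z) * (1 - rho) <= beta.
    by move: hz; rewrite normc_def -(rmorph1 (real_complex R)) -rmorphB -rmorphM lecR.
  rewrite -ler_pdivlMr// => hz'; rewrite -[sqnorm z]sqr_sqrtr ?sqnorm_ge0//.
  by rewrite ler_pXn2r// nnegrE ?sqrtr_ge0// divr_ge0 ?sqrtr_ge0// ltW.
have T0 : ccvg U T 0.
  have [|l hl] := @ccvg_bounded R U _ T ((beta / (1 - rho)) ^+ 2).
    move=> N; apply: le_trans (TB N) _; rewrite ler_piMr ?sqr_ge0//.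
    by rewrite exprn_ile1 ?sqnorm_ge0// ltW// sqnorm_lt1.
  suff <- : l = 0 by [].
  apply: (ccvg_sqnorm_le hl _ TB) => e e0.
  have : (beta / (1 - rho)) ^+ 2 * sqnorm w ^+ (n + N) @[N --> \oo] --> (0 : R).
    rewrite -[X in _ --> X](mulr0 ((beta / (1 - rho)) ^+ 2)).
    apply: cvgM; first exact: cvg_cst.
    have : (fun N => sqnorm w ^+ (n + N)) = (fun N => sqnorm w ^+ n * sqnorm w ^+ N).
      by apply/funext => N; rewrite exprD.
    move=> ->; rewrite -[X in _ --> X](mulr0 (sqnorm w ^+ n)).
    apply: cvgM; first exact: cvg_cst.
    by apply: cvg_expr; rewrite ger0_norm ?sqnorm_ge0// sqnorm_lt1.
  move/cvgrPdist_le => /(_ e e0) h; apply: Uoo; apply: filterS h => N.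
  by rewrite sub0r normrN; apply: le_trans; exact: ler_norm.
under eq_fun do rewrite E.
rewrite -[X in ccvg U _ X]addr0; apply: ccvgD => //.
rewrite -[X in ccvg U _ X]addr0; apply: ccvgD; first exact: ccvg_cst.
have e0 : \sum_(k < n) (((a`_j)`_k - (a`_j)`_k) * w ^+ k) = 0.
  by rewrite big1// => k _; rewrite subrr mul0r.
suff : ccvg U (fun N => \sum_(k < n) (((F N)`_j)`_k - (a`_j)`_k) * w ^+ k)
  (\sum_(k < n) (((a`_j)`_k - (a`_j)`_k) * w ^+ k)) by rewrite e0.
apply: (@ccvg_sum R U UU _ _ _ (fun (k : 'I_n) N => (((F N)`_j)`_k - (a`_j)`_k) * w ^+ k)
  (fun k => ((a`_j)`_k - (a`_j)`_k) * w ^+ k)) => k _; apply: ccvgM; last exact: ccvg_cst.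
apply: (@ccvgD R U UU (fun N => ((F N)`_j)`_k) (fun=> - (a`_j)`_k)).
  exact: acvg.
exact: ccvg_cst.
Qed.

(** Two passes, J_K being the weighted squared norm of a. The first, J_K^2 <= nrm r J_K, bounds J_K
    and puts a in G. Only then is each [F N] known to be orthogonal to a, which gives J_K^2 <= nrm r
    (nrm a - J_K); the limit in K leaves nrm a = 0. *)
Lemma limit_eq0 : a = 0.
Proof.
have [c c0 hc] := psi_exists n m p.
have nr0 := nrm_ge0 p r.
have J0 K := cutJ_ge0 a c0 hc K.
have Jle K : cutJ n m p c a K <= nrm r.
  have [P [Q [PA E]]] := cutoff_dot ss m_gt0 c K.
  have := dot_limit Q PA; rewrite (cutJ_dot a E) => cv.
  have : sqnorm ((cutJ n m p c a K)%:C)%C <= nrm r * cutJ n m p c a K.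
    apply: (ccvg_sqnorm_bound cv) => N.
    apply: le_trans (cut_dot_bound ss m_gt0 a c0 hc (FA N) E) _.
    by rewrite ler_wpM2r.
  rewrite /sqnorm /= expr0n addr0 expr2.
  have := J0 K; rewrite le_eqVlt => /predU1P[<-//|Jp].
  by rewrite ler_pM2r.
have cJ := @cutJ_cvg _ _ _ _ ss m_gt0 c a c0 hc.
have le_r : (\int[@leb2 R]_(t in @torus_dom R) (sqnorm (quo a t))%:E <= (nrm r)%:E)%E.
  rewrite -(cvg_lim _ cJ)//; apply: lime_le; first exact: (cvgP _ cJ).
  by apply: nearW => K; rewrite lee_fin.
have aA : inA a.
  split; first exact: cmeas_quo.
  apply/integrableP; split; first exact/measurable_EFinP/measurable_sqnorm/cmeas_quo.
  apply: le_lt_trans (ltry (nrm r)); apply: le_trans le_r.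
  rewrite le_eqVlt; apply/orP; left; apply/eqP; apply: eq_integral => t _ /=.
  by rewrite ger0_norm ?sqnorm_ge0.
have aG : finG a by [].
have Jle2 K : cutJ n m p c a K ^+ 2 <= nrm r * (nrm a - cutJ n m p c a K).
  have [P [Q [PA E]]] := cutoff_dot ss m_gt0 c K.
  have := dot_limit Q PA; rewrite (cutJ_dot a E) => cv.
  have : sqnorm ((cutJ n m p c a K)%:C)%C <= nrm r * (nrm a - cutJ n m p c a K).
    apply: (ccvg_sqnorm_bound cv) => N.
    have h := cut_dot_orth_bound ss m_gt0 c0 hc (FA N) aA (FG N aG) E.
    by apply: le_trans h _; rewrite ler_wpM2r// subr_ge0 (cutJ_le ss m_gt0).
  by rewrite /sqnorm /= expr0n addr0.
have cJr : cutJ n m p c a K @[K --> \oo] --> nrm a.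
  have := cJ; have -> : (\int[@leb2 R]_(t in @torus_dom R) (sqnorm (quo a t))%:E =
      (nrm a)%:E)%E.
    rewrite /nrm /sqnormI /Rintegral fineK//.
    have mT : @measurable _ (measurableTypeR R * measurableTypeR R)%type (@torus_dom R).
      exact: measurable_torus.
    exact: (integrable_fin_num mT aA.2).
  by move/fine_cvg.
have nA0 : nrm a ^+ 2 <= nrm r * (nrm a - nrm a).
  have h : cutJ n m p c a K ^+ 2 - nrm r * (nrm a - cutJ n m p c a K) @[K --> \oo]
      --> nrm a ^+ 2 - nrm r * (nrm a - nrm a).
    apply: cvgB; first by under eq_fun do rewrite expr2; rewrite expr2; exact: cvgM.
    by apply: cvgM; [exact: cvg_cst|apply: cvgB => //; exact: cvg_cst].
  rewrite -subr_le0 -(cvg_lim (@Rhausdorff R) h); apply: limr_le; first exact: (cvgP _ h).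
  by apply: nearW => K; rewrite subr_le0.
have na0 : nrm a = 0.
  by move: nA0; rewrite subrr mulr0 => h; apply/eqP; rewrite -sqrf_eq0 eq_le h sqr_ge0.
have [C C0 hC] := coef_bound ss m_gt0.
apply/polyP => j; apply/polyP => k; rewrite !coef0; apply/eqP.
rewrite -sqnorm_eq0 eq_le sqnorm_ge0 andbT.
by apply: le_trans (hC _ k j aA am) _; rewrite na0 mulr0.
Qed.

End Limit.

Theorem ev_orthogonal r : inA r -> (size r <= m)%N ->
  (forall g, finG g -> dot r g = 0) -> ev r = 0.
Proof.
move=> rA sr rG.
have [F hF] := choice (fun N => approximant N rA sr rG).
have [U [UU Uoo]] := ultraFilterLemma (eventually_filter).
have FA N : inA (F N) by case: (hF N) => -[].
have Fm N : (size (F N) <= m)%N by case: (hF N) => -[].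
have Fr N : nrm (F N) <= nrm r by case: (hF N) => -[].
have Fev N : ev (F N) = ev r by case: (hF N).
have FG N g : finG g -> dot (F N) g = 0 by case: (hF N) => _ _ + _; apply.
have Fgap N j k : (k < N)%N -> ((F N)`_j)`_(n + k) = 0 by case: (hF N) => _ _ _; apply.
have [a [am an acvg]] := coef_limit FA Fm Fr Fgap Uoo.
rewrite -(ev_limit FA Fm Fr Fev Fgap Uoo an acvg).
by rewrite (limit_eq0 FA Fm Fr FG am an acvg) hev0.
Qed.

End KeyOrthogonality.

(** * Riesz representation of [ev] on G *)

Section Eigenvector.
Variables (R : realType) (n m : nat) (p : {poly {poly R[i]}}).
Hypothesis ss : semi_stable n m p.
Hypothesis m_gt0 : (0 < m)%N.
Local Notation pt := (ptilde n m p).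
Local Notation D := (bezD m p pt).
Local Notation inA := (inA p).
Local Notation dot := (dot p).
Local Notation nrm := (nrm p).
Local Notation quo := (quo p).
Local Notation finG := (finG n m p).
Implicit Types (f g h r y : {poly {poly R[i]}}).

Let mT : @measurable _ (measurableTypeR R * measurableTypeR R)%type (@torus_dom R) :=
  @measurable_torus R.

(** |z1 - w| is bounded below on the circle. The bound is [zero_free_bounds] for the polynomial X -
    z1 of size 2, evaluated at w. *)
Lemma inA_XsubC (w : R[i]) f : `|w| < 1 -> inA (('X - w%:P)%:P * f) -> inA f.
Proof.
move=> w1; pose b := Num.sqrt (sqnorm w); pose M := ((1 - b) ^+ 2 ^+ 2)^-1.
have b1 : 0 < 1 - b by rewrite subr_gt0 -sqrtr1 ltr_sqrt// sqnorm_lt1.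
have bnd (x : R) : (1 - b) ^+ 2 ^+ 2 <= sqnorm (tor x - w).
  have [z z1|_ /(_ w (sqnorm_lt1 w1))] := @zero_free_bounds R ('X - (tor x)%:P) 2 (eq_leq (size_XsubC _)).
    rewrite hornerXsubC subr_eq0; apply: contraTneq z1 => ->.
    by rewrite sqnorm_tor ltxx.
  by rewrite !hornerXsubC sub0r sqnormN sqnorm_tor mulr1 -(sqnormN (w - _)) opprB.
have M0 : 0 < (1 - b) ^+ 2 ^+ 2 by rewrite !exprn_gt0.
have nz (x : R) : tor x - w != 0.
  by rewrite -sqnorm_eq0 gt_eqF// (lt_le_trans M0).
pose F (t : R * R) := (tor t.1 - w)^-1.
have mF : cmeas (@torus_dom R) F.
  apply: cmeasV; apply: cmeasB; last exact: cmeas_cst.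
  exact: (cmeas_tor (@measurable_fst_torus R)).
have bF t : @torus_dom R t -> sqnorm (F t) <= M.
  by move=> _; rewrite sqnormV lef_pV2 ?posrE// (lt_le_trans M0).
move=> fA; have := sqintM_bounded mT mF bF fA; apply: (eq_sqint mT) => t _.
by rewrite quo_polyC hornerXsubC mulrA mulVf// mul1r.
Qed.

Variables (w v : R[i]).
Hypothesis w1 : `|w| < 1.
Hypothesis hp : hev w v m p = 0.
Hypothesis hpt : hev w v m pt = 0.
Local Notation ev := (hev w v m.-1).

Lemma size_polyC_mul (c : {poly R[i]}) h : (size h <= m)%N -> (size (c%:P * h)%R <= m)%N.
Proof. by move=> sh; rewrite mul_polyC; exact: leq_trans (size_scale_leq _ _) sh. Qed.

(** Dividing all factors z1 - w out of D z2^(m-1) stays in the space and leaves q with q(w) <> 0.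
    The power z2^(m-1) is the one weighted by v^0, so v = 0 is covered. *)
Lemma ev_neq0 : exists2 h, inA h /\ (size h <= m)%N & ev h != 0.
Proof.
have [k [q qw DE]] := multiplicity_XsubC D w.
have D0 := bezD_neq0 ss; rewrite D0 /= in qw.
pose h : {poly {poly R[i]}} := q%:P * 'X^(m.-1).
exists h; last first.
  rewrite hevZ; apply: mulf_neq0; first exact: qw.
  by rewrite -['X^_]mul1r -{1}[m.-1]add0n hevXn /hev big_ord1 coefC hornerC mulr1 oner_neq0.
split; last by apply: size_polyC_mul; rewrite size_polyXn prednK.
have := inA_D ss m_gt0 'X^(m.-1); rewrite DE; elim: k {DE} => [|k IH].
  by rewrite expr0 mulr1.
move=> hA; apply: IH; apply: (inA_XsubC w1); move: hA.
by rewrite exprS mulrCA polyCM mulrA.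
Qed.

Lemma finG_projection h : inA h ->
  exists2 q, finG q & forall g, finG g -> dot (h - q) g = 0.
Proof.
move=> hA; have [s [sG Gs]] := subspace_spanned (finG_lin n m p)
  (fun f => fun '(And3 a b _) => conj a b).
have [|q sq oq] := @projection R p s h _ hA; first by move=> x /sG[].
by exists q => [|g /Gs]; [exact: (spanned_closed (finG_lin n m p) sG sq)|exact: oq].
Qed.

Lemma ev_projection h q : inA h -> (size h <= m)%N -> finG q ->
  (forall g, finG g -> dot (h - q) g = 0) -> ev q = ev h.
Proof.
move=> hA sh [sq _ qA] oq.
have sr : (size (h - q)%R <= m)%N.
  by apply: leq_trans (size_polyD _ _) _; rewrite size_polyN geq_max sh.
have := ev_orthogonal ss m_gt0 w1 hp hpt (inAB hA qA) sr oq.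
by rewrite hevD hevN => /eqP; rewrite subr_eq0 => /eqP.
Qed.

(** In the finite-dimensional G, e is the part of g0 orthogonal to the kernel of [ev]. The identity
    extends from G to all admissible h because projection onto G preserves [ev]. *)
Lemma ev_riesz : exists f, [/\ finG f, f != 0 &
  forall h, inA h -> (size h <= m)%N -> dot h f = ev h].
Proof.
have [h0 [h0A sh0] h00] := ev_neq0.
have [g0 g0G og0] := finG_projection h0A.
have ev0 : ev g0 != 0 by rewrite (ev_projection h0A sh0 g0G og0).
have g0A : inA g0 by case: g0G.
pose S g := finG g /\ ev g = 0.
have [G0 GL] := finG_lin n m p.
have Sl : lin_closed S.
  split=> [|c f g [fG f0] [gG gg0]]; first by split; [exact: G0|exact: hev0].
  by split; [exact: GL|rewrite hevD hevZ f0 gg0 mulr0 addr0].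
have [s [sS Ss]] := subspace_spanned Sl (fun f => fun '(conj (And3 a b _) _) => conj a b).
have [|k sk ok] := @projection R p s g0 _ g0A; first by move=> x /sS[[]].
have [kG k0] := spanned_closed Sl sS sk.
have kA : inA k by case: kG.
pose e := g0 - k; have eA : inA e by exact: inAB.
have eG : finG e.
  have -> : e = (-1)%:P%:P * k + g0 by rewrite !polyCN !polyC1 /e; ring.
  exact: GL.
have eve : ev e = ev g0 by rewrite hevD hevN k0 subr0.
have ee : dot e e != 0.
  apply/eqP => e0; have := nrm0_dot eA.
  have ne0 : nrm e = 0 by move: e0; rewrite dot_self => -[].
  have [C C0 hC] := coef_bound ss m_gt0.
  have e00 : e = 0.
    apply/polyP => j; apply/polyP => i; rewrite !coef0; apply/eqP.
    rewrite -sqnorm_eq0 eq_le sqnorm_ge0 andbT.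
    have se : (size e <= m)%N by case: eG.
    by apply: le_trans (hC _ i j eA se) _; rewrite ne0 mulr0.
  by move: ev0; rewrite -eve e00 hev0 eqxx.
(* Chosen so that <e, c e> = ev e; the second argument is conjugate-linear. *)
pose c := conjc (ev e / dot e e).
have c0 : c != 0.
  rewrite conjc_eq0; apply: mulf_neq0; first by rewrite eve.
  by rewrite invr_eq0.
have fG : finG (c%:P%:P * e) by have := GL c e 0 eG G0; rewrite addr0.
have dG h : finG h -> dot h (c%:P%:P * e) = ev h.
  move=> hG; have hA : inA h by case: hG.
  rewrite (dotZr c eA hA) /c conjcK.
  pose a := ev h / ev e; pose k' := (- a)%:P%:P * e + h.
  have k'G : finG k' by exact: GL.
  have k'A : inA k' by case: k'G.
  have evk' : ev k' = 0 by rewrite hevD hevZ hornerC /a mulNr divfK ?eve// addNr.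
  have ek' : dot k' e = 0 by rewrite (dotJ eA k'A) ok ?conjc0//; exact: Ss.
  have -> : h = a%:P%:P * e + k' by rewrite /k' !polyCN; ring.
  rewrite (dotDl (inAM _ eA) k'A eA) (dotZl _ eA eA) ek' addr0.
  by rewrite (hevD _ _ _ (a%:P%:P * e)) hevZ hornerC evk' addr0 mulrCA divfK.
exists (c%:P%:P * e); split => //.
  apply: mulf_neq0; last by apply: contraNneq ee => ->; rewrite dot0l.
  by rewrite !polyC_eq0.
move=> h hA sh; have [q qG oq] := finG_projection hA.
have qA : inA q by case: qG.
have fA : inA (c%:P%:P * e) by case: fG.
rewrite -{1}(subrK q h) (dotDl (inAB hA qA) qA fA) (oq _ fG) add0r (dG q qG).
exact: ev_projection.
Qed.
End Eigenvector.

(** * Multiplication by z1 and z2 against the representing vector *)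

Section ShiftRelations.
Variables (R : realType) (n m : nat) (p : {poly {poly R[i]}}).
Hypothesis ss : semi_stable n m p.
Hypothesis m_gt0 : (0 < m)%N.
Local Notation inA := (inA p).
Local Notation dot := (dot p).
Local Notation nrm := (nrm p).
Local Notation quo := (quo p).
Variables (w v : R[i]).
Hypothesis hp : hev w v m p = 0.
Local Notation ev := (hev w v m.-1).
Implicit Types (f g h : {poly {poly R[i]}}).

Let mT : @measurable _ (measurableTypeR R * measurableTypeR R)%type (@torus_dom R) :=
  @measurable_torus R.

(** After conjugation p/p cancels, and z2 f/p has mean 0 in z2. *)
Lemma dot_p_z2 (c : {poly R[i]}) f : inA f -> dot (c%:P * p) ('X * f) = 0.
Proof.
move=> fA.
have z := tint_quo_eq0 ss m_gt0 c 0 fA.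
have XfA : inA ('X * f) by exact: inAM.
have cpA : inA (c%:P * p) by apply: inAM; exact: inA_p.
rewrite (dotJ XfA cpA) -[RHS]conjc0 -z; congr conjc.
have [M hM] := horner_tor_bounded c.
have i1 : cintegrable (@leb2 R) (@torus_dom R)
    (fun t => quo ('X * f) t * conjc (quo (c%:P * p) t)).
  exact: (cintegrable_mulJ mT XfA cpA).
have i2 : cintegrable (@leb2 R) (@torus_dom R)
    (fun t => conjc c.[tor t.1] * tor t.2 ^+ 1 * quo f t).
  apply: (cintegrable_quoM (M := M)) => //.
    apply: cmeasM; first apply: cmeasJ.
      by apply: cmeas_horner; exact: (cmeas_tor (@measurable_fst_torus R)).
    by apply: cmeasX; exact: (cmeas_tor (@measurable_snd_torus R)).
  by move=> t _; rewrite sqnormM sqnormX sqnormJ sqnorm_tor expr1n mulr1 hM ?sqnorm_tor.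
apply/eqP; rewrite -subr_eq0 -[dot _ _]/(cint _ _ _) -(cintB mT i1 i2); apply/eqP.
apply: (tint_eq0_off ss); first exact: (cintegrableB mT i1 i2).
move=> t Tt nb; have P0 := tev_p_neq0 ss m_gt0 Tt nb.
rewrite (quoM p 'X f) (quo_polyC p c p) {2}/quo divff// mulr1 expr1.
have -> : tev 'X t = tor t.2 by rewrite -['X]expr1 /tev eval2Xn.
by ring.
Qed.

Lemma factor_X f : f`_0 = 0 -> exists h, f = 'X * h.
Proof.
move=> f0; exists (\poly_(j < (size f).-1) f`_j.+1); apply/polyP => -[|j].
  by rewrite f0 mulrC coefMX.
rewrite mulrC coefMX /= coef_poly; case: ltnP => // h.
by rewrite nth_default//; lia.
Qed.

Variable f : {poly {poly R[i]}}.
Hypothesis fA : inA f.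
Hypothesis fE : forall h, inA h -> (size h <= m)%N -> dot h f = ev h.

Lemma dot_z1_riesz h : inA h -> (size h <= m)%N -> dot ('X%:P * h) f = w * dot h f.
Proof.
move=> hA sh; rewrite (fE (inAM _ hA)) ?size_polyC_mul// hevZ hornerX fE//.
Qed.

(* Writing p_0 g - g_0 p = z_2 h, both g_0 p and z_2 h are tested against
   z_2 f - conj v f: the first is harmless since g_0 p / p has no z_2-frequency. *)
Lemma dot_p0_z2_riesz g : inA g -> (size g <= m)%N ->
  dot ((p`_0)%:P * g) ('X * f) = v * dot ((p`_0)%:P * g) f.
Proof.
move=> gA sg.
have [h hE] : exists h, (p`_0)%:P * g - (g`_0)%:P * p = 'X * h.
  by apply: factor_X; rewrite coefB !coefCM mulrC subrr.
have p0A : inA ((p`_0)%:P * g) by exact: inAM.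
have g0A : inA ((g`_0)%:P * p) by apply: inAM; exact: inA_p.
have XhA : inA ('X * h) by rewrite -hE; exact: inAB.
have hA : inA h.
  apply: inA_sqnorm XhA => t; rewrite (tevM 'X h) sqnormM.
  by rewrite -['X]expr1 sqnorm_tev_z2 mul1r.
have XfA : inA ('X * f) by exact: inAM.
have sh : (size h <= m)%N.
  have [->|h0] := eqVneq h 0; first by rewrite size_poly0.
  have : (size ('X * h)%R <= m.+1)%N.
    rewrite -hE; apply: leq_trans (size_polyD _ _) _; rewrite size_polyN geq_max.
    rewrite (leq_trans (size_polyC_mul _ sg))//= mul_polyC.
    exact: leq_trans (size_scale_leq _ _) (eq_leq (ss_size ss)).
  by rewrite mulrC size_mulX.
have E : dot ('X * h) ('X * f) = dot h f.
  by apply: dot_unimodular => t; rewrite -['X]expr1 sqnorm_tev_z2.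
(* In formal degree m, z2 h evaluates as h does in degree m - 1, p contributes 0, and raising the
   formal degree of p_0 g costs a factor v. *)
have evh : ev h = v * ev ((p`_0)%:P * g).
  have mE : m = (m.-1 + 1)%N by rewrite addn1 prednK.
  have := congr1 (hev w v m) hE.
  rewrite [in RHS]mulrC -['X]expr1 [in RHS]mE hevXn => <-.
  rewrite hevD hevN (hevZ _ _ _ g`_0) hp mulr0 subr0 [X in hev w v X _]mE hev_wide ?expr1//.
  by rewrite prednK// size_polyC_mul.
have split_ : (p`_0)%:P * g = 'X * h + (g`_0)%:P * p by rewrite -hE subrK.
rewrite {1}split_ (dotDl XhA g0A XfA) E dot_p_z2// addr0.
by rewrite fE// evh fE// size_polyC_mul.
Qed.

Lemma dot_z2_riesz g : inA g -> (size g <= m)%N -> dot g ('X * f) = v * dot g f.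
Proof.
move=> gA sg; pose e := 'X * f - (conjc v)%:P%:P * f.
have XfA : inA ('X * f) by exact: inAM.
have cfA : inA ((conjc v)%:P%:P * f) by exact: inAM.
have eA : inA e by exact: inAB.
have dote h : inA h -> dot h e = dot h ('X * f) - v * dot h f.
  by move=> hA; rewrite (dotBr XfA cfA hA) (dotZr _ fA hA) conjcK.
pose u k := dot (('X^k)%:P * g) e.
have kA k : inA (('X^k)%:P * g) by exact: inAM.
suff : u 0 = 0.
  by rewrite /u expr0 mul1r dote// => /eqP; rewrite subr_eq0 => /eqP.
have p00 z : sqnorm z <= 1 -> (p`_0).[z] != 0 by exact: (ss_coef0_neq0 ss).
have p0 : p`_0 != 0.
  by apply/eqP => h; have := @p00 0; rewrite h horner0 eqxx sqnorm0 ler01 => /(_ isT).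
(* Multiplication by z1^k is isometric, hence a bound uniform in k. *)
apply: (@bounded_recur_eq0 R u p`_0 (nrm g * nrm e) p0 p00) => k.
  apply: le_trans (dot_CauchySchwarz (kA k) eA) _.
  by rewrite nrm_unimodular//; exact: sqnorm_tev_Xn.
have : dot ((p`_0)%:P * (('X^k)%:P * g)) e = 0.
  by rewrite (dote _ (inAM _ (kA k))) (dot_p0_z2_riesz (kA k) (size_polyC_mul _ sg)) subrr.
move=> z; rewrite -[RHS]z /recur.
have -> : (p`_0)%:P * (('X^k)%:P * g) =
    \sum_(i < size p`_0) ((p`_0)`_i)%:P%:P * (('X^(k + i))%:P * g).
  rewrite -{1}[p`_0]coefK poly_def rmorph_sum /= mulr_suml; apply: eq_bigr => i _.
  by rewrite -mul_polyC exprD !polyCM; ring.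
rewrite dot_suml//; last by move=> i _; exact: inAM.
by apply: eq_bigr => i _; rewrite dotZl.
Qed.

End ShiftRelations.

(** * From inner products to the compressed shifts, and the reflection on G *)

Section Relations.
Variables (R : realType) (n m : nat) (p : {poly {poly R[i]}}).
Local Notation inA := (inA p).
Local Notation dot := (dot p).
Local Notation quo := (quo p).
Local Notation finG := (finG n m p).
Implicit Types (f g h s : {poly {poly R[i]}}).

Let mT : @measurable _ (measurableTypeR R * measurableTypeR R)%type (@torus_dom R) :=
  @measurable_torus R.

Lemma ip_dot f g : ip p (eval2 f) (eval2 g) = (((4 * pi ^+ 2)^-1)%:C)%C * dot f g.
Proof.
rewrite -[dot f g]/(cint _ _ _) /ip /cint.
have E (t : R * R) : eval2 f (tor t.1) (tor t.2) * conjc (eval2 g (tor t.1) (tor t.2)) *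
    Complex (weight p t) 0 = quo f t * conjc (quo g t).
  rewrite /quo /weight -/(tev f t) -/(tev g t) -/(tev p t).
  rewrite (conjcM (tev g t)) conjcV mulrACA; congr (_ * _).
  by rewrite -invfM mulJ_sqnorm -(fmorphV (real_complex R)).
under [X in Complex (_ * X)]eq_Rintegral do rewrite E.
under [X in Complex _ (_ * X)]eq_Rintegral do rewrite E.
by apply: complex_ext; rewrite ?ReM ?ImM ReR ImR mul0r ?subr0 ?addr0.
Qed.

Lemma inG_finG f : inG n m p f <-> finG f.
Proof.
have E (t : R * R) : sqnorm (quo f t) = sqnorm (eval2 f (tor t.1) (tor t.2)) * weight p t.
  by rewrite /quo sqnormM sqnormV.
split=> -[sf sfj H]; split => //.
  split; first exact: cmeas_quo.
  apply/integrableP; split; first exact/measurable_EFinP/measurable_sqnorm/cmeas_quo.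
  apply: le_lt_trans H; rewrite le_eqVlt; apply/orP; left; apply/eqP.
  by apply: eq_integral => t _ /=; rewrite ger0_norm ?sqnorm_ge0// E.
case: H => _ /integrableP[_]; apply: le_lt_trans.
rewrite le_eqVlt; apply/orP; left; apply/eqP.
by apply: eq_integral => t _ /=; rewrite ger0_norm ?sqnorm_ge0// E.
Qed.

Lemma ip_eq f g f' g' : dot f g = dot f' g' ->
  ip p (eval2 f) (eval2 g) = ip p (eval2 f') (eval2 g').
Proof. by rewrite !ip_dot => ->. Qed.

Lemma ip_shift s f g h : ip p (fun z1 z2 => eval2 s z1 z2 * eval2 f z1 z2 - eval2 g z1 z2)
  (eval2 h) = (((4 * pi ^+ 2)^-1)%:C)%C * dot (s * f - g) h.
Proof.
have E : (fun z1 z2 => eval2 s z1 z2 * eval2 f z1 z2 - eval2 g z1 z2) = eval2 (s * f - g).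
  by apply/funext => a; apply/funext => b; rewrite eval2B eval2M.
by rewrite E ip_dot.
Qed.

Lemma Trel_dot s f g : finG f -> finG g ->
  (forall h, finG h -> dot (s * f) h = dot g h) -> Trel n m p (eval2 s) f g.
Proof.
move=> [_ _ fA] gG H; split; first exact/inG_finG.
move=> h /inG_finG hG; have hA : inA h by case: hG.
have gA : inA g by case: gG.
by rewrite ip_shift dotBl ?H ?subrr ?mulr0//; exact: inAM.
Qed.

Lemma Trel_dotE s f g h : finG f -> Trel n m p (eval2 s) f g -> finG h ->
  dot h g = dot h (s * f).
Proof.
move=> [_ _ fA] [/inG_finG gG H] hG; have hA : inA h by case: hG.
have gA : inA g by case: gG.
have := H h (iffRL (inG_finG h) hG); rewrite ip_shift => /eqP.
have c0 : (((4 * pi ^+ 2)^-1)%:C)%C != 0 :> R[i].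
  by rewrite -sqnorm_eq0 /sqnorm /= expr0n addr0 sqrf_eq0 invr_eq0 gt_eqF// vol_gt0.
rewrite mulf_eq0 (negPf c0) /= => /eqP.
have sA : inA (s * f) by exact: inAM.
rewrite (dotBl sA gA hA) => /eqP; rewrite subr_eq0 => /eqP e.
by rewrite (dotJ gA hA) -e -(dotJ sA hA).
Qed.

Lemma adjrel_dot s f g : finG f -> finG g ->
  (forall h, finG h -> dot g h = dot f (s * h)) ->
  adjrel n m p (Trel n m p (eval2 s)) f g.
Proof.
move=> fG gG H; split; first exact/inG_finG.
move=> h k /inG_finG hG hk; apply: ip_eq.
by rewrite (Trel_dotE hG hk fG) H.
Qed.

Lemma T1relE : T1rel n m p = Trel n m p (eval2 'X%:P).
Proof.
by rewrite /T1rel; congr Trel; apply/funext => a; apply/funext => b; rewrite eval2C hornerX.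
Qed.

Lemma T2relE : T2rel n m p = Trel n m p (eval2 'X).
Proof.
rewrite /T2rel; congr Trel; apply/funext => a; apply/funext => b.
by rewrite -['X]expr1 eval2Xn.
Qed.

Lemma finGZ (c : R[i]) f : finG f -> finG (c%:P%:P * f).
Proof.
by have [G0 GL] := finG_lin n m p; move=> fG; have := GL c f 0 fG G0; rewrite addr0.
Qed.

Lemma finG_ptilde f : (0 < n)%N -> (0 < m)%N -> finG f -> finG (ptilde n.-1 m.-1 f).
Proof.
move=> n0 m0 [sf sfj fA]; split.
- by apply: leq_trans (size_poly _ _) _; rewrite prednK.
- move=> j; rewrite coef_poly; case: ifP => _; last by rewrite size_poly0.
  by apply: leq_trans (size_poly _ _) _; rewrite prednK.
- by apply: inA_ptilde => // [|j]; rewrite prednK.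
Qed.

Lemma ptildeK f : (0 < n)%N -> (0 < m)%N -> finG f ->
  ptilde n.-1 m.-1 (ptilde n.-1 m.-1 f) = f.
Proof.
move=> n0 m0 [sf sfj _]; apply/polyP => j; rewrite coef_poly prednK//.
case: ltnP => jm; last by rewrite nth_default// (leq_trans sf).
apply/polyP => i; rewrite coef_poly prednK//.
case: ltnP => im; last by rewrite nth_default// (leq_trans (sfj j)).
rewrite coef_poly prednK// (_ : (m.-1 - j < m)%N); last by lia.
rewrite coef_poly prednK// (_ : (n.-1 - i < n)%N); last by lia.
by rewrite conjcK !subKn//; lia.
Qed.

(** Pointwise the reflection of f is z1^(n-1) z2^(m-1) conj f. It exchanges f and g while the
    multipliers s and r keep their places, which turns a relation for a shift into one for its
    adjoint. *)
Lemma dot_ptilde f g s r : (0 < n)%N -> (0 < m)%N -> finG f -> finG g ->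
  dot (s * ptilde n.-1 m.-1 f) (r * ptilde n.-1 m.-1 g) = dot (s * g) (r * f).
Proof.
move=> n0 m0 [sf sfj _] [sg sgj _]; apply: eq_cint => t _.
rewrite (quoM p s) (quoM p r) (quoM p s) (quoM p r).
have E h : (size h <= m)%N -> (forall j, (size (h`_j)%R <= n)%N) ->
    quo (ptilde n.-1 m.-1 h) t = tor t.1 ^+ n.-1 * tor t.2 ^+ m.-1 *
      conjc (tev h t) / tev p t.
  move=> sh shj; rewrite /quo /tev eval2_ptilde ?sqnorm_tor// ?prednK//.
rewrite (E f sf sfj) (E g sg sgj) /quo.
rewrite !(conjcM, conjcV, conjcK).
set x := tor t.1 ^+ n.-1; set y := tor t.2 ^+ m.-1.
have xx : x * conjc x = 1 by rewrite mulJ_sqnorm sqnormX sqnorm_tor expr1n.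
have yy : y * conjc y = 1 by rewrite mulJ_sqnorm sqnormX sqnorm_tor expr1n.
move: (tev s t) (conjc (tev r t)) (tev g t) (conjc (tev f t)) (tev p t)^-1
  (conjc (tev p t))^-1 (conjc x) (conjc y) xx yy => s' r' g' f' P P' x' y' xx yy.
transitivity ((x * x') * (y * y') * (s' * (g' * P) * (r' * (f' * P')))).
  by ring.
by rewrite xx yy !mul1r; ring.
Qed.

Lemma dot_ptilde_l f g s : (0 < n)%N -> (0 < m)%N -> finG f -> finG g ->
  dot (s * ptilde n.-1 m.-1 f) (ptilde n.-1 m.-1 g) = dot (s * g) f.
Proof.
move=> n0 m0 fG gG; have := dot_ptilde s 1 n0 m0 fG gG.
by rewrite (mul1r (ptilde _ _ g)) (mul1r f).
Qed.

Lemma dot_ptilde_r f g r : (0 < n)%N -> (0 < m)%N -> finG f -> finG g ->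
  dot (ptilde n.-1 m.-1 f) (r * ptilde n.-1 m.-1 g) = dot g (r * f).
Proof.
move=> n0 m0 fG gG; have := dot_ptilde 1 r n0 m0 fG gG.
by rewrite (mul1r (ptilde _ _ f)) (mul1r g).
Qed.

End Relations.

(** * The two joint eigenvectors attached to a common zero *)

Lemma hev_zero_at (R : realType) (m : nat) (f : {poly {poly R[i]}}) (a : R[i]) w :
  (size f <= m.+1)%N -> in_Dinv w -> zero_at m f a w -> hev a (inv_opt w) m f = 0.
Proof.
case: w => [b|] sf /= => [b1|_] f0; last first.
  rewrite /hev big_ord_recr /= subnn expr0 mulr1 f0 addr0 big1// => j _.
  by rewrite expr0n subn_eq0 leqNgt ltn_ord mulr0.
have b0 : b != 0 by rewrite -normr_gt0 (lt_trans ltr01).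
rewrite /hev; transitivity (b^-1 ^+ m * eval2 f a b); last by rewrite f0 mulr0.
rewrite (eval2_coef _ _ sf) mulr_sumr; apply: eq_bigr => j _.
have jm : (j <= m)%N by rewrite -ltnS.
rewrite mulrCA; congr (_ * _).
have -> : b^-1 ^+ m = b^-1 ^+ (m - j) * b^-1 ^+ j by rewrite -exprD subnK.
by rewrite -mulrA -exprMn mulVf// expr1n mulr1.
Qed.

Theorem theorem10p2 (R : realType) (n m : nat) (p : {poly {poly R[i]}})
  (w1 : R[i]) (w2 : option R[i]) :
  semi_stable n m p ->
  `|w1| < 1 -> in_Dinv w2 ->
  zero_at m p w1 w2 -> zero_at m (ptilde n m p) w1 w2 ->
  joint_eig n m p (adjrel n m p (T1rel n m p)) (T2rel n m p)
            (conjc w1) (conjc (inv_opt w2)) /\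
  joint_eig n m p (T1rel n m p) (adjrel n m p (T2rel n m p))
            w1 (inv_opt w2).
Proof.
move=> ss w11 w2D zp zpt; set v := inv_opt w2.
have hp : hev w1 v m p = 0 := hev_zero_at (eq_leq (ss_size ss)) w2D zp.
have hpt : hev w1 v m (ptilde n m p) = 0 := hev_zero_at (size_pt n m p) w2D zpt.
(* For m = 0 the hypothesis would give a zero of p(z1, 0) in the closed disc. *)
have m0 : (0 < m)%N.
  rewrite lt0n; apply/eqP => m0; move: hp; rewrite m0 /hev big_ord1 mulr1.
  by apply/eqP; apply: (ss_coef0_neq0 ss); rewrite ltW// sqnorm_lt1.
have [f [fG f0 fE]] := ev_riesz ss m0 w11 hp hpt.
have [sf sfj fA] := fG.
(* For n = 0 the space G is trivial, against f <> 0. *)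
have n0 : (0 < n)%N.
  rewrite lt0n; apply: contra_neq f0 => n0; apply/polyP => j; rewrite coef0.
  by apply/eqP; rewrite -size_poly_eq0 -leqn0 -n0.
have Z1 h : finG n m p h -> dot p ('X%:P * h) f = w1 * dot p h f.
  by move=> [sh _ hA]; exact: (dot_z1_riesz fE).
have Z2 h : finG n m p h -> dot p h ('X * f) = v * dot p h f.
  by move=> [sh _ hA]; exact: (dot_z2_riesz ss m0 hp fA fE).
have Xf s : inA p (s * f) by exact: inAM.
rewrite T1relE T2relE; split.
  exists f; split => //; first exact/inG_finG.
    apply: adjrel_dot => [//||h hG]; first exact: finGZ.
    have hA : inA p h by case: hG.
    rewrite (dotJ (inAM 'X%:P hA) fA) Z1// conjcM -(dotJ hA fA).
    exact: dotZl.
  apply: Trel_dot => [//||h hG]; first exact: finGZ.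
  have hA : inA p h by case: hG.
  by rewrite (dotJ hA (Xf 'X)) Z2// conjcM -(dotJ hA fA) dotZl.
have FG : finG n m p (ptilde n.-1 m.-1 f) := finG_ptilde n0 m0 fG.
(* The reflection is an involution of G, so every test vector may be taken to be a reflection. *)
have refl h : finG n m p h -> exists2 k, finG n m p k & h = ptilde n.-1 m.-1 k.
  move=> hG; exists (ptilde n.-1 m.-1 h); first exact: finG_ptilde.
  by rewrite (ptildeK n0 m0 hG).
exists (ptilde n.-1 m.-1 f); split; first exact/inG_finG.
- apply: contra_neq f0 => F0; rewrite -(ptildeK n0 m0 fG) F0.
  apply/polyP => j; rewrite coef_poly !coef0; case: ifP => // _.
  by apply/polyP => i; rewrite coef_poly !coef0 conjc0; case: ifP.
- apply: Trel_dot => [//||_ /refl[k kG ->]]; first exact: finGZ.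
  have kA : inA p k by case: kG.
  rewrite [LHS](dot_ptilde_l _ n0 m0 fG kG) [RHS](dot_ptilde_l _ n0 m0 fG kG).
  by rewrite [LHS](Z1 k kG) [RHS](dotZl _ kA fA).
- apply: adjrel_dot => [//||_ /refl[k kG ->]]; first exact: finGZ.
  have kA : inA p k by case: kG.
  rewrite [LHS](dot_ptilde_l _ n0 m0 fG kG) [RHS](dot_ptilde_r _ n0 m0 fG kG).
  by rewrite [LHS](dotZl _ kA fA) [RHS](Z2 k kG).
Qed.
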